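(* Let $E,F,G$ be Banach spaces, $\alpha$ a uniform crossnorm and $(\pi_n)$ a sequence of partitions of $\mathbb R_{\ge0}$. Let $X\in D(\mathbb R_{\ge0},E)$ and let $A\colon\mathbb R_{\ge0}\to F$ be a càdlàg path of finite variation. Let $f\colon F\times E\to G$ be a function satisfying: (i) the restriction of $f$ to each compact subset of $F\times E$ is Lipschitz continuous; (ii) for each $a$ the map $x\mapsto f(a,x)$ is Gâteaux differentiable and $D_xf\in C_{\mathcal K}(F\times E,\mathcal L(E,G))$. Suppose that $(\pi_n)$ satisfies either $\lim_{n\to\infty}|\pi_n|=0$ or $\lim_{n\to\infty}O^-_t((A,X),\pi_n)=0$ for all $t\ge0$. If $X$ has strong (resp. weak) $\alpha$-tensor quadratic variation ${}^\alpha[X,X]$ and finite 2-variation along $(\pi_n)$, then $f(A,X)$ has the strong (resp. weak) $\alpha$-tensor quadratic variation along $(\pi_n)$, given by $${}^\alpha[f(A,X),f(A,X)]_t=\int_0^tD_xf(A_{s-},X_{s-})^{\otimes2}\,\mathrm d\,{}^\alpha[X,X]^{\mathrm c}_s+\sum_{0<s\le t}(\Delta f(A,X)_s)^{\otimes2},\qquad t\ge0.$$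
   Context: Banach spaces are real. A uniform crossnorm $\alpha$ is an assignment of a reasonable crossnorm on $E\otimes F$ to every pair of Banach spaces $(E,F)$ (i.e. $\alpha(x\otimes y)\le\|x\|\|y\|$ and $x^*\otimes y^*$ is $\alpha$-bounded with norm $\le\|x^*\|\|y^*\|$) such that for all $T\in\mathcal L(E_1,E_2)$, $S\in\mathcal L(F_1,F_2)$, $T\otimes S$ extends to a bounded operator $E_1\widehat\otimes_\alpha F_1\to E_2\widehat\otimes_\alpha F_2$ with $\|T\otimes S\|\le\|T\|\|S\|$. $E\widehat\otimes_\alpha F$ is the $\alpha$-completion of $E\otimes F$; $T^{\otimes2}=T\otimes T$, $v^{\otimes2}=v\otimes v$. $C_{\mathcal K}(S,S')$ is the set of functions $S\to S'$ whose restriction to each compact subset of $S$ is continuous. A partition of $\mathbb R_{\ge0}$ is $\pi=\{\,]t_i,t_{i+1}]:i\in\mathbb N\}$ with $0=t_0<t_1<\dots\to\infty$; $|\pi|=\sup_{]r,s]\in\pi}|s-r|$. $D(\mathbb R_{\ge0},E)$ is the set of càdlàg $E$-valued paths; $\Delta X_t=X_t-X_{t-}$ ($t>0$), $\Delta X_0=0$; $\delta X_t(]r,s])=X_{s\wedge t}-X_{r\wedge t}$. $O^-_t(Z,\pi)=\sup_{]r,s]\in\pi}\sup_{u,v\in[r,s[\,\cap[0,t]}\|Z_u-Z_v\|$. Finite variation means finite total variation on compact intervals. $f(A,X)$ is the path $t\mapsto f(A_t,X_t)$ and $\Delta f(A,X)_s$ its jump. A càdlàg $X$ in $E$ has strong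 (weak) $\alpha$-tensor quadratic variation along $(\pi_n)$ if there is an $E\widehat\otimes_\alpha E$-valued càdlàg path ${}^\alpha[X,X]$ of finite variation with $\sum_{I\in\pi_n}\delta X_t(I)\otimes\delta X_t(I)\to{}^\alpha[X,X]_t$ in norm (weakly) for every $t\ge0$, and $\Delta\,{}^\alpha[X,X]_t=\Delta X_t\otimes\Delta X_t$ for all $t$. $X$ has finite 2-variation along $(\pi_n)$ if $\sup_n\sum_{I\in\pi_n}\|\delta X_t(I)\|^2<\infty$ for all $t\ge0$. For a finite variation càdlàg path $Z$, $Z^{\mathrm c}_t=Z_t-\sum_{0<s\le t}\Delta Z_s$; integrals $\int_0^t$ against finite variation paths are vector Stieltjes integrals over $]0,t]$. *)

(* Defs.v *)
From HB Require Import structures.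
From mathcomp Require Import all_boot all_order all_algebra.
From mathcomp Require Import all_classical all_reals all_analysis.
From mathcomp.analysis.showcase Require summability.

Set Implicit Arguments.
Unset Strict Implicit.
Unset Printing Implicit Defensive.

Import Order.TTheory GRing.Theory Num.Theory.
Import numFieldNormedType.Exports.

Local Open Scope classical_set_scope.
Local Open Scope ring_scope.

Section BoundedOperators.
Context {R : realType}.

Definition bounded_operator_pred (E F : normedModType R) : {pred E -> F} :=
  [pred T : E -> F | `[< linear T /\ continuous T >] ].
Arguments bounded_operator_pred : clear implicits.

Record bounded_operator (E F : normedModType R) := BoundedOperator {
  bop_fun :> E -> F;
  bop_funP : bop_fun \in bounded_operator_pred E F }.

Section Lmodule.
Variables E F : normedModType R.

HB.instance Definition _ := [isSub of bounded_operator E F for @bop_fun E F].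
HB.instance Definition _ := [Choice of bounded_operator E F by <:].

Lemma bop_linear (T : bounded_operator E F) : linear T.
Proof. by case: T => T /= /asboolP[]. Qed.

Lemma bop_continuous (T : bounded_operator E F) : continuous T.
Proof. by case: T => T /= /asboolP[]. Qed.

HB.instance Definition _ (T : bounded_operator E F) :=
  GRing.isLinear.Build R E F _ (bop_fun T) (bop_linear T).

Lemma bounded_operator_submod_closed : submod_closed (bounded_operator_pred E F).
Proof.
split.
  apply/asboolP; split; first by move=> a x y /=; rewrite scaler0 addr0.
  by move=> x; exact: cvg_cst.
move=> a T S /asboolP[lT cT] /asboolP[lS cS]; apply/asboolP; split.
  move=> b x y; rewrite /= !fctE lT lS !scalerDr !scalerA addrACA.
  by rewrite (mulrC a b).
move=> x; apply: (@cvgD _ _ _ _ _ (fun y => a *: T y) S).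
  exact: cvgZl_tmp (cT x).
exact: cS.
Qed.

HB.instance Definition _ := GRing.isSubmodClosed.Build _ _
  (bounded_operator_pred E F) bounded_operator_submod_closed.
HB.instance Definition _ :=
  [SubChoice_isSubLmodule of bounded_operator E F by <:].

Definition opnorm (T : bounded_operator E F) : R :=
  sup [set `|T x| | x in [set x : E | `|x| <= 1]].

Lemma bop_addE (T S : bounded_operator E F) x : (T + S) x = T x + S x.
Proof. by []. Qed.

Lemma bop_scaleE a (T : bounded_operator E F) x : (a *: T) x = a *: T x.
Proof. by []. Qed.

Lemma bop0E x : (0 : bounded_operator E F) x = 0.
Proof. by []. Qed.

Lemma opnorm_has_sup (T : bounded_operator E F) :
  has_sup [set `|T x| | x in [set x : E | `|x| <= 1]].
Proof.
split; first by exists `|T 0|, 0; rewrite //= normr0 ler01.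
have /linear_boundedP/pinfty_ex_gt0[M M0 TM] : bounded_near T (nbhs (0 : E)).
  by apply/linear_bounded_continuous; exact: bop_continuous.
by exists M => _ [x /= x1 <-]; rewrite (le_trans (TM x))// ler_piMr// ltW.
Qed.

Lemma opnorm_ge (T : bounded_operator E F) x : `|x| <= 1 -> `|T x| <= opnorm T.
Proof.
by move=> x1; apply: (sup_upper_bound (opnorm_has_sup T)); exists x.
Qed.

Lemma opnorm_le (T : bounded_operator E F) (M : R) :
  (forall x, `|x| <= 1 -> `|T x| <= M) -> opnorm T <= M.
Proof.
move=> TM; apply: ge_sup; first exact: (opnorm_has_sup T).1.
by move=> _ [x x1 <-]; exact: TM.
Qed.

Lemma opnorm_ge0 (T : bounded_operator E F) : 0 <= opnorm T.
Proof. by rewrite (le_trans _ (@opnorm_ge T 0 _)) ?normr0 ?ler01. Qed.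

Lemma ler_opnormD (T S : bounded_operator E F) :
  opnorm (T + S) <= opnorm T + opnorm S.
Proof.
apply: opnorm_le => x x1; rewrite bop_addE (le_trans (ler_normD _ _))//.
by rewrite lerD// opnorm_ge.
Qed.

Lemma opnormZ_le a (T : bounded_operator E F) : opnorm (a *: T) <= `|a| * opnorm T.
Proof.
by apply: opnorm_le => x x1; rewrite bop_scaleE normrZ ler_wpM2l ?opnorm_ge.
Qed.

Lemma opnormZ a (T : bounded_operator E F) : opnorm (a *: T) = `|a| * opnorm T.
Proof.
apply/eqP; rewrite eq_le opnormZ_le /=.
have [->|a0] := eqVneq a 0; first by rewrite normr0 mul0r opnorm_ge0.
rewrite -ler_pdivlMl ?normr_gt0// -normfV (le_trans _ (opnormZ_le _ _))//.
by rewrite scalerA mulVf// scale1r.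
Qed.

Lemma opnorm0_eq0 (T : bounded_operator E F) : opnorm T = 0 -> T = 0.
Proof.
move=> T0; apply/val_inj/funext => x /=.
have [->|x0] := eqVneq x 0; first exact: (linear0 T).
have : `|T (`|x|^-1 *: x)| <= 0.
  by rewrite -T0 opnorm_ge// normrZ normfV normr_id mulVf ?normr_eq0.
rewrite linearZ normr_le0 scaler_eq0 invr_eq0 normr_eq0 (negbTE x0) /=.
by move/eqP.
Qed.

HB.instance Definition _ := Lmodule_isNormed.Build R (bounded_operator E F)
  ler_opnormD opnormZ opnorm0_eq0.

End Lmodule.

End BoundedOperators.

Notation "''L' ( E , F )" := (bounded_operator E F)
  (at level 8, format "''L' ( E ,  F )") : type_scope.

Section Tensor.
Context {R : realType}.

(* The algebraic tensor product is realized in the algebraic dual of the space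
   of bilinear forms, x (x) y being the evaluation at (x, y). *)
Definition tensor_pred (E F : lmodType R) :
    {pred {bilinear E -> F -> R^o} -> R^o} :=
  [pred u : {bilinear E -> F -> R^o} -> R^o |
    `[< exists s : seq (E * F), forall B, u B = \sum_(p <- s) B p.1 p.2 >] ].
Arguments tensor_pred : clear implicits.

Record tensor (E F : lmodType R) := Tensor {
  tensor_fun :> {bilinear E -> F -> R^o} -> R^o;
  tensor_funP : tensor_fun \in tensor_pred E F }.

Section Lmodule.
Variables E F : lmodType R.

HB.instance Definition _ := [isSub of tensor E F for @tensor_fun E F].
HB.instance Definition _ := [Choice of tensor E F by <:].

Lemma tensor_submod_closed : submod_closed (tensor_pred E F).
Proof.
split.
  by apply/asboolP; exists [::] => B; rewrite big_nil.
move=> a u v /asboolP[s us] /asboolP[t vt]; apply/asboolP.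
exists ([seq (a *: p.1, p.2) | p <- s] ++ t) => B.
rewrite big_cat big_map /= !fctE us vt scaler_sumr; congr (_ + _).
by apply: eq_bigr => p _; rewrite linearZl_LR.
Qed.

HB.instance Definition _ := GRing.isSubmodClosed.Build _ _
  (tensor_pred E F) tensor_submod_closed.
HB.instance Definition _ := [SubChoice_isSubLmodule of tensor E F by <:].

Lemma pure_tensor_subproof (x : E) (y : F) :
  (fun B : {bilinear E -> F -> R^o} => B x y) \in tensor_pred E F.
Proof. by apply/asboolP; exists [:: (x, y)] => B; rewrite big_seq1. Qed.

Definition pure_tensor (x : E) (y : F) : tensor E F :=
  Tensor (pure_tensor_subproof x y).

End Lmodule.

Section Map.
Variables E1 E2 F1 F2 : lmodType R.

Section Comp.
Variables (T : {linear E1 -> E2}) (S : {linear F1 -> F2}).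
Variable B : {bilinear E2 -> F2 -> R^o}.

Definition bilinear_comp (x : E1) (y : F1) : R^o := B (T x) (S y).

Lemma bilinear_comp_bilinear : bilinear_for *:%R *:%R bilinear_comp.
Proof.
split=> z a x y; rewrite /bilinear_comp /=.
  by rewrite linearP linearPl.
by rewrite linearP linearPr.
Qed.

HB.instance Definition _ := bilinear_isBilinear.Build R E1 F1 R^o _ _
  bilinear_comp bilinear_comp_bilinear.
End Comp.

Variables (T : {linear E1 -> E2}) (S : {linear F1 -> F2}).

Lemma tensor_map_subproof (u : tensor E1 F1) :
  (fun B : {bilinear E2 -> F2 -> R^o} => u (bilinear_comp T S B))
    \in tensor_pred E2 F2.
Proof.
case: u => u /= /asboolP[s us]; apply/asboolP.
by exists [seq (T p.1, S p.2) | p <- s] => B; rewrite us big_map.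
Qed.

Definition tensor_map (u : tensor E1 F1) : tensor E2 F2 :=
  Tensor (tensor_map_subproof u).

End Map.

Lemma tensor_map_pure (E1 E2 F1 F2 : lmodType R) (T : {linear E1 -> E2})
    (S : {linear F1 -> F2}) (x : E1) (y : F1) :
  tensor_map T S (pure_tensor x y) = pure_tensor (T x) (S y).
Proof. exact: val_inj. Qed.

Section Functional.
Variables (E F : lmodType R) (phi : {linear E -> R^o}) (psi : {linear F -> R^o}).

Definition bilinear_mul (x : E) (y : F) : R^o := phi x * psi y.

Lemma bilinear_mul_bilinear : bilinear_for *:%R *:%R bilinear_mul.
Proof.
split=> z a x y; rewrite /bilinear_mul /= linearP.
  by rewrite mulrDl -scalerAl.
by rewrite mulrDr -scalerAr.
Qed.

HB.instance Definition _ := bilinear_isBilinear.Build R E F R^o _ _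
  bilinear_mul bilinear_mul_bilinear.

Definition tensor_functional (u : tensor E F) : R := u bilinear_mul.

End Functional.

Lemma tensor_functional_pure (E F : lmodType R) (phi : {linear E -> R^o})
    (psi : {linear F -> R^o}) x y :
  tensor_functional phi psi (pure_tensor x y) = phi x * psi y.
Proof. by []. Qed.

End Tensor.

Section Crossnorm.
Context {R : realType}.

Record reasonable_crossnorm (E F : normedModType R) (a : tensor E F -> R) : Prop :=
  ReasonableCrossnorm {
    crossnormD : forall u v, a (u + v) <= a u + a v;
    crossnormZ : forall (c : R) u, a (c *: u) = `|c| * a u;
    crossnorm0_eq0 : forall u, a u = 0 -> u = 0;
    crossnorm_pure : forall x y, a (pure_tensor x y) <= `|x| * `|y|;
    crossnorm_functional : forall (phi : 'L(E, R^o)) (psi : 'L(F, R^o)) u,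
      `|tensor_functional phi psi u| <= `|phi| * `|psi| * a u }.

Definition tensor_norm_family :=
  forall E F : completeNormedModType R, tensor E F -> R.

(* A Banach space together with a linear isometry of (E (x) F, alpha) onto a
   dense subspace: the alpha-completion of E (x) F, which is unique up to an
   isometric isomorphism compatible with the embeddings. *)
Record tensor_completion (alpha : tensor_norm_family)
    (E F : completeNormedModType R) := TensorCompletion {
  tc_space :> completeNormedModType R;
  tc_embed : tensor E F -> tc_space;
  tc_embed_linear : linear tc_embed;
  tc_embed_norm : forall u, `|tc_embed u| = alpha E F u;
  tc_embed_dense : dense (range tc_embed) }.

Definition tprod (alpha : tensor_norm_family) (E F : completeNormedModType R)
  (C : tensor_completion alpha E F) (x : E) (y : F) : C :=
  tc_embed C (pure_tensor x y).

Section Extension.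
Variables (alpha : tensor_norm_family) (E1 F1 E2 F2 : completeNormedModType R).
Variables (C1 : tensor_completion alpha E1 F1).
Variables (C2 : tensor_completion alpha E2 F2).

Definition extends_tensor_map (T : 'L(E1, E2)) (S : 'L(F1, F2)) (L : 'L(C1, C2)) :=
  forall u, L (tc_embed C1 u) = tc_embed C2 (tensor_map T S u).

Definition tensor_op (T : 'L(E1, E2)) (S : 'L(F1, F2)) : 'L(C1, C2) :=
  get (extends_tensor_map T S).

End Extension.

Record uniform_crossnorm (alpha : tensor_norm_family) : Prop := UniformCrossnorm {
  uniform_crossnorm_reasonable : forall E F, reasonable_crossnorm (alpha E F);
  uniform_crossnorm_extends :
    forall (E1 F1 E2 F2 : completeNormedModType R)
      (C1 : tensor_completion alpha E1 F1) (C2 : tensor_completion alpha E2 F2)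
      (T : 'L(E1, E2)) (S : 'L(F1, F2)),
    exists2 L : 'L(C1, C2), extends_tensor_map T S L & `|L| <= `|T| * `|S| }.

End Crossnorm.

(* Paths indexed by the nonnegative reals are functions on R whose values at
   negative times are irrelevant. *)
Section Paths.
Context {R : realType}.

Definition left_lim (V : normedModType R) (Z : R -> V) (t : R) : V :=
  lim (Z s @[s --> t^'-]).

Definition cadlag (V : normedModType R) (Z : R -> V) :=
  (forall t, 0 <= t -> Z s @[s --> t^'+] --> Z t) /\
  (forall t, 0 < t -> cvg (Z s @[s --> t^'-])).

Definition jump (V : normedModType R) (Z : R -> V) (t : R) : V :=
  if 0 < t then Z t - left_lim Z t else 0.

(* Vector-valued counterparts of variation, variations, bounded_variation and
   total_variation of the library, which are restricted to R -> R. *)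
Definition vvariation (V : normedModType R) (a b : R) (Z : R -> V) (s : seq R) : R :=
  \sum_(0 <= n < size s) `|Z (nth b (a :: s) n.+1) - Z (nth b (a :: s) n)|.

Definition vvariations (V : normedModType R) (a b : R) (Z : R -> V) : set R :=
  [set vvariation a b Z s | s in itv_partition a b].

Definition vtotal_variation (V : normedModType R) (a b : R) (Z : R -> V) : \bar R :=
  ereal_sup [set x%:E | x in vvariations a b Z].

Definition finite_variation (V : normedModType R) (Z : R -> V) :=
  forall a b, 0 <= a -> a <= b -> has_ubound (vvariations a b Z).

Definition upto (V : normedModType R) (g : R -> V) (t : R) : R -> V :=
  fun s => if 0 < s <= t then g s else 0.

(* Sums over 0 < s <= t are limits along the net of finite sets of indices. *)
Definition summable_upto (V : normedModType R) (g : R -> V) (t : R) :=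
  cvg (summability.partial_sum (upto g t) @ summability.totally).

Definition sum_upto (V : normedModType R) (g : R -> V) (t : R) : V :=
  summability.sum (upto g t).

Definition continuous_part (V : normedModType R) (Z : R -> V) : R -> V :=
  fun t => Z t - sum_upto (jump Z) t.

End Paths.

(* Bochner (Dinculeanu) integral over ]0, t] of an operator-valued function with
   respect to the vector measure ]a, b] |-> Z b - Z a of finite variation |dZ|. *)
Section StieltjesIntegral.
Context {R : realType} (V W : normedModType R).

Definition variation_measure (Z : R -> V)
    (mu : {measure set (measurableTypeR R) -> \bar R}) :=
  forall a b : R, 0 <= a -> a <= b -> mu `]a, b]%classic = vtotal_variation a b Z.

(* The term ((a, b), T) stands for the function T 1_{]a, b]}. *)
Definition op_step := seq (R * R * 'L(V, W)).

Definition op_step_on (t : R) (h : op_step) :=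
  forall p, p \in h -> 0 <= p.1.1 /\ p.1.1 <= p.1.2 /\ p.1.2 <= t.

Definition op_step_fun (h : op_step) (s : R) : 'L(V, W) :=
  \sum_(p <- h) (\1_`]p.1.1, p.1.2]%classic s : R) *: p.2.

Definition op_step_integral (Z : R -> V) (h : op_step) : W :=
  \sum_(p <- h) p.2 (Z p.1.2 - Z p.1.1).

Definition is_stieltjes_integral (H : R -> 'L(V, W)) (Z : R -> V) (t : R) (I : W) :=
  exists mu : {measure set (measurableTypeR R) -> \bar R},
    variation_measure Z mu /\
    exists h : nat -> op_step,
      [/\ forall n, op_step_on t (h n),
          forall n, measurable_fun (`]0, t]%classic : set (measurableTypeR R))
            (fun s => `|H s - op_step_fun (h n) s|),
          (\int[mu]_(s in `]0%R, t]) (`|H s - op_step_fun (h n) s|)%:E)%E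
            @[n --> \oo] --> 0%E
        & op_step_integral Z (h n) @[n --> \oo] --> I].

End StieltjesIntegral.

(* The partition { ]p i, p i.+1] : i in nat } is represented by the sequence p
   of its endpoints. *)
Section Partitions.
Context {R : realType}.

Definition is_partition (p : nat -> R) :=
  [/\ p 0%N = 0, forall i, p i < p i.+1 & p i @[i --> \oo] --> +oo].

Definition mesh (p : nat -> R) : \bar R :=
  ereal_sup [set (`|p i.+1 - p i|)%:E | i in setT].

Definition osc_left (V : normedModType R) (Z : R -> V) (t : R) (p : nat -> R) : \bar R :=
  ereal_sup [set x | exists i u v,
    [/\ p i <= u < p i.+1 /\ 0 <= u <= t,
        p i <= v < p i.+1 /\ 0 <= v <= t
      & x = (`|Z u - Z v|)%:E]].

Definition increment (V : normedModType R) (X : R -> V) (t : R) (p : nat -> R)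
    (i : nat) : V :=
  X (Num.min (p i.+1) t) - X (Num.min (p i) t).

(* At most finitely many increments are nonzero, so finitely supported sums over
   nat are used. *)
Definition finite_2variation (V : normedModType R) (X : R -> V)
    (pi : nat -> nat -> R) :=
  forall t, 0 <= t -> has_ubound
    [set \sum_(i \in [set: nat]) `|increment X t (pi n) i| ^+ 2 | n in setT].

Inductive convergence_mode := Strong | Weak.

Definition converges (m : convergence_mode) (V : normedModType R)
    (u : nat -> V) (l : V) :=
  match m with
  | Strong => u n @[n --> \oo] --> l
  | Weak => forall phi : 'L(V, R^o), phi (u n) @[n --> \oo] --> phi l
  end.

Definition tensor_quadratic_variation (m : convergence_mode)
    (alpha : tensor_norm_family) (E : completeNormedModType R)
    (C : tensor_completion alpha E E) (pi : nat -> nat -> R)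
    (X : R -> E) (Q : R -> C) :=
  [/\ cadlag X, cadlag Q /\ finite_variation Q,
      forall t, 0 <= t -> converges m
        (fun n => \sum_(i \in [set: nat])
           tprod C (increment X t (pi n) i) (increment X t (pi n) i)) (Q t)
    & forall t, 0 <= t -> jump Q t = tprod C (jump X t) (jump X t)].

End Partitions.

Section FunctionSpaces.
Context {R : realType}.

Definition continuous_on_compacts (S S' : topologicalType) (g : S -> S') :=
  forall K : set S, compact K -> {within K, continuous g}.

Definition lipschitz_on_compacts (V W : normedModType R) (g : V -> W) :=
  forall K : set V, compact K -> [lipschitz g x | x in K].

Definition gateaux_derivative (V W : normedModType R) (g : V -> W) (x : V)
    (D : 'L(V, W)) :=
  forall h : V, is_derive x h g (D h).

End FunctionSpaces.

(* Main.v *)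
From HB Require Import structures.
Require Import Defs.
From mathcomp Require Import all_boot all_order all_algebra finmap.
From mathcomp Require Import all_classical all_reals all_analysis.
From mathcomp.analysis.showcase Require summability.
From mathcomp Require Import measurable_realfun ring lra.

(** Put Z = (A, X) and K_s = (D_x f (Z_s))^{(x)2}. For a partition with cells
    ]r, s] the square of the increment of f(Z) over a cell splits as
    K_r (dX^{(x)2}) + Phi (Z_r, Z_s), where
    Phi (z, z') = (f z' - f z)^{(x)2} - (D_x f (z) (x' - x))^{(x)2}.
    The sums of the first terms converge, in the given mode, to the integral of
    K_{s-} against [X,X]: on an interval where K oscillates by at most e, they
    differ from T([X,X]^n_v - [X,X]^n_u), T a fixed value of K, by at most e times
    the increment of the discrete quadratic variation, and these errors add up.
    The sums of the second terms converge in norm to the sum of the jumps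
    Phi (Z_{s-}, Z_s), since the mean value inequality gives
    Phi (z, z') = o (|x' - x|^2 + |a' - a|) as z' - z -> 0 on compact sets.
    Both hypotheses on the partitions enter only through the fact that each cell
    can be cut at one point so that Z oscillates little on both pieces.
    Properties of paths on a compact interval are obtained from Cousin's lemma:
    a transitive relation P u v on reals that holds for v close to the right of u
    and for u close to the left of v holds between the two ends. *)

Set Implicit Arguments.
Unset Strict Implicit.
Unset Printing Implicit Defensive.

Import Order.TTheory GRing.Theory Num.Theory.
Import numFieldNormedType.Exports.

Local Open Scope classical_set_scope.
Local Open Scope ring_scope.

(** * Cousin's lemma and the mean value inequality *)

(** Weak convergence gives access to the discrete brackets only at fixed times and through fixed
    operators. So K is frozen on finitely many intervals chosen before n, and the freezing error is
    measured by scalar sums of squares, which finite 2-variation bounds uniformly in n. The gauge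
    |x' - x|^2 + |a' - a| is dictated by the data: its sum over the cells is bounded by the
    2-variation of X plus the variation of A. Letting n grow bounds its sum over any finite set of
    jump times, so every jump series of the proof converges absolutely. The integral of the
    conclusion is taken against the continuous part of [X,X]. The jump part, integrated against
    K_{s-}, yields the sum of K_{s-} (Delta X_s^{(x)2}), exactly the term that Phi (Z_{s-}, Z_s)
    subtracts; what remains is (Delta f(Z)_s)^{(x)2}. Since f and D_x f are controlled only on
    compact sets, all estimates are made on the compact set of values and left limits of Z up to
    time t, and on its enlargement by segments. *)

Section Cousin.
Context {R : realType}.

(** Let c be the supremum of the s in ]a, b] with [P a s]. The left condition at c and transitivity
    through a point close to c give [P a c]; if c < b, the right condition at c would lead beyond c.
    [P] is never asked of a degenerate interval, so the search starts from the right condition at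
    [a]. *)
Lemma cousin (P : R -> R -> Prop) (a b : R) : a < b ->
  (forall s, a <= s < b -> \forall v \near s^'+, v <= b -> P s v) ->
  (forall s, a < s <= b -> \forall u \near s^'-, a <= u -> P u s) ->
  (forall u v w, a <= u -> u < v -> v < w -> w <= b -> P u v -> P v w -> P u w) ->
  P a b.
Proof.
move=> ab Pr Pl Pt; pose S := [set s | a < s <= b /\ P a s].
have Sne : S !=set0.
  have /filter_ex[s [[as_ sb] Ps]] : \forall v \near a^'+,
      (a < v /\ v <= b) /\ (v <= b -> P a v).
    near=> v; split; first by split; near: v;
      [exact: nbhs_right_gt | exact: nbhs_right_le].
    by near: v; apply: Pr; rewrite lexx.
  by exists s; split; [rewrite as_ sb | exact: Ps].
have Sub : ubound S b by move=> s [/andP[]].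
have hs : has_sup S by split => //; exists b.
set c := sup S.
have ac : a < c.
  have [s Ss] := Sne; apply: lt_le_trans (ub_le_sup _ Ss); last by exists b.
  by case: Ss => /andP[].
have cb : c <= b by apply: ge_sup.
have Pac : P a c.
  have [e /= e0 Hl] : \forall u \near c^'-, a <= u -> P u c by apply: Pl; rewrite ac cb.
  have [s Ss cs] := sup_adherent e0 hs; have [/andP[as_ sb] Ps] := Ss.
  have : s <= c by apply: ub_le_sup; first by exists b.
  rewrite le_eqVlt => /orP[/eqP <-//|sc].
  apply: (Pt _ s _) => //; apply: Hl => //=; last exact: ltW.
  by rewrite gtr0_norm ?subr_gt0// ltrBlDr -ltrBlDl.
move: cb; rewrite le_eqVlt => /orP[/eqP <-//|cb].
have /filter_ex[v [[cv vb] Pv]] : \forall v \near c^'+,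
    (c < v /\ v <= b) /\ (v <= b -> P c v).
  near=> v; split; first by split; near: v;
    [exact: nbhs_right_gt | exact: nbhs_right_le].
  by near: v; apply: Pr; rewrite cb ltW.
have : v <= c.
  apply: ub_le_sup; first by exists b.
  by split; [rewrite vb (lt_trans ac cv) | apply: (Pt _ c) => //; exact: Pv].
by rewrite leNgt cv.
Unshelve. all: by end_near. Qed.

End Cousin.

Section MeanValue.
Context {R : realType}.

Lemma near_left_itv (P : R -> Prop) (t : R) : (\forall x \near t^'-, P x) ->
  \forall u \near t^'-, forall x, u <= x < t -> P x.
Proof.
move=> [e /= e0 H]; exists e => //= u ue ut x /andP[ux xt]; apply: H => //=.
move: ue => /=; rewrite !gtr0_norm ?subr_gt0// => ue.
by apply: le_lt_trans ue; rewrite lerD2l lerN2.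
Qed.

Lemma near_right_itv (P : R -> Prop) (t : R) : (\forall x \near t^'+, P x) ->
  \forall v \near t^'+, forall x, t < x <= v -> P x.
Proof.
move=> [e /= e0 H]; exists e => //= u ue ut x /andP[tx xu]; apply: H => //=.
move: ue => /=; rewrite !ltr0_norm ?subr_lt0// !opprB => ue.
by apply: le_lt_trans ue; rewrite lerD2r.
Qed.

(** Clearing the denominator of the difference quotient gives a bound linear in |d|, which can be
    added up along a segment. *)
Lemma gateaux_near (V W : normedModType R) (g : V -> W) (y h : V) (D : 'L(V, W))
    (e : R) : gateaux_derivative g y D -> 0 < e ->
  \forall d \near (0 : R), `|g (y + d *: h) - g y - d *: D h| <= e * `|d|.
Proof.
move=> gD e0; have [dg Dg] := gD h.
have : (fun d : R => d^-1 *: ((g \o shift y) (d *: h) - g y)) @ 0^' --> D h.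
  by rewrite -Dg; exact: dg.
move/cvgr_distC_le => /(_ _ e0) [r /= r0 H]; exists r => //= d dr.
have [->|d0] := eqVneq d 0.
  by rewrite scale0r addr0 subrr sub0r scale0r oppr0 !normr0 mulr0.
have := H d dr d0; rewrite /= /shift.
rewrite -(@ler_pM2r _ `|d|) ?normr_gt0//; apply: le_trans.
rewrite mulrC -normrZ scalerBr scalerA mulfV// scale1r.
by rewrite (addrC y).
Qed.

(** The deviation of the increment of [g] from [w] times the length is additive over adjacent
    parameter intervals, so the bound passes from short intervals to [0, 1] by Cousin's lemma,
    without functionals. The slack [e] absorbs the remainder of the derivative at each point. *)
Lemma gateaux_mean_value (V W : normedModType R) (g : V -> W)
    (D : V -> 'L(V, W)) (x h : V) (w : W) (M : R) :
  (forall y, gateaux_derivative g y (D y)) ->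
  (forall c : R, 0 <= c <= 1 -> `|D (x + c *: h) h - w| <= M) ->
  `|g (x + h) - g x - w| <= M.
Proof.
move=> gD DM; apply/ler_addgt0Pr => e e0.
pose P (u v : R) : Prop := `|g (x + v *: h) - g (x + u *: h) - (v - u) *: w| <= (M + e) * (v - u).
have main s : 0 <= s <= 1 -> \forall d \near (0 : R),
    `|g (x + s *: h + d *: h) - g (x + s *: h) - d *: w| <= (M + e) * `|d|.
  move=> s01; have [r /= r0 H] := gateaux_near h (gD (x + s *: h)) e0.
  exists r => //= d /H {}H.
  rewrite -(subrK (d *: D (x + s *: h) h) (g (x + s *: h + d *: h) - _)) -addrA.
  rewrite -scalerBr (le_trans (ler_normD _ _))// addrC mulrDl lerD//.
  by rewrite normrZ mulrC ler_wpM2r// DM.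
have : P 0 1.
  apply: cousin => //.
  - move=> s /andP[s0 s1]; have [|r /= r0 H] := main s; first by rewrite s0 ltW.
    exists r => //= v vr sv v1; have := H (v - s).
    rewrite /= sub0r normrN distrC => /(_ vr).
    by rewrite -(addrA x) -scalerDl subrKC ltr0_norm ?subr_lt0// opprB.
  - move=> s /andP[s0 s1]; have [|r /= r0 H] := main s; first by rewrite ltW.
    exists r => //= v vr sv v1; have := H (v - s).
    rewrite /= sub0r normrN distrC => /(_ vr).
    rewrite -(addrA x) -scalerDl subrKC gtr0_norm ?subr_gt0//.
    rewrite /P (_ : _ - (s - v) *: w = - (g (x + v *: h) - g (x + s *: h) -
      (v - s) *: w)) ?normrN//.
    by rewrite !opprB [LHS]addrC -scaleNr opprB.
  - move=> u v z _ uv vz _ Puv Pvz; rewrite /P.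
    rewrite (_ : z - u = (v - u) + (z - v)); last by lra.
    rewrite mulrDr (le_trans _ (lerD Puv Pvz))// (le_trans _ (ler_normD _ _))//.
    rewrite [in leRHS]addrACA -opprD -scalerDl.
    by rewrite [in leRHS](addrC (g (x + v *: h) - _)) subrKA.
by rewrite /P scale0r addr0 scale1r subr0 scale1r mulr1.
Qed.

End MeanValue.

(** * Uniform continuity on compact sets *)

Section Compactness.
Context {R : realType}.

Lemma compact_uniform_continuity (V W : normedModType R) (K : set V) (g : V -> W)
    (e : R) : compact K -> {within K, continuous g} -> 0 < e ->
  exists2 d : R, 0 < d & forall x y, K x -> K y -> `|x - y| <= d ->
    `|g x - g y| <= e.
Proof.
move=> /compact_near_coveringP cK cg e0.
(* The covering argument uses neighbourhoods in the whole space, where [g] need not be continuous;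
   hence [P] tests points of [K] only. *)
pose P (d : R) (x : V) := K x -> forall y, K y -> `|x - y| <= d -> `|g x - g y| <= e.
suff : \forall d \near (0 : R)^'+, K `<=` P d.
  move=> H; near (0:R)^'+ => d; exists d => // x y Kx.
  by apply: (near H d _ x) => //; near: d; exact: H.
apply: cK => x Kx; move/subspace_continuousP : cg => /(_ _ Kx).
move/cvgr_distC_le => /(_ (e / 2)); rewrite divr_gt0// => /(_ isT).
rewrite near_withinE /= => /nbhs_normP[r /= r0 H].
near=> y d => Ky z Kz yzd.
have dr : d < r / 2 by near: d; apply: nbhs_right_lt; rewrite divr_gt0.
rewrite (splitr e) -(subrKA (g x)) (le_trans (ler_normD _ _))//.
rewrite lerD//.
  by apply: H => //=; near: y; apply/nbhs_normP; exists r.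
rewrite distrC; apply: H => //=.
rewrite -(subrKA y) (le_lt_trans (ler_normD _ _))//.
rewrite (splitr r) ltrD//.
  by near: y; apply/nbhs_normP; exists (r / 2) => //=; rewrite divr_gt0.
by rewrite (le_lt_trans yzd).
Unshelve. all: by end_near. Qed.

End Compactness.

(** * Càdlàg paths *)

Section Cadlag.
Context {R : realType}.

Lemma cvg_norm_le (T : Type) (F : set_system T) (V : normedModType R) (f : T -> V)
    (a l : V) (e : R) : ProperFilter F -> f @ F --> a ->
  (\forall x \near F, `|f x - l| <= e) -> `|a - l| <= e.
Proof.
move=> FF fa fe; apply/ler_addgt0Pl => d d0.
have /filter_ex[x [xa xl]] : \forall x \near F, `|a - f x| <= d /\ `|f x - l| <= e.
  by near=> x; split; near: x => //; move/cvgr_dist_le : fa; exact.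
by rewrite -(subrKA (f x)) (le_trans (ler_normD _ _))// lerD.
Unshelve. all: by end_near. Qed.

Section Path.
Context {V : normedModType R} (Z : R -> V).

Lemma left_limE (t : R) (l : V) : Z s @[s --> t^'-] --> l -> left_lim Z t = l.
Proof. by move=> Zl; apply: cvg_lim => //; exact: norm_hausdorff. Qed.

Hypothesis cZ : cadlag Z.

Lemma cadlag_left_lim (t : R) : 0 < t -> Z s @[s --> t^'-] --> left_lim Z t.
Proof. exact: cZ.2. Qed.

Lemma cadlag_near_left (t e : R) : 0 < t -> 0 < e ->
  \forall u \near t^'-, forall x, u <= x < t -> `|Z x - left_lim Z t| <= e.
Proof.
move=> t0 e0; apply: near_left_itv.
by move/cvgr_distC_le : (cadlag_left_lim t0); exact.
Qed.

Lemma cadlag_near_right (t e : R) : 0 <= t -> 0 < e ->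
  \forall v \near t^'+, forall x, t <= x <= v -> `|Z x - Z t| <= e.
Proof.
move=> t0 e0.
have : \forall v \near t^'+, forall x, t < x <= v -> `|Z x - Z t| <= e.
  by apply: near_right_itv; move/cvgr_distC_le : (cZ.1 t t0); exact.
apply: filterS => v H x /andP[]; rewrite le_eqVlt => /orP[/eqP <- _|tx xv].
  by rewrite subrr normr0 ltW.
by apply: H; rewrite tx xv.
Qed.

Lemma left_lim_norm_le (u t : R) (l : V) (e : R) : 0 < t -> u < t ->
  (forall x, u <= x < t -> `|Z x - l| <= e) -> `|left_lim Z t - l| <= e.
Proof.
move=> t0 ut H; apply: (cvg_norm_le _ (cadlag_left_lim t0)).
near=> x; apply: H; apply/andP; split; near: x.
  exact: nbhs_left_ge.
exact: nbhs_left_lt.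
Unshelve. all: by end_near. Qed.

(** Left limits are included because the values alone need not form a closed set, and because the
    jump terms are evaluated at [left_lim Z s]. *)
Definition cadlag_range (t : R) : set V :=
  [set v | (exists2 s, 0 <= s <= t & v = Z s) \/
           (exists2 s, 0 < s <= t & v = left_lim Z s)].

Lemma cadlag_range_val (t s : R) : 0 <= s <= t -> cadlag_range t (Z s).
Proof. by left; exists s. Qed.

Lemma cadlag_range_left_lim (t s : R) :
  0 < s <= t -> cadlag_range t (left_lim Z s).
Proof. by right; exists s. Qed.

(** Compactness of [[0, t]], in its near-covering form, is transferred to the path: just after s,
    values and left limits are close to [Z s]; just before s, they are close to [left_lim Z s], and
    so is the left limit at s. One neighbourhood of s thus handles both kinds of points of the
    range. *)
Lemma cadlag_range_compact (t : R) : compact (cadlag_range t).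
Proof.
apply/compact_near_coveringP => I F P FF cP.
pose Q (i : I) (s : R) := (0 <= s <= t -> P i (Z s)) /\ (0 < s <= t -> P i (left_lim Z s)).
have : \forall i \near F, `[0, t]%classic `<=` Q i.
  have /compact_near_coveringP := @segment_compact R 0 t; apply => // s.
  rewrite /= in_itv /= => /andP[s0 st].
  have near_ball v : cadlag_range t v -> exists2 r, 0 < r &
      \forall i \near F, forall w, `|w - v| <= r -> P i w.
    move=> /cP[[A B] [/= /nbhs_normP[r /= r0 rA] FB] AB].
    exists (r / 2); first by rewrite divr_gt0.
    apply: filterS FB => i Bi w wv; apply: (AB (w, i)); split => //=; apply: rA => /=.
    by rewrite distrC (le_lt_trans wv)// ltr_pdivrMr// ltr_pMr// ltr1n.
  have [r1 r10 H1] := near_ball _ (cadlag_range_val (introT andP (conj s0 st))).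
  have [v [sv vH]] : exists v, s < v /\ forall x, s <= x <= v -> `|Z x - Z s| <= r1.
    near s^'+ => v; exists v; split; first by near: v; exact: nbhs_right_gt.
    by near: v; exact: cadlag_near_right.
  have [u [us [B FB BH]]] : exists u, u < s /\ exists2 B, F B &
      forall i x, B i -> 0 <= x <= t -> u < x <= s ->
        (x < s -> P i (Z x)) /\ (0 < x -> P i (left_lim Z x)).
    (* At s = 0 there is no left limit to control: no time of [[0, t]] precedes s and no positive
       time is at most s, so any u < s serves. *)
    have [s_gt0|s_le0] := ltP 0 s; last first.
      exists (s - 1); split; first by rewrite ltrBlDr ltrDl.
      exists setT; first exact: filterT.
      move=> i x _ /andP[x0 _] /andP[_ xs]; split.
        by rewrite ltNge (le_trans s_le0).
      by rewrite ltNge (le_trans xs).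
    have /near_ball [r2 r20 H2] : cadlag_range t (left_lim Z s).
      by apply: cadlag_range_left_lim; rewrite s_gt0.
    have [u [us uH]] : exists u, u < s /\
        forall x, u <= x < s -> `|Z x - left_lim Z s| <= r2.
      near s^'- => u; exists u; split; first by near: u; exact: nbhs_left_lt.
      by near: u; exact: cadlag_near_left.
    exists u; split => //; exists [set i | forall w, `|w - left_lim Z s| <= r2 -> P i w] => //.
    move=> i x Bi /andP[x0 xt] /andP[ux xs]; split=> [x_lt_s|x_gt0]; apply: Bi.
      by apply: uH; rewrite ltW.
    apply: (@left_lim_norm_le u) => // y /andP[uy yx].
    by apply: uH; rewrite uy (lt_le_trans yx).
  exists (`]u, v[%classic, [set i | B i /\ forall w, `|w - Z s| <= r1 -> P i w]).
    split => /=; last exact: filterI.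
    by apply: near_in_itvoo; rewrite in_itv/= us.
  move=> [x i] [/=]; rewrite in_itv /= => /andP[ux xv] [Bi iH].
  have [sx|xs] := ltP s x.
    split=> _; apply: iH; first by apply: vH; rewrite !ltW.
    apply: (@left_lim_norm_le s) => //; first exact: le_lt_trans sx.
    by move=> y /andP[sy yx]; apply: vH; rewrite sy (le_trans (ltW yx)) ?ltW.
  split=> /andP[x0 xt].
    move: xs; rewrite le_eqVlt => /orP[/eqP ->|xs].
      by apply: iH; rewrite subrr normr0 ltW.
    by have [||+ _] := BH i x Bi; rewrite ?x0 ?ux// ?ltW//; apply.
  by have [||_] := BH i x Bi; rewrite ?(ltW x0) ?ux//; apply.
apply: filterS => i H v [[s s0t ->]|[s s0t ->]].
  by have [|+ _] := H s; [rewrite /= in_itv|exact].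
have [|_ +] := H s; last exact.
by rewrite /= in_itv/=; case/andP : s0t => /ltW -> ->.
Unshelve. all: by end_near. Qed.

End Path.
End Cadlag.

(** * Total variation *)

Section Variation.
Context {R : realType} {V : normedModType R}.
Implicit Types (Z : R -> V) (a b c : R) (s : seq R).

(** Recursion on the list replaces access by position, so that cutting and concatenating partitions
    become inductions. *)
Fixpoint chain_variation Z a s : R :=
  if s is x :: s' then `|Z x - Z a| + chain_variation Z x s' else 0.

Lemma vvariationE a b Z s : vvariation a b Z s = chain_variation Z a s.
Proof.
rewrite /vvariation; elim: s a => [|x s IH] a /=; first by rewrite big_geq.
by rewrite big_nat_recl//= -IH.
Qed.

Lemma chain_variation_cat Z a s1 s2 : chain_variation Z a (s1 ++ s2) =
  chain_variation Z a s1 + chain_variation Z (last a s1) s2.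
Proof. by elim: s1 a => [|x s1 IH] a /=; rewrite ?add0r// IH addrA. Qed.

(** Inserting [b] can only increase the variation, by the triangle inequality on the step that
    passes over [b]. Partitions increase strictly, hence the separate case [a] = [b]. *)
Lemma chain_variation_split Z a b c s : a <= b -> b <= c -> itv_partition a c s ->
  exists s1 s2, [/\ itv_partition a b s1, itv_partition b c s2 &
    chain_variation Z a s <= chain_variation Z a s1 + chain_variation Z b s2].
Proof.
elim: s a => [|x s IH] a ab bc [/= pa /eqP la].
  exists [::], [::]; rewrite -la in bc *; have -> : b = a by apply/le_anti/andP.
  by split; rewrite /itv_partition//= ?addr0.
move: pa => /andP[ax px]; have [xb|bx] := leP x b.
  have [|s1 [s2 [[p1 /eqP l1] p2 le12]]] := IH x xb bc.
    by split => //; apply/eqP.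
  exists (x :: s1), s2; split => //=; first by split; rewrite /= ?ax ?p1// l1.
  by rewrite -addrA lerD2l.
move: ab; rewrite le_eqVlt => /orP[/eqP abE|ab].
  exists [::], (x :: s); split; rewrite /itv_partition -?abE/= ?eqxx//.
    by rewrite ax px la eqxx.
  by rewrite add0r.
exists [:: b], (x :: s); split; rewrite /itv_partition/= ?ab ?eqxx//.
  by rewrite bx px la eqxx.
by rewrite addr0 addrA lerD2r addrC -(subrKA (Z b) (Z x)) ler_normD.
Qed.

Lemma itv_partition_ex a b : a <= b -> exists s, itv_partition a b s.
Proof.
rewrite le_eqVlt => /orP[/eqP ->|ab]; first by exists [::]; split => /=.
by exists [:: b]; split; rewrite /= ?ab.
Qed.

Definition tvar Z a b : R := sup (vvariations a b Z).

Lemma tvar_le Z a b (M : R) : a <= b ->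
  (forall s, itv_partition a b s -> chain_variation Z a s <= M) -> tvar Z a b <= M.
Proof.
move=> ab H; apply: ge_sup.
  by have [s ps] := itv_partition_ex ab; exists (vvariation a b Z s), s.
by move=> _ [s ps <-]; rewrite vvariationE; exact: H.
Qed.

Lemma chain_variation_dominated Z (beta : R -> R) a b s :
  (forall u v, a <= u -> u <= v -> v <= b -> `|Z v - Z u| <= beta v - beta u) ->
  itv_partition a b s -> chain_variation Z a s <= beta b - beta a.
Proof.
elim: s a => [|x s IH] a H [/= pa /eqP la]; first by rewrite la subrr.
move: pa => /andP[ax px].
have xb : x <= b by apply: (itv_partition_le (s := s)); split => //; exact/eqP.
rewrite -(subrK (beta x) (beta b)) -addrA addrC lerD//.
  by apply: H => //; exact: ltW.
apply: IH; last by split => //; exact/eqP.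
by move=> u v xu uv vb; apply: H => //; apply: le_trans xu; exact: ltW.
Qed.

(** The increments of [beta] telescope along every partition. The function [beta] may change with
    the horizon [T]. *)
Lemma finite_variation_dominated Z :
  (forall T, exists beta : R -> R, forall u v, 0 <= u -> u <= v -> v <= T ->
    `|Z v - Z u| <= beta v - beta u) ->
  finite_variation Z.
Proof.
move=> H a b a0 ab; have [beta Hb] := H b; exists (beta b - beta a) => _ [s ps <-].
rewrite vvariationE; apply: chain_variation_dominated ps => u v au uv vb.
by apply: Hb => //; exact: le_trans au.
Qed.

Section FiniteVariation.
Variable Z : R -> V.
Hypothesis fZ : finite_variation Z.

Lemma chain_variation_le_tvar a b s : 0 <= a -> a <= b -> itv_partition a b s ->
  chain_variation Z a s <= tvar Z a b.
Proof.
move=> a0 ab ps; rewrite -(vvariationE a b).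
by apply: ub_le_sup; [exact: fZ | exists s].
Qed.

Lemma vtotal_variationE a b : 0 <= a -> a <= b ->
  vtotal_variation a b Z = (tvar Z a b)%:E.
Proof.
move=> a0 ab; rewrite /vtotal_variation ereal_sup_EFin//; first exact: fZ.
by have [s ps] := itv_partition_ex ab; exists (vvariation a b Z s), s.
Qed.

Lemma tvar_ge0 a b : 0 <= a -> a <= b -> 0 <= tvar Z a b.
Proof.
move=> a0 ab; have [s ps] := itv_partition_ex ab.
apply: le_trans (chain_variation_le_tvar a0 ab ps).
by elim: s {ps} (a) => //= x s IH c; rewrite addr_ge0.
Qed.

Lemma norm_le_tvar a b : 0 <= a -> a <= b -> `|Z b - Z a| <= tvar Z a b.
Proof.
move=> a0; rewrite le_eqVlt => /orP[/eqP <-|ab].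
  by rewrite subrr normr0 tvar_ge0.
rewrite -[leLHS]addr0; apply: (@chain_variation_le_tvar a b [:: b]) => //.
  exact: ltW.
by split; rewrite /= ?ab.
Qed.

Lemma tvarD a b c : 0 <= a -> a <= b -> b <= c ->
  tvar Z a c = tvar Z a b + tvar Z b c.
Proof.
move=> a0 ab bc; have b0 := le_trans a0 ab; have ac := le_trans ab bc.
apply/eqP; rewrite eq_le; apply/andP; split.
  apply: tvar_le => // s /(chain_variation_split Z ab bc)[s1 [s2 [p1 p2]]].
  by move/le_trans; apply; rewrite lerD// chain_variation_le_tvar.
rewrite -lerBrDr; apply: tvar_le => // s1 [p1 /eqP l1].
rewrite lerBrDr addrC -lerBrDr; apply: tvar_le => // s2 [p2 /eqP l2].
rewrite lerBrDl -{1}l1 -chain_variation_cat chain_variation_le_tvar//.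
by split; rewrite ?cat_path ?p1 ?last_cat l1 ?p2 ?l2.
Qed.

Lemma tvarxx a : 0 <= a -> tvar Z a a = 0.
Proof. by move=> a0; have := tvarD a0 (lexx a) (lexx a); lra. Qed.

(** Choose a partition of [a, a + 1] that attains the variation up to e / 2. For v before its first
    point x, replacing a by v gives a partition of [v, a + 1] whose variation is smaller by at most
    |Z v - Z a|. By additivity the variation on [a, v] is at most e / 2 + |Z v - Z a|. *)
Lemma tvar_right_continuous a : 0 <= a -> Z s @[s --> a^'+] --> Z a ->
  tvar Z a s @[s --> a^'+] --> (0 : R).
Proof.
move=> a0 Za; apply/cvgrPdist_le => e e0.
have a1 : a < a + 1 by rewrite ltrDl.
have a1' := ltW a1.
have [_ [s ps <-]] : exists2 x, vvariations a (a + 1) Z x & tvar Z a (a + 1) - e / 2 < x.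
  apply: sup_adherent; first by rewrite divr_gt0.
  split; last exact: fZ.
  by have [s ps] := itv_partition_ex a1'; exists (vvariation a (a + 1) Z s), s.
rewrite vvariationE; case: s ps => [[/= _ /eqP aE]|x s [/= /andP[ax px] /eqP lx]].
  by rewrite -aE in a1; rewrite ltxx in a1.
have xa1 : x <= a + 1 by apply: (itv_partition_le (s := s)); split => //; exact/eqP.
move=> H; near=> v.
have av : a < v by near: v; exact: nbhs_right_gt.
have vx : v < x by near: v; exact: nbhs_right_lt.
have va1 := ltW (lt_le_trans vx xa1).
have Zv : `|Z v - Z a| <= e / 2.
  by near: v; move/cvgr_distC_le : Za; apply; rewrite divr_gt0.
rewrite sub0r normrN ger0_norm ?tvar_ge0 ?(ltW av)//.
have v0 : 0 <= v by exact: le_trans (ltW av).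
have := tvarD a0 (ltW av) va1.
have /(chain_variation_le_tvar v0 va1) /= : itv_partition v (a + 1) (x :: s).
  by split; rewrite /= ?vx ?px// lx.
have : `|Z x - Z a| <= `|Z x - Z v| + `|Z v - Z a|.
  by rewrite -(subrKA (Z v) (Z x)) ler_normD.
by move: H Zv; set w := chain_variation _ _ _; lra.
Unshelve. all: by end_near. Qed.

(** Extended to negative times by its value at 0, so as to be nondecreasing and right continuous on
    the whole line, as a Lebesgue-Stieltjes measure requires. *)
Definition tvar_cdf : R -> R := fun t => tvar Z 0 (Num.max 0 t).

Lemma tvar_cdfB a b : 0 <= a -> a <= b -> tvar_cdf b - tvar_cdf a = tvar Z a b.
Proof.
move=> a0 ab; rewrite /tvar_cdf !max_r ?(le_trans a0)//.
by rewrite (tvarD (lexx 0) a0 ab) addrAC subrr add0r.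
Qed.

Lemma tvar_cdf_nd : nondecreasing tvar_cdf.
Proof.
move=> a b ab; rewrite -subr_ge0 /tvar_cdf.
have m0 c : 0 <= Num.max 0 c by rewrite le_max lexx.
have mab : Num.max 0 a <= Num.max 0 b by rewrite ge_max m0 le_max ab orbT.
by rewrite (tvarD (lexx 0) (m0 a) mab) addrAC subrr add0r tvar_ge0.
Qed.

Lemma norm_le_tvar_cdf a b : 0 <= a -> a <= b -> `|Z b - Z a| <= tvar_cdf b - tvar_cdf a.
Proof. by move=> a0 ab; rewrite tvar_cdfB// norm_le_tvar. Qed.

Hypothesis rZ : forall t, 0 <= t -> Z s @[s --> t^'+] --> Z t.

Lemma tvar_cdf_rc : right_continuous tvar_cdf.
Proof.
move=> a; have [a0|a0] := leP 0 a; last first.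
  apply: cvg_near_cst; near=> x.
  have x0 : x < 0 by near: x; exact: nbhs_right_lt.
  by rewrite /tvar_cdf !max_l// ltW.
have /cvgrPdist_le H := tvar_right_continuous a0 (rZ a0).
apply/cvgrPdist_le => e e0; near=> x.
have ax : a <= x by near: x; exact: nbhs_right_ge.
rewrite distrC tvar_cdfB//; have -> : tvar Z a x = - (0 - tvar Z a x) by lra.
by rewrite normrN; near: x; exact: H.
Unshelve. all: by end_near. Qed.

HB.instance Definition _ := isCumulative.Build R _ R tvar_cdf tvar_cdf_nd tvar_cdf_rc.

Lemma variation_measure_ex : exists mu : {measure set (measurableTypeR R) -> \bar R},
  variation_measure Z mu.
Proof.
exists (lebesgue_stieltjes_measure tvar_cdf) => a b a0 ab.
rewrite vtotal_variationE// -tvar_cdfB//.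
rewrite /= /lebesgue_stieltjes_measure /measure_extension.
rewrite measurable_mu_extE/=; last exact: is_ocitv.
by rewrite wlength_itv_bnd.
Qed.

End FiniteVariation.

Lemma finite_variationD Z1 Z2 : finite_variation Z1 -> finite_variation Z2 ->
  finite_variation (fun x => Z1 x + Z2 x).
Proof.
move=> f1 f2; apply: finite_variation_dominated => T.
exists (fun t => tvar_cdf Z1 t + tvar_cdf Z2 t) => u v u0 uv _.
rewrite !opprD !(addrACA _ _ (- _)) (le_trans (ler_normD _ _))//.
by rewrite lerD// norm_le_tvar_cdf.
Qed.

Lemma finite_variationN Z : finite_variation Z -> finite_variation (fun x => - Z x).
Proof.
move=> fZ; apply: finite_variation_dominated => T.
exists (tvar_cdf Z) => u v u0 uv _.
by rewrite -opprD normrN norm_le_tvar_cdf.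
Qed.

End Variation.

(** * Step functions and the Stieltjes integral *)

Section OpSteps.
Context {R : realType} {V W : normedModType R}.
Implicit Types (h : op_step V W) (p : R * R * 'L(V, W)).

Lemma bop_subE (T S : 'L(V, W)) x : (T - S) x = T x - S x.
Proof. by []. Qed.

Lemma bopB (T : 'L(V, W)) x y : T (x - y) = T x - T y.
Proof. exact: linearB. Qed.

Lemma opnorm_apply (T : 'L(V, W)) x : `|T x| <= `|T| * `|x|.
Proof.
have [->|x0] := eqVneq x 0; first by rewrite linear0 !normr0 mulr0.
rewrite -ler_pdivrMr ?normr_gt0// mulrC -{1}[(`|x|)^-1]ger0_norm ?invr_ge0//.
rewrite -normrZ -linearZ; apply: opnorm_ge.
by rewrite normrZ normfV normr_id mulVf ?normr_eq0.
Qed.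

Lemma op_step_fun_cons p h s : op_step_fun (p :: h) s =
  (\1_`]p.1.1, p.1.2]%classic s : R) *: p.2 + op_step_fun h s.
Proof. by rewrite /op_step_fun big_cons. Qed.

Lemma op_step_fun_cat h1 h2 s :
  op_step_fun (h1 ++ h2) s = op_step_fun h1 s + op_step_fun h2 s.
Proof. by rewrite /op_step_fun big_cat. Qed.

Lemma op_step_integral_cons (Z : R -> V) p h : op_step_integral Z (p :: h) =
  p.2 (Z p.1.2 - Z p.1.1) + op_step_integral Z h.
Proof. by rewrite /op_step_integral big_cons. Qed.

Lemma op_step_integral_cat (Z : R -> V) h1 h2 : op_step_integral Z (h1 ++ h2) =
  op_step_integral Z h1 + op_step_integral Z h2.
Proof. by rewrite /op_step_integral big_cat. Qed.

Definition opp_step h : op_step V W := [seq (p.1, - p.2) | p <- h].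

Lemma op_step_funN h s : op_step_fun (opp_step h) s = - op_step_fun h s.
Proof.
rewrite /op_step_fun big_map /= -sumrN; apply: eq_bigr => p _.
by rewrite scalerN.
Qed.

Lemma op_step_integralN (Z : R -> V) h :
  op_step_integral Z (opp_step h) = - op_step_integral Z h.
Proof. by rewrite /op_step_integral big_map /= -sumrN. Qed.

Lemma op_step_integralD (Z1 Z2 : R -> V) h :
  op_step_integral (fun s => Z1 s + Z2 s) h =
  op_step_integral Z1 h + op_step_integral Z2 h.
Proof.
rewrite /op_step_integral -big_split/=; apply: eq_bigr => p _.
by rewrite opprD addrACA linearD.
Qed.

Definition step_on (a b : R) h :=
  forall p, p \in h -> [/\ a <= p.1.1, p.1.1 <= p.1.2 & p.1.2 <= b].

Lemma step_on_op_step_on t h : step_on 0 t h -> op_step_on t h.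
Proof. by move=> H p /H[]. Qed.

Lemma step_on_cons a b p h : step_on a b (p :: h) ->
  [/\ a <= p.1.1, p.1.1 <= p.1.2 & p.1.2 <= b] /\ step_on a b h.
Proof.
move=> H; split; first by apply: H; rewrite mem_head.
by move=> q qh; apply: H; rewrite inE qh orbT.
Qed.

Lemma step_on_cat a b h1 h2 :
  step_on a b h1 -> step_on a b h2 -> step_on a b (h1 ++ h2).
Proof. by move=> H1 H2 p; rewrite mem_cat => /orP[/H1|/H2]. Qed.

Lemma step_onN a b h : step_on a b h -> step_on a b (opp_step h).
Proof. by move=> H _ /mapP[p ph ->]; exact: H ph. Qed.

Lemma step_onW a b c d h : c <= a -> b <= d -> step_on a b h -> step_on c d h.
Proof.
by move=> ca bd H p /H[ap pp pb]; split=> //; [exact: le_trans ap|exact: le_trans bd].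
Qed.

Lemma op_step_fun_out a b h s : step_on a b h -> ~~ (a < s <= b) -> op_step_fun h s = 0.
Proof.
move=> H sab; rewrite /op_step_fun big_seq big1// => p /H[ap _ pb].
rewrite indicE memNset ?scale0r//= in_itv/= => /andP[ps sp].
by move/negP: sab; apply; rewrite (le_lt_trans ap)// (le_trans sp).
Qed.

Lemma step_on_single (u v : R) (T : 'L(V, W)) : u <= v -> step_on u v [:: ((u, v), T)].
Proof. by move=> uv p; rewrite inE => /eqP -> /=; split. Qed.

Lemma op_step_fun_single (u v s : R) (T : 'L(V, W)) : u < s <= v ->
  op_step_fun [:: ((u, v), T)] s = T.
Proof.
move=> usv; rewrite op_step_fun_cons /op_step_fun big_nil addr0 indicE mem_setE.
by rewrite in_itv/= usv scale1r.
Qed.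

(** Cells are open on the left and closed on the right, so steps on adjacent intervals do not
    overlap: each vanishes on the interval of the other. *)
Lemma step_approx_cat (H : R -> 'L(V, W)) (u v w e : R) h1 h2 : u <= v -> v <= w ->
  step_on u v h1 -> step_on v w h2 ->
  (forall s, u < s <= v -> `|H s - op_step_fun h1 s| <= e) ->
  (forall s, v < s <= w -> `|H s - op_step_fun h2 s| <= e) ->
  step_on u w (h1 ++ h2) /\
  forall s, u < s <= w -> `|H s - op_step_fun (h1 ++ h2) s| <= e.
Proof.
move=> uv vw on1 on2 H1 H2; split.
  by apply: step_on_cat; [exact: step_onW (lexx u) vw on1|exact: step_onW uv (lexx w) on2].
move=> s /andP[us sw]; rewrite op_step_fun_cat; have [sv|vs] := leP s v.
  by rewrite (op_step_fun_out on2) ?addr0 ?H1 ?us// ltNge sv.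
by rewrite (op_step_fun_out on1) ?add0r ?H2 ?vs// negb_and -ltNge vs orbT.
Qed.

Definition clamp (u v x : R) : R := Num.min (Num.max x u) v.

Lemma clamp_l (u v x : R) : x <= u -> u <= v -> clamp u v x = u.
Proof. by move=> xu uv; rewrite /clamp max_r// min_l. Qed.

Lemma clamp_r (u v x : R) : v <= x -> u <= v -> clamp u v x = v.
Proof. by move=> vx uv; rewrite /clamp max_l ?min_r// (le_trans uv). Qed.

Lemma clamp_id (u v x : R) : u <= x -> x <= v -> clamp u v x = x.
Proof. by move=> ux xv; rewrite /clamp max_l ?min_l. Qed.

Lemma clamp_mono (u v x y : R) : x <= y -> clamp u v x <= clamp u v y.
Proof. by move=> xy; apply: le_min2; rewrite ?lexx// le_max2. Qed.

Lemma clamp_ge (u v x : R) : u <= v -> u <= clamp u v x.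
Proof. by move=> uv; rewrite /clamp le_min uv andbT le_max lexx orbT. Qed.

Lemma clamp_le (u v x : R) : clamp u v x <= v.
Proof. by rewrite /clamp ge_min lexx orbT. Qed.

(** On either side of [v], one of the two clamps on the right equals [v], and the last term cancels
    it. *)
Lemma clampD (Z : R -> V) (u v w x : R) : u <= v -> v <= w ->
  Z (clamp u w x) = Z (clamp u v x) + Z (clamp v w x) - Z v.
Proof.
move=> uv vw; have [xv|/ltW vx] := leP x v.
  rewrite (clamp_l xv vw) addrK; congr Z; rewrite /clamp.
  by rewrite !min_l// ge_max ?xv ?uv// (le_trans xv) // (le_trans uv).
rewrite (clamp_r vx uv) addrAC subrr add0r; congr Z; rewrite /clamp.
by rewrite !max_l// (le_trans uv).
Qed.

(** Restriction of [h] to []u, v]]: a cell outside collapses to a degenerate one, which adds nothing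
    to the function or to the integral, so no cell has to be removed. *)
Definition clamp_step (u v : R) h : op_step V W :=
  [seq (clamp u v p.1.1, clamp u v p.1.2, p.2) | p <- h].

Lemma step_on_clamp a b u v h : u <= v -> step_on a b h -> step_on u v (clamp_step u v h).
Proof.
move=> uv H _ /mapP[p /H[_ pp _] ->]; split => /=.
- exact: clamp_ge.
- exact: clamp_mono.
- exact: clamp_le.
Qed.

Lemma clamp_step_id a b h : step_on a b h -> clamp_step a b h = h.
Proof.
move=> H; rewrite -[RHS]map_id; apply/eq_in_map => -[[x y] T] /H[/= ax xy yb].
by rewrite !clamp_id// ?(le_trans ax)// (le_trans xy).
Qed.

Lemma clamp_step_fun u v h s : u < s -> s <= v ->
  op_step_fun (clamp_step u v h) s = op_step_fun h s.
Proof.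
move=> us sv; rewrite /op_step_fun big_map; apply: eq_bigr => p _ /=.
congr (_ *: _); rewrite !indicE; congr (_%:R); congr (nat_of_bool _).
rewrite !mem_setE !in_itv/= /clamp gt_min gt_max us andbT (ltNge v) sv orbF.
by rewrite le_min le_max sv andbT (leNgt s u) us orbF.
Qed.

Lemma op_step_integral_clampD (Z : R -> V) (u v w : R) h : u <= v -> v <= w ->
  op_step_integral Z (clamp_step u w h) =
  op_step_integral Z (clamp_step u v h) + op_step_integral Z (clamp_step v w h).
Proof.
move=> uv vw; elim: h => [|p h IH].
  by rewrite /clamp_step/= /op_step_integral !big_nil addr0.
rewrite /= !op_step_integral_cons /= IH addrACA; congr (_ + _).
rewrite -linearD; congr (p.2 _); rewrite !(clampD Z _ uv vw).
move: (Z (clamp u v _)) (Z (clamp u v _)) (Z (clamp v w _)) (Z (clamp v w _)) (Z v).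
by move=> x1 x2 x3 x4 z; rewrite opprB subrKA opprD addrACA.
Qed.

(** The finitely many end points avoid a short interval to the right of [s], so [h] is constant on
    []s, v]] and the restricted integral reduces to one term. *)
Lemma clamp_step_near_right (Z : R -> V) a b h s : step_on a b h ->
  \forall v \near s^'+,
    op_step_integral Z (clamp_step s v h) = op_step_fun h v (Z v - Z s).
Proof.
have pt (x : R) : \forall v \near s^'+, s < x -> v < x.
  have [sx|_] := ltP s x; last by near=> v.
  by near=> v => _; near: v; exact: nbhs_right_lt.
elim: h => [|p h IH] H.
  by near=> v; rewrite /op_step_integral /op_step_fun !big_nil bop0E.
have [[_ pp _] {}/IH IH] := step_on_cons H.
near=> v; rewrite /= op_step_integral_cons op_step_fun_cons bop_addE.
congr (_ + _); last by near: v.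
have sv : s < v by near: v; exact: nbhs_right_gt.
have H1 : s < p.1.1 -> v < p.1.1 by near: v; exact: pt.
have H2 : s < p.1.2 -> v < p.1.2 by near: v; exact: pt.
rewrite bop_scaleE -linearZ /= indicE mem_setE in_itv/=; congr (p.2 _).
have [ps|/[dup] sp /H1 vp] := leP p.1.1 s.
  rewrite (clamp_l ps) ?(ltW sv)// (le_lt_trans ps sv)/=.
  have [qs|/H2 vq] := leP p.1.2 s.
    by rewrite clamp_l ?(ltW sv)// leNgt (le_lt_trans qs sv) subrr scale0r.
  by rewrite clamp_r ?(ltW sv) ?(ltW vq)// scale1r.
rewrite clamp_r ?(ltW sv)// ?(le_trans (ltW vp))// clamp_r ?ltW// subrr.
by rewrite ltNge (ltW vp) scale0r.
Unshelve. all: by end_near. Qed.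

Lemma clamp_step_near_left (Z : R -> V) a b h s : step_on a b h ->
  \forall u \near s^'-,
    op_step_integral Z (clamp_step u s h) = op_step_fun h s (Z s - Z u).
Proof.
have pt (x : R) : \forall u \near s^'-, x < s -> x < u.
  have [sx|_] := ltP x s; last by near=> u.
  by near=> u => _; near: u; exact: nbhs_left_gt.
elim: h => [|p h IH] H.
  by near=> v; rewrite /op_step_integral /op_step_fun !big_nil bop0E.
have [[_ pp _] {}/IH IH] := step_on_cons H.
near=> u; rewrite /= op_step_integral_cons op_step_fun_cons bop_addE.
congr (_ + _); last by near: u.
have us : u < s by near: u; exact: nbhs_left_lt.
have H1 : p.1.1 < s -> p.1.1 < u by near: u; exact: pt.
have H2 : p.1.2 < s -> p.1.2 < u by near: u; exact: pt.
rewrite bop_scaleE -linearZ /= indicE mem_setE in_itv/=; congr (p.2 _).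
have [sq|/[dup] qs /H2 qu] := leP s p.1.2.
  rewrite (clamp_r sq) ?(ltW us)// andbT.
  have [sp|/H1 pu] := leP s p.1.1.
    by rewrite clamp_r ?(ltW us)// subrr scale0r.
  by rewrite clamp_l ?(ltW us) ?(ltW pu)// scale1r.
rewrite clamp_l ?(ltW us) ?(ltW qu)// clamp_l ?(ltW us)// ?(le_trans pp) ?(ltW qu)//.
by rewrite subrr andbF scale0r.
Unshelve. all: by end_near. Qed.

(** The cells of [h] may overlap, so a bound term by term would be too large. On short intervals [h]
    is constant and the bound is immediate; both sides are compatible with gluing intervals, so
    Cousin's lemma concludes. *)
Lemma op_step_integral_le (Z : R -> V) (a b c : R) h : finite_variation Z ->
  0 <= a -> a <= b -> step_on a b h ->
  (forall s, a < s <= b -> `|op_step_fun h s| <= c) ->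
  `|op_step_integral Z h| <= c * tvar Z a b.
Proof.
move=> fZ a0; rewrite le_eqVlt => /orP[/eqP <- hh _|ab hh hc].
  rewrite tvarxx// mulr0 normr_le0 /op_step_integral big_seq big1// => p /hh[ap pp pa].
  have -> : p.1.1 = p.1.2 by lra.
  by rewrite subrr linear0.
rewrite -(clamp_step_id hh).
have point u s v : a <= u -> u <= v -> s <= b -> a < s ->
    `|op_step_fun h s (Z v - Z u)| <= c * tvar Z u v.
  move=> au uv sb as_; rewrite (le_trans (opnorm_apply _ _))// ler_pM ?hc ?as_//.
  by rewrite norm_le_tvar// (le_trans a0).
apply: (@cousin _ (fun u v =>
  `|op_step_integral Z (clamp_step u v h)| <= c * tvar Z u v : Prop)) => //.
- move=> s /andP[as_ sb]; near=> v => vb.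
  have sv : s < v by near: v; exact: nbhs_right_gt.
  rewrite (near (clamp_step_near_right Z s hh) v)//.
  by apply: point; rewrite ?(le_lt_trans as_ sv)// ltW.
- move=> s /andP[as_ sb]; near=> u => au.
  have us : u < s by near: u; exact: nbhs_left_lt.
  rewrite (near (clamp_step_near_left Z s hh) u)//.
  by apply: point => //; exact: ltW.
- move=> u v w au uv vw wb Puv Pvw.
  rewrite (op_step_integral_clampD Z h (ltW uv) (ltW vw)).
  rewrite (tvarD fZ (le_trans a0 au) (ltW uv) (ltW vw)) mulrDr.
  by rewrite (le_trans (ler_normD _ _))// lerD.
Unshelve. all: by end_near. Qed.

End OpSteps.

Section Stieltjes.
Context {R : realType} {V : normedModType R}.

(** Locally two constants suffice: just after [s] the left limits of [K] are close to [K s], and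
    just before [s], with [s] included, they are close to [left_lim K s]. This is why cells closed
    on the right fit left limits. *)
Lemma step_approx (W : normedModType R) (K : R -> 'L(V, W)) (a b e : R) :
  cadlag K -> 0 <= a -> a <= b -> 0 < e ->
  exists2 h : op_step V W, step_on a b h &
    forall s, a < s <= b -> `|left_lim K s - op_step_fun h s| <= e.
Proof.
move=> cK a0 + e0; rewrite le_eqVlt => /orP[/eqP <-|ab].
  exists [::] => // s /andP[as_ /(lt_le_trans as_)]; by rewrite ltxx.
pose P (x y : R) : Prop := exists2 h : op_step V W, step_on x y h &
    forall s, x < s <= y -> `|left_lim K s - op_step_fun h s| <= e.
suff : P a b by [].
apply: cousin ab _ _ _.
- move=> s /andP[as_ sb]; have s0 := le_trans a0 as_; near=> v => vb.
  have sv : s < v by near: v; exact: nbhs_right_gt.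
  have H : forall x, s <= x <= v -> `|K x - K s| <= e by near: v; exact: cadlag_near_right.
  exists [:: ((s, v), K s)]; first exact/step_on_single/ltW.
  move=> x /andP[sx xv]; rewrite op_step_fun_single ?sx//.
  apply: (left_lim_norm_le cK _ sx); first exact: le_lt_trans sx.
  by move=> y /andP[sy yx]; apply: H; rewrite sy (le_trans (ltW yx)).
- move=> s /andP[as_ sb]; have s0 := le_lt_trans a0 as_; near=> u => au.
  have us : u < s by near: u; exact: nbhs_left_lt.
  have H : forall x, u <= x < s -> `|K x - left_lim K s| <= e.
    by near: u; exact: cadlag_near_left.
  exists [:: ((u, s), left_lim K s)]; first exact/step_on_single/ltW.
  move=> x /andP[ux xs]; rewrite op_step_fun_single ?ux//.
  apply: (left_lim_norm_le cK _ ux); first exact: (le_lt_trans (le_trans a0 au)).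
  by move=> y /andP[uy yx]; apply: H; rewrite uy (lt_le_trans yx).
- move=> u v w au uv vw wb [h1 on1 H1] [h2 on2 H2].
  have [on12 H12] := step_approx_cat (ltW uv) (ltW vw) on1 on2 H1 H2.
  by exists (h1 ++ h2).
Unshelve. all: by end_near. Qed.

Lemma cauchy_seq_cvg (W : completeNormedModType R) (u : nat -> W) :
  (forall e : R, 0 < e -> \forall N \near \oo, forall n m, (N <= n)%N -> (N <= m)%N ->
    `|u n - u m| <= e) -> cvg (u @ \oo).
Proof.
move=> H; apply/cauchy_cvgP; apply: cauchy_exP => e e0.
have e2 : 0 < e / 2 by rewrite divr_gt0.
have [N _ /(_ N (leqnn N)) HN] := H _ e2.
exists (u N); exists N => // n Nn; rewrite -ball_normE /=.
by rewrite (le_lt_trans (HN N n (leqnn N) Nn))// ltr_pdivrMr// ltr_pMr// ltr1n.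
Qed.

(** The constant [T] makes the induction work: where the first cell is active, its operator is
    absorbed into [T]. *)
Lemma measurable_norm_op_step (W : normedModType R) (h : op_step V W) (T : 'L(V, W)) :
  measurable_fun (setT : set (measurableTypeR R)) (fun s => `|T + op_step_fun h s|).
Proof.
elim: h T => [|p h IH] T.
  by under eq_fun do rewrite /op_step_fun big_nil; exact: measurable_cst.
pose P : R -> bool := fun s => (p.1.1 < s) && (s <= p.1.2).
rewrite (_ : (fun s => _) = (fun s => if P s then `|(T + p.2) + op_step_fun h s|
    else `|T + op_step_fun h s|)); last first.
  apply/funext => s; rewrite op_step_fun_cons indicE mem_setE in_itv/= -/(P s).
  by case: (P s); rewrite ?scale1r ?scale0r ?add0r// addrA.
apply: measurable_fun_ifT => //; apply: (measurable_fun_bool true).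
rewrite setTI (_ : _ @^-1` _ = `]p.1.1, p.1.2]%classic); first exact: measurable_itv.
by apply/seteqP; split => x; rewrite /= in_itv.
Qed.

Lemma measurable_norm_left_lim (W : normedModType R) (K : R -> 'L(V, W)) (h : op_step V W) t :
  cadlag K ->
  measurable_fun (`]0, t]%classic : set (measurableTypeR R))
    (fun s => `|left_lim K s - op_step_fun h s|).
Proof.
move=> cK; have [t0|t0] := leP 0 t; last first.
  rewrite set_itv_ge ?bnd_simp -?leNgt ?ltW//; exact: measurable_fun_set0.
have /choice[k kP] (n : nat) : exists k : op_step V W, step_on 0 t k /\ forall s,
    0 < s <= t -> `|left_lim K s - op_step_fun k s| <= n.+1%:R^-1.
  have n0 : 0 < n.+1%:R^-1 :> R by rewrite invr_gt0.
  by have [k k1 k2] := step_approx cK (lexx 0) t0 n0; exists k.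
apply: (@measurable_fun_cvg _ _ _ _ (fun n s => `|0 + op_step_fun (k n ++ opp_step h) s|)).
- by move=> n; apply: measurable_funTS; exact: measurable_norm_op_step.
- move=> s; rewrite /= in_itv/= => s0t; apply: cvg_norm.
  under eq_fun do rewrite add0r op_step_fun_cat op_step_funN.
  apply: cvgB; last exact: cvg_cst.
  apply/cvgrPdist_le => e e0; near=> n; rewrite (le_trans ((kP n).2 s s0t))//.
  by apply: ltW; near: n; exact: (near_infty_natSinv_lt (PosNum e0)).
Unshelve. all: by end_near. Qed.


(** The integral is the limit of step integrals along uniform approximations. The estimate of the
    second clause, valid for every step function close to [left_lim K], determines [I] and carries
    all later arguments; the measure occurs only in the first clause. *)
Lemma stieltjes_ex (W : completeNormedModType R) (K : R -> 'L(V, W)) (Z : R -> V) (t : R) :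
  cadlag K -> 0 <= t -> finite_variation Z ->
  (forall s, 0 <= s -> Z x @[x --> s^'+] --> Z s) ->
  exists I : W, is_stieltjes_integral (left_lim K) Z t I /\
    forall (h : op_step V W) e, step_on 0 t h ->
      (forall s, 0 < s <= t -> `|left_lim K s - op_step_fun h s| <= e) ->
      `|I - op_step_integral Z h| <= e * tvar Z 0 t.
Proof.
move=> cK t0 fZ rZ.
have dist (h1 h2 : op_step V W) e1 e2 : step_on 0 t h1 -> step_on 0 t h2 ->
    (forall s, 0 < s <= t -> `|left_lim K s - op_step_fun h1 s| <= e1) ->
    (forall s, 0 < s <= t -> `|left_lim K s - op_step_fun h2 s| <= e2) ->
    `|op_step_integral Z h1 - op_step_integral Z h2| <= (e1 + e2) * tvar Z 0 t.
  move=> on1 on2 H1 H2; rewrite -op_step_integralN -op_step_integral_cat.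
  apply: op_step_integral_le => //.
    by apply: step_on_cat => //; exact: step_onN.
  move=> s st; rewrite op_step_fun_cat op_step_funN -(subrKA (left_lim K s)).
  by rewrite (le_trans (ler_normD _ _))// lerD ?H2// distrC H1.
have /choice[k kP] (n : nat) : exists k : op_step V W, step_on 0 t k /\ forall s,
    0 < s <= t -> `|left_lim K s - op_step_fun k s| <= n.+1%:R^-1.
  have n0 : 0 < n.+1%:R^-1 :> R by rewrite invr_gt0.
  by have [k k1 k2] := step_approx cK (lexx 0) t0 n0; exists k.
have small (e : R) : 0 < e -> \forall n \near \oo, n.+1%:R^-1 * tvar Z 0 t <= e.
  (* Adding 1 keeps the quotient meaningful when the variation vanishes; the same device recurs in
     later choices of constants. *)
  move=> e0; have d0 : 0 < e / (tvar Z 0 t + 1) by rewrite divr_gt0// ltr_wpDl ?tvar_ge0.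
  have := near_infty_natSinv_lt (PosNum d0); apply: filterS => n /= /ltW.
  rewrite ler_pdivlMr ?ltr_wpDl ?tvar_ge0//; apply: le_trans.
  by rewrite ler_wpM2l// lerDl.
have /cvg_ex[I Ilim] : cvg (op_step_integral Z (k n) @[n --> \oo]).
  apply: cauchy_seq_cvg => e e0; near=> N => n m Nn Nm.
  have [on1 H1] := kP n; have [on2 H2] := kP m.
  rewrite (le_trans (dist _ _ _ _ on1 on2 H1 H2))// (splitr e) mulrDl.
  have : N.+1%:R^-1 * tvar Z 0 t <= e / 2.
    by near: N; apply: small; rewrite divr_gt0.
  move=> H; apply: lerD; apply: le_trans H; rewrite ler_wpM2r ?tvar_ge0//.
    by rewrite lef_pV2 ?posrE// ler_nat.
  by rewrite lef_pV2 ?posrE// ler_nat.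
exists I; split; last first.
  move=> h e onh Hh; apply/ler_addgt0Pr => d d0; apply: (cvg_norm_le _ Ilim).
  near=> n; have [on1 H1] := kP n.
  rewrite (le_trans (dist _ _ _ _ on1 onh H1 Hh))// mulrDl addrC lerD//.
  by near: n; exact: small.
have [mu muP] := variation_measure_ex fZ rZ.
exists mu; split => //; exists k; split => //.
- by move=> n; apply: step_on_op_step_on; exact: (kP n).1.
- by move=> n; exact: measurable_norm_left_lim.
have mI : measurable (`]0, t]%classic : set (measurableTypeR R)) by exact: measurable_itv.
have muI : mu `]0, t]%classic = (tvar Z 0 t)%:E by rewrite muP// vtotal_variationE.
have bound n : (0 <= \int[mu]_(s in `]0%R, t]) (`|left_lim K s - op_step_fun (k n) s|)%:E <=
    (n.+1%:R^-1 * tvar Z 0 t)%:E)%E.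
  apply/andP; split; first by apply: integral_ge0 => s _; rewrite lee_fin.
  rewrite EFinM -muI -integral_cst//; apply: ge0_le_integral => //.
  - by apply/measurable_EFinP; exact: measurable_norm_left_lim.
  - by move=> s; rewrite /= in_itv/= => s0t; rewrite lee_fin; exact: (kP n).2.
apply: (@squeeze_cvge _ _ _ _ (fun=> 0%E) _ (fun n => (n.+1%:R^-1 * tvar Z 0 t)%:E)).
- by near=> n; exact: bound.
- exact: cvg_cst.
- apply: cvg_EFin; first by near=> n.
  apply/cvgrPdist_le => e e0; near=> n.
  rewrite sub0r normrN ger0_norm ?mulr_ge0 ?tvar_ge0//.
  by near: n; exact: small.
Unshelve. all: by end_near. Qed.

End Stieltjes.

(** * Sums over real times *)

#[local] Existing Instance summability.totally_filter.

Section SumUpto.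
Context {R : realType}.

Lemma near_all_seq (T : Type) (F : set_system T) (I : eqType) (r : seq I)
    (P : I -> T -> Prop) : Filter F -> (forall i, \forall x \near F, P i x) ->
  \forall x \near F, forall i, i \in r -> P i x.
Proof.
move=> FF H; elim: r => [|i r IH]; first by apply: filterE.
apply: filterS2 (H i) IH => x Pi Pr j; rewrite inE => /orP[/eqP ->//|]; exact: Pr.
Qed.

Lemma partial_sumE (V : normedModType R) (g : R -> V) (J : {fset R}) :
  summability.partial_sum g J = \sum_(s <- J) g s.
Proof. by rewrite /summability.partial_sum big_seq_fsetE. Qed.

Lemma totally_superset (J0 : {fset R}) : \forall J \near summability.totally, (J0 `<=` J)%fset.
Proof. by exists J0. Qed.

Lemma sum_fset_superset (V : zmodType) (g : R -> V) (J0 J : {fset R}) : (J0 `<=` J)%fset ->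
  \sum_(s <- J) g s = \sum_(s <- J0) g s + \sum_(s <- J | s \notin J0) g s.
Proof.
move=> J0J; rewrite (bigID (mem J0)) /=; congr (_ + _).
rewrite (big_fset_condE _ J); apply: eq_fbigl => s; rewrite !inE.
by apply/andP/idP => [[]//|sJ0]; split=> //; exact: (fsubsetP J0J).
Qed.

Definition absolutely_summable (V : normedModType R) (g : R -> V) :=
  exists M, forall J : {fset R}, \sum_(s <- J) `|g s| <= M.

(** Take [J0] whose sum is within [e] of the supremum of all finite sums: whatever [J] adds to [J0]
    is then at most [e]. *)
Lemma absolutely_summable_tail (V : normedModType R) (g : R -> V) (e : R) :
  absolutely_summable g -> 0 < e -> exists J0 : {fset R},
  forall J : {fset R}, \sum_(s <- J | s \notin J0) `|g s| <= e.
Proof.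
move=> [M gM] e0.
have hs : has_sup [set x | exists J : {fset R}, x = \sum_(s <- J) `|g s|].
  split; first by exists (\sum_(s <- (fset0 : {fset R})) `|g s|), fset0.
  by exists M => _ [J ->]; exact: gM.
have [_ [J0 ->] HJ0] := sup_adherent e0 hs.
exists J0 => J.
have : \sum_(s <- (J0 `|` J)%fset) `|g s| <=
    sup [set x | exists J : {fset R}, x = \sum_(s <- J) `|g s|].
  by apply: (sup_upper_bound hs); eexists.
rewrite (sum_fset_superset _ (fsubsetUl J0 J)).
suff -> : \sum_(s <- (J0 `|` J)%fset | s \notin J0) `|g s| = \sum_(s <- J | s \notin J0) `|g s|.
  by move: HJ0; lra.
rewrite big_fset_condE [in RHS]big_fset_condE; apply: eq_fbigl => s; rewrite !inE.
by case: (s \in J0) => //=; rewrite !andbF.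
Qed.

Lemma partial_sum_cvg (V : completeNormedModType R) (g : R -> V) :
  absolutely_summable g -> cvg (summability.partial_sum g @ summability.totally).
Proof.
move=> gs; apply/cauchy_cvgP; apply: cauchy_exP => e e0.
have e2 : 0 < e / 2 by rewrite divr_gt0.
have [J0 H] := absolutely_summable_tail gs e2.
exists (summability.partial_sum g J0); exists J0 => // J /= J0J.
rewrite -ball_normE /= !partial_sumE (sum_fset_superset _ J0J).
rewrite opprD addrA subrr sub0r normrN (le_lt_trans (ler_norm_sum _ _ _))//.
by rewrite (le_lt_trans (H J))// ltr_pdivrMr// ltr_pMr// ltr1n.
Qed.

Lemma sum_tail (V : completeNormedModType R) (g : R -> V) (e : R) (J0 : {fset R}) :
  absolutely_summable g -> (forall J : {fset R}, \sum_(s <- J | s \notin J0) `|g s| <= e) ->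
  `|summability.sum g - \sum_(s <- J0) g s| <= e.
Proof.
move=> gs H; apply: (cvg_norm_le _ (partial_sum_cvg gs)).
have := totally_superset J0; apply: filterS => J J0J.
rewrite partial_sumE (sum_fset_superset _ J0J) addrAC subrr add0r.
by rewrite (le_trans (ler_norm_sum _ _ _)).
Qed.

Section Upto.
Context {V : completeNormedModType R} (g : R -> V).

Lemma upto_itv (u v s : R) : 0 <= u -> u <= v ->
  upto g v s - upto g u s = if u < s <= v then g s else 0.
Proof.
rewrite /upto => u0 uv; have [su|us] := leP s u; rewrite ?andbT ?andbF/=.
  by rewrite (le_trans su uv) andbT subrr.
by rewrite (le_lt_trans u0 us) subr0.
Qed.

Lemma uptoB_le (u v T s : R) : 0 <= u -> u <= v -> v <= T ->
  `|upto g v s - upto g u s| <= `|upto g T s|.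
Proof.
move=> u0 uv vT; rewrite upto_itv//; case: ifPn => [/andP[us sv]|_]; last by rewrite normr0.
by rewrite /upto (le_lt_trans u0 us) (le_trans sv vT).
Qed.

Hypothesis gs : forall t, 0 <= t -> absolutely_summable (upto g t).

Lemma summable_uptoT (t : R) : 0 <= t -> summable_upto g t.
Proof. by move=> t0; exact: partial_sum_cvg (gs t0). Qed.

Lemma sum_uptoB (u v : R) : 0 <= u -> u <= v ->
  summability.partial_sum (fun s => upto g v s - upto g u s) @ summability.totally -->
  sum_upto g v - sum_upto g u.
Proof.
move=> u0 uv; have v0 := le_trans u0 uv.
rewrite (_ : summability.partial_sum _ = fun J => summability.partial_sum (upto g v) J -
  summability.partial_sum (upto g u) J); last first.
  by apply/funext => J; rewrite !partial_sumE -sumrB.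
by apply: cvgB; exact: summable_uptoT.
Qed.

Lemma sum_uptoB_tail (e T u v : R) (J0 : {fset R}) :
  (forall J : {fset R}, \sum_(s <- J | s \notin J0) `|upto g T s| <= e) ->
  0 <= u -> u <= v -> v <= T ->
  `|sum_upto g v - sum_upto g u - \sum_(s <- J0) (upto g v s - upto g u s)| <= e.
Proof.
move=> H u0 uv vT; apply: (cvg_norm_le _ (sum_uptoB u0 uv)).
have := totally_superset J0; apply: filterS => J J0J.
rewrite partial_sumE (sum_fset_superset _ J0J) addrAC subrr add0r.
rewrite (le_trans (ler_norm_sum _ _ _))// (le_trans _ (H J))//.
by apply: ler_sum => s _; exact: uptoB_le.
Qed.

(** Up to a tail of size [e] only finitely many times matter, and none of them lies in []t, v]] once
    v is close to [t]. *)
Lemma sum_upto_right (t : R) : 0 <= t -> sum_upto g s @[s --> t^'+] --> sum_upto g t.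
Proof.
move=> t0; apply/cvgrPdist_le => e e0.
have T0 : 0 <= t + 1 by rewrite addr_ge0.
have [J0 HJ0] := absolutely_summable_tail (gs T0) e0.
have near_J0 : \forall v \near t^'+, forall s, s \in enum_fset J0 -> t < s -> v < s.
  apply: near_all_seq => s; have [ts|_] := ltP t s; last by near=> v.
  by near=> v => _; near: v; exact: nbhs_right_lt.
near=> v; have tv : t <= v by near: v; exact: nbhs_right_ge.
have vT : v <= t + 1 by near: v; apply: nbhs_right_le; rewrite ltrDl.
have vJ0 : forall s, s \in enum_fset J0 -> t < s -> v < s by near: v; exact: near_J0.
have := sum_uptoB_tail HJ0 t0 tv vT; rewrite big_seq big1 ?subr0 1?distrC// => s sJ0.
rewrite upto_itv//; case: ifPn => // /andP[ts sv].
by have := vJ0 s sJ0 ts; rewrite ltNge sv.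
Unshelve. all: by end_near. Qed.

Lemma sum_upto_left (t : R) : 0 < t ->
  sum_upto g s @[s --> t^'-] --> sum_upto g t - g t.
Proof.
move=> t0; apply/cvgrPdist_le => e e0.
have [J0 HJ0] := absolutely_summable_tail (gs (ltW t0)) e0.
(* Putting [t] into the finite set isolates its term: for u close to [t] it is the only time of the
   set in []u, t]], and it accounts for [g t] in the limit. *)
pose J1 := (t |` J0)%fset.
have HJ1 (J : {fset R}) : \sum_(s <- J | s \notin J1) `|upto g t s| <= e.
  apply: le_trans (HJ0 J); rewrite [leLHS]big_mkcond [leRHS]big_mkcond.
  apply: ler_sum => s _; rewrite /J1 !inE negb_or.
  by case: eqP => _; case: (s \in J0) => //=; rewrite normr_ge0.
have near_J1 : \forall u \near t^'-, forall s, s \in enum_fset J1 -> s < t -> s < u.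
  apply: near_all_seq => s; have [st|_] := ltP s t; last by near=> u.
  by near=> u => _; near: u; exact: nbhs_left_gt.
near=> u; have ut : u < t by near: u; exact: nbhs_left_lt.
have u0 : 0 <= u by near: u; exact: nbhs_left_ge.
have uJ1 : forall s, s \in enum_fset J1 -> s < t -> s < u by near: u; exact: near_J1.
have := sum_uptoB_tail HJ1 u0 (ltW ut) (lexx t).
rewrite (big_fsetD1 t) ?fset1U1//= big_seq big1 ?addr0; last first.
  move=> s; rewrite !inE => /andP[st sJ1]; rewrite upto_itv ?(ltW ut)//.
  case: ifPn => // /andP[us]; rewrite le_eqVlt (negbTE st)/= => /uJ1 su.
  have : s < u by apply: su; rewrite /J1 !inE.
  by rewrite ltNge (ltW us).
rewrite upto_itv ?(ltW ut)// ut lexx /=.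
by rewrite addrAC.
Unshelve. all: by end_near. Qed.

End Upto.

(** The path of sums of norms is the dominating function. The two increments are limits along the
    same net, so they are compared on one finite set where each is within e / 2 of its limit. *)
Lemma finite_variation_sum_upto (V : completeNormedModType R) (g : R -> V) :
  (forall t, 0 <= t -> absolutely_summable (upto g t)) -> finite_variation (sum_upto g).
Proof.
move=> gs.
have ngs t : 0 <= t -> absolutely_summable (upto (fun s => `|g s| : R^o) t).
  move=> /gs[M gM]; exists M => J; apply: le_trans (gM J).
  by apply: ler_sum => s _; rewrite /upto; case: ifP; rewrite ?normr_id ?normr0.
apply: finite_variation_dominated => T.
exists (fun t => sum_upto (fun s => `|g s| : R^o) t : R) => u v u0 uv _.
have /cvgrPdist_le H1 := sum_uptoB gs u0 uv.
have /cvgrPdist_le H2 := sum_uptoB ngs u0 uv.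
apply/ler_addgt0Pr => e e0; have e2 : 0 < e / 2 by rewrite divr_gt0.
have [J [H1J]] := filter_ex (filterI (H1 _ e2) (H2 _ e2)).
rewrite ler_distlC => /andP[_ H2J].
rewrite -(subrK (summability.partial_sum (fun s => upto g v s - upto g u s) J) (_ - sum_upto g u)).
rewrite (le_trans (ler_normD _ _))// (splitr e) addrA addrC.
apply: lerD => //; apply: le_trans H2J.
rewrite !partial_sumE (le_trans (ler_norm_sum _ _ _))//.
apply: ler_sum => s _; rewrite !upto_itv//.
by case: ifP; rewrite ?normr0.
Qed.

End SumUpto.

(** * Convergence modes and tensor products *)

Section Convergence.
Context {R : realType}.

Lemma op_comp_subproof (U V W : normedModType R) (T : 'L(V, W)) (S : 'L(U, V)) :
  (fun x => T (S x)) \in @bounded_operator_pred R U W.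
Proof.
apply/asboolP; split; first by move=> a x y /=; rewrite !linearP.
by move=> x; apply: continuous_comp; exact: bop_continuous.
Qed.

Definition op_comp (U V W : normedModType R) (T : 'L(V, W)) (S : 'L(U, V)) : 'L(U, W) :=
  BoundedOperator (op_comp_subproof T S).

Variable m : convergence_mode.

Lemma converges_strong (V : normedModType R) (u : nat -> V) (l : V) :
  u n @[n --> \oo] --> l -> converges m u l.
Proof.
case: m => //= ul phi; apply: continuous_cvg => //; exact: bop_continuous.
Qed.

Lemma convergesD (V : normedModType R) (u v : nat -> V) (l k : V) :
  converges m u l -> converges m v k -> converges m (fun n => u n + v n) (l + k).
Proof.
case: m => /=; first exact: cvgD.
move=> ul vk phi; rewrite linearD; under eq_fun do rewrite linearD.
exact: cvgD (ul phi) (vk phi).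
Qed.

Lemma convergesB (V : normedModType R) (u v : nat -> V) (l k : V) :
  converges m u l -> converges m v k -> converges m (fun n => u n - v n) (l - k).
Proof.
case: m => /=; first exact: cvgB.
move=> ul vk phi; rewrite bopB; under eq_fun do rewrite bopB.
exact: cvgB (ul phi) (vk phi).
Qed.

(** In the weak mode, a bounded functional composed with [T] is again a bounded functional. *)
Lemma converges_op (V W : normedModType R) (T : 'L(V, W)) (u : nat -> V) (l : V) :
  converges m u l -> converges m (fun n => T (u n)) (T l).
Proof.
case: m => /=; last by move=> ul phi; exact: (ul (op_comp phi T)).
by move=> ul; apply: continuous_cvg => //; exact: bop_continuous.
Qed.

(** Both modes are handled through a Lipschitz map [f]: the identity for norm convergence, each
    bounded functional for weak convergence. The approximation is in norm in both cases, so three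
    errors of size e / 3 suffice, with the tolerance divided by [3 * (M + 1)]. *)
Lemma converges_approx (V : normedModType R) (u : nat -> V) (l : V) :
  (forall e : R, 0 < e -> exists v k, [/\ converges m v k, `|l - k| <= e &
    \forall n \near \oo, `|u n - v n| <= e]) -> converges m u l.
Proof.
move=> H.
have strong (W : normedModType R) (f : V -> W) (M : R) : 0 <= M ->
    (forall x y, `|f x - f y| <= M * `|x - y|) ->
    (forall v k, converges m v k -> f (v n) @[n --> \oo] --> f k) ->
    f (u n) @[n --> \oo] --> f l.
  move=> M0 fM fm; apply/cvgrPdist_le => e e0.
  have d0 : 0 < e / (3 * (M + 1)) by rewrite divr_gt0// mulr_gt0// ltr_wpDl.
  have [v [k [vk lk uv]]] := H _ d0.
  have Md : M * (e / (3 * (M + 1))) <= e / 3.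
    rewrite invfM mulrA [leLHS]mulrA ler_pdivrMr ?ltr_wpDl// mulrC.
    by rewrite mulrCA mulrC (mulrC 3^-1) ler_wpM2l ?divr_ge0 ?(ltW e0)// lerDl.
  have e3 : 0 < e / 3 by rewrite divr_gt0.
  near=> n.
  have H1 : `|f l - f k| <= e / 3.
    by rewrite (le_trans (fM _ _))// (le_trans _ Md)// ler_wpM2l.
  have H2 : `|f k - f (v n)| <= e / 3.
    by near: n; have /cvgrPdist_le := fm v k vk; exact.
  have H3 : `|f (v n) - f (u n)| <= e / 3.
    rewrite (le_trans (fM _ _))// (le_trans _ Md)// ler_wpM2l// distrC.
    by near: n.
  rewrite -(subrKA (f k)) (le_trans (ler_normD _ _))//.
  rewrite -(subrKA (f (v n)) (f k)).
  have := ler_normD (f k - f (v n)) (f (v n) - f (u n)); lra.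
case: m strong => /= strong.
  apply: (strong V id 1) => // x y; by rewrite mul1r.
move=> phi; apply: (strong R^o phi `|phi|) => //.
by move=> x y; rewrite -linearB opnorm_apply.
Unshelve. all: by end_near. Qed.

End Convergence.

Section TensorAlgebra.
Context {R : realType} (alpha : @tensor_norm_family R).
Hypothesis alpha_uniform : uniform_crossnorm alpha.

Section Tprod.
Context {E F : completeNormedModType R} (C : tensor_completion alpha E F).

Lemma tprodDl x x' y : tprod C (x + x') y = tprod C x y + tprod C x' y.
Proof.
rewrite /tprod -[tc_embed C (pure_tensor x y)]scale1r -tc_embed_linear scale1r.
by congr tc_embed; apply/val_inj/funext => B /=; rewrite linearDl.
Qed.

Lemma tprodDr x y y' : tprod C x (y + y') = tprod C x y + tprod C x y'.
Proof.
rewrite /tprod -[tc_embed C (pure_tensor x y)]scale1r -tc_embed_linear scale1r.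
by congr tc_embed; apply/val_inj/funext => B /=; rewrite linearDr.
Qed.

Lemma tprodNl x y : tprod C (- x) y = - tprod C x y.
Proof.
have H : tprod C 0 y = 0 by apply: (addrI (tprod C 0 y)); rewrite -tprodDl !addr0.
by apply: (addrI (tprod C x y)); rewrite -tprodDl !subrr.
Qed.

Lemma tprodNr x y : tprod C x (- y) = - tprod C x y.
Proof.
have H : tprod C x 0 = 0 by apply: (addrI (tprod C x 0)); rewrite -tprodDr !addr0.
by apply: (addrI (tprod C x y)); rewrite -tprodDr !subrr.
Qed.

Lemma tprod0l y : tprod C 0 y = 0.
Proof. by apply: (addrI (tprod C 0 y)); rewrite -tprodDl !addr0. Qed.

Lemma norm_tprod x y : `|tprod C x y| <= `|x| * `|y|.
Proof.
rewrite /tprod tc_embed_norm.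
exact: crossnorm_pure (uniform_crossnorm_reasonable alpha_uniform E F) x y.
Qed.

End Tprod.

Lemma norm_tprodB {E : completeNormedModType R} (C : tensor_completion alpha E E) x y :
  `|tprod C x x - tprod C y y| <= `|x - y| * (`|x| + `|y|).
Proof.
have -> : tprod C x x - tprod C y y = tprod C (x - y) x + tprod C y (x - y).
  by rewrite tprodDl tprodDr tprodNl tprodNr addrA subrK.
rewrite (le_trans (ler_normD _ _))// mulrDr lerD ?norm_tprod//.
by rewrite mulrC norm_tprod.
Qed.

Section TensorOp.
Context {E1 F1 E2 F2 : completeNormedModType R}.
Variables (C1 : tensor_completion alpha E1 F1) (C2 : tensor_completion alpha E2 F2).

Lemma op_eq_dense (L M : 'L(C1, C2)) :
  (forall u, L (tc_embed C1 u) = M (tc_embed C1 u)) -> L = M.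
Proof.
move=> LM; apply/val_inj/funext => x /=; apply/eqP; rewrite -subr_eq0 -normr_le0.
apply/ler_addgt0Pl => e e0; rewrite addr0.
pose k := `|L - M| + 1.
have k0 : 0 < k by rewrite /k ltr_wpDl.
have ek : 0 < e / k by rewrite divr_gt0.
have [y [By [u _ uy]]] : (ball x (e / k) `&` range (tc_embed C1)) !=set0.
  apply: tc_embed_dense; first by exists x; exact: ballxx.
  exact: ball_open.
have -> : L x - M x = (L - M) (x - y).
  have LMy : L y = M y by rewrite -uy LM.
  by rewrite bop_subE (linearB L) (linearB M) /= LMy opprB subrKA.
rewrite (le_trans (opnorm_apply _ _))//.
move: By; rewrite -ball_normE /= => /ltW By.
rewrite (le_trans (ler_wpM2l (normr_ge0 _) By))// mulrA ler_pdivrMr// mulrC.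
by rewrite ler_wpM2l ?(ltW e0)// /k lerDl.
Qed.

Lemma tensor_op_extends (T : 'L(E1, E2)) (S : 'L(F1, F2)) :
  extends_tensor_map T S (tensor_op C1 C2 T S).
Proof.
have [L LE _] := uniform_crossnorm_extends alpha_uniform C1 C2 T S.
by apply: getPex; exists L.
Qed.

(** [tensor_op] selects an extension by choice. Algebraic tensors being dense, the extension is
    unique, so what is known of one extension, such as its norm bound, passes to [tensor_op]. *)
Lemma tensor_op_eq (T : 'L(E1, E2)) (S : 'L(F1, F2)) (L : 'L(C1, C2)) :
  extends_tensor_map T S L -> tensor_op C1 C2 T S = L.
Proof.
by move=> LE; apply: op_eq_dense => u; rewrite LE; exact: tensor_op_extends.
Qed.

Lemma tensor_op_tprod T S x y :
  tensor_op C1 C2 T S (tprod C1 x y) = tprod C2 (T x) (S y).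
Proof. by rewrite /tprod tensor_op_extends tensor_map_pure. Qed.

Lemma norm_tensor_op T S : `|tensor_op C1 C2 T S| <= `|T| * `|S|.
Proof.
have [L LE LTS] := uniform_crossnorm_extends alpha_uniform C1 C2 T S.
by rewrite (tensor_op_eq LE).
Qed.

Lemma tc_embedB u v : tc_embed C2 (u - v) = tc_embed C2 u - tc_embed C2 v.
Proof. by rewrite addrC -scaleN1r tc_embed_linear scaleN1r addrC. Qed.

Lemma tensor_op_Bl T T' S :
  tensor_op C1 C2 (T - T') S = tensor_op C1 C2 T S - tensor_op C1 C2 T' S.
Proof.
apply: tensor_op_eq => u; rewrite bop_subE.
rewrite !tensor_op_extends -tc_embedB; congr tc_embed; apply/val_inj/funext => B /=.
rewrite fctE /=; case: u => u /= /asboolP[s us].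
rewrite [in LHS](_ : (- _) B = - u (bilinear_comp T' S B))// !us -sumrB.
apply: eq_bigr => p _; rewrite /= /bilinear_comp /=.
by rewrite -linearBl.
Qed.

Lemma tensor_op_Br T S S' :
  tensor_op C1 C2 T (S - S') = tensor_op C1 C2 T S - tensor_op C1 C2 T S'.
Proof.
apply: tensor_op_eq => u; rewrite bop_subE.
rewrite !tensor_op_extends -tc_embedB; congr tc_embed; apply/val_inj/funext => B /=.
rewrite fctE /=; case: u => u /= /asboolP[s us].
rewrite [in LHS](_ : (- _) B = - u (bilinear_comp T S' B))// !us -sumrB.
apply: eq_bigr => p _; rewrite /= /bilinear_comp /=.
by rewrite -linearBr.
Qed.

End TensorOp.

Lemma norm_tensor_opB {E F : completeNormedModType R} (C1 : tensor_completion alpha E E)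
    (C2 : tensor_completion alpha F F) (T S : 'L(E, F)) :
  `|tensor_op C1 C2 T T - tensor_op C1 C2 S S| <= `|T - S| * (`|T| + `|S|).
Proof.
have -> : tensor_op C1 C2 T T - tensor_op C1 C2 S S =
    tensor_op C1 C2 (T - S) T + tensor_op C1 C2 S (T - S).
  by rewrite tensor_op_Bl tensor_op_Br addrA subrK.
rewrite (le_trans (ler_normD _ _))// mulrDr lerD ?norm_tensor_op//.
by rewrite mulrC norm_tensor_op.
Qed.

End TensorAlgebra.

(** * Partitions *)

Section FinePartitions.
Context {R : realType}.

Lemma cvge0_lt (T : Type) (F : set_system T) (u : T -> \bar R) (e : R) : Filter F ->
  u @ F --> 0%E -> 0 < e -> \forall x \near F, (u x < e%:E)%E.
Proof.
move=> FF u0 e0; apply: (u0 [set y | (y < e%:E)%E]); apply: open_nbhs_nbhs.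
by split; [exact: open_ereal_lt_ereal|rewrite /= lte_fin].
Qed.

Lemma partition_lt (p : nat -> R) i j : is_partition p -> (i < j)%N -> p i < p j.
Proof. by case=> _ p_lt _; apply: (homo_ltn lt_trans p_lt). Qed.

Lemma partition_le (p : nat -> R) i j : is_partition p -> (i <= j)%N -> p i <= p j.
Proof.
move=> pp; rewrite leq_eqVlt => /orP[/eqP ->//|/(partition_lt pp)]; exact: ltW.
Qed.

Lemma partition_ge0 (p : nat -> R) i : is_partition p -> 0 <= p i.
Proof. by move=> pp; case: (pp) => <- _ _; exact: partition_le. Qed.

Lemma partition_ex (p : nat -> R) t : is_partition p -> exists N, t <= p N.
Proof. by move=> [_ _ /cvgryPge/(_ t)/filter_ex]. Qed.

Lemma partition_index_ex (p : nat -> R) s : is_partition p -> 0 < s ->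
  exists i, p i < s <= p i.+1.
Proof.
move=> pp s0; have ex := partition_ex s pp.
case: (ex_minnP ex) => -[|i] si imin; first by case: pp si => -> _ _; rewrite leNgt s0.
exists i; rewrite si andbT ltNge; apply/negP => /imin; by rewrite ltnn.
Qed.

Lemma partition_index_uniq (p : nat -> R) s i j : is_partition p ->
  p i < s <= p i.+1 -> p j < s <= p j.+1 -> i = j.
Proof.
move=> pp /andP[is_ si] /andP[js sj]; apply/eqP; rewrite eqn_leq.
apply/andP; split; rewrite leqNgt; apply/negP => /(partition_le pp) ij.
  by have := lt_le_trans is_ sj; rewrite ltNge ij.
by have := lt_le_trans js si; rewrite ltNge ij.
Qed.

Definition partition_index (p : nat -> R) (s : R) : nat :=
  xget 0%N [set i | p i < s <= p i.+1].

Lemma partition_indexP (p : nat -> R) s : is_partition p -> 0 < s ->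
  p (partition_index p s) < s <= p (partition_index p s).+1.
Proof.
move=> pp /(partition_index_ex pp)[i Hi].
by apply: (@xgetPex _ 0%N [set i | p i < s <= p i.+1]); exists i.
Qed.

Context {V : normedModType R} (Z : R -> V).

(* Each cell of the partition is cut at a single point on both sides of which
   the path oscillates by at most [e]: this is the common consequence of a small
   mesh and of a small left oscillation. *)
Definition fine_at (t e : R) (p : nat -> R) := forall i, p i < t ->
  exists c, [/\ p i < c <= p i.+1,
    forall u v, p i <= u < c -> u <= t -> p i <= v < c -> v <= t -> `|Z u - Z v| <= e &
    forall u v, c <= u <= p i.+1 -> u <= t -> c <= v <= p i.+1 -> v <= t ->
      `|Z u - Z v| <= e].

(** Cutting each cell at its right end point leaves the half-open cell, where the left oscillation
    applies, and a single point. *)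
Lemma fine_osc_left (pi : nat -> nat -> R) (t e : R) : (forall n, is_partition (pi n)) ->
  osc_left Z t (pi n) @[n --> \oo] --> 0%E -> 0 < e ->
  \forall n \near \oo, fine_at t e (pi n).
Proof.
move=> ppi osc0 e0.
have : \forall n \near \oo, (osc_left Z t (pi n) < e%:E)%E.
  exact: (cvge0_lt _ osc0 e0).
apply: filterS => n On i it; exists (pi n i.+1); split.
- by rewrite lexx (partition_lt (ppi n)).
- have u0 u : pi n i <= u -> 0 <= u by exact/le_trans/partition_ge0.
  move=> u v /andP[iu ui] ut /andP[iv vi] vt.
  rewrite -lee_fin (le_trans _ (ltW On))//; apply: ereal_sup_ubound.
  by exists i, u, v; split; rewrite ?iu ?ui ?iv ?vi ?u0.
- move=> u v iu _ iv _; have -> : u = v by lra.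
  by rewrite subrr normr0 ltW.
Qed.

Hypothesis cZ : cadlag Z.

(** A Lebesgue number argument. When two intervals are glued at [v], a cell across [v] is cut at [v]
    itself, once [d] is small enough to keep the cell where the path is close to [left_lim Z v]
    before [v] and to [Z v] from [v] on. *)
Lemma fine_mesh (pi : nat -> nat -> R) (t e : R) : (forall n, is_partition (pi n)) ->
  mesh (pi n) @[n --> \oo] --> 0%E -> 0 <= t -> 0 < e ->
  \forall n \near \oo, fine_at t e (pi n).
Proof.
move=> ppi mesh0 t0 e0.
have e2 : 0 < e / 2 by rewrite divr_gt0.
have close x y l : `|Z x - l| <= e / 2 -> `|Z y - l| <= e / 2 -> `|Z x - Z y| <= e.
  move=> xl yl; rewrite -(subrKA l) (splitr e) (le_trans (ler_normD _ _))//.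
  by rewrite lerD// distrC.
pose cut r s := exists c, [/\ r < c <= s,
    forall u v, r <= u < c -> r <= v < c -> `|Z u - Z v| <= e &
    forall u v, c <= u <= s -> c <= v <= s -> `|Z u - Z v| <= e].
have cut_right r s l : r < s -> (forall x, r <= x < s -> `|Z x - l| <= e / 2) -> cut r s.
  move=> rs H; exists s; split; first by rewrite rs lexx.
    by move=> u v Hu Hv; apply: (@close _ _ l); exact: H.
  move=> u v Hu Hv; have -> : u = v by lra.
  by rewrite subrr normr0 ltW.
have [d d0 Hd] : exists2 d : R, 0 < d & forall r s, 0 <= r -> r < s -> s <= t + 1 ->
    s - r < d -> cut r s.
  pose P (a b : R) : Prop := exists2 d : R, 0 < d & forall r s, a <= r -> r < s ->
      s <= b -> s - r < d -> cut r s.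
  suff : P 0 (t + 1) by [].
  apply: cousin; first by rewrite ltr_wpDl.
  - move=> s /andP[s0 st]; near=> v => vt; exists 1 => // r r' sr rr' r'v _.
    apply: (cut_right _ _ (Z s)) => // x /andP[rx xr'].
    have H : forall x, s <= x <= v -> `|Z x - Z s| <= e / 2.
      by near: v; exact: cadlag_near_right.
    by apply: H; rewrite (le_trans sr)// (le_trans (ltW xr')).
  - move=> s /andP[s0 st]; near=> u => u0; exists 1 => // r r' sr rr' r'v _.
    apply: (cut_right _ _ (left_lim Z s)) => // x /andP[rx xr'].
    have H : forall x, u <= x < s -> `|Z x - left_lim Z s| <= e / 2.
      by near: u; exact: cadlag_near_left.
    by apply: H; rewrite (le_trans sr)// (lt_le_trans xr').
  - move=> u v w u0 uv vw wt [d1 d10 H1] [d2 d20 H2].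
    have v0 : 0 < v by exact: le_lt_trans uv.
    have [l [lv Hl]] : exists l, l < v /\ forall x, l <= x < v -> `|Z x - left_lim Z v| <= e / 2.
      near v^'- => l; exists l; split; first by near: l; exact: nbhs_left_lt.
      by near: l; exact: cadlag_near_left.
    have [r [vr Hr]] : exists r, v < r /\ forall x, v <= x <= r -> `|Z x - Z v| <= e / 2.
      near v^'+ => r; exists r; split; first by near: r; exact: nbhs_right_gt.
      by near: r; exact: (cadlag_near_right cZ (ltW v0)).
    exists (Num.min (Num.min d1 d2) (Num.min (v - l) (r - v))).
      by rewrite !lt_min d10 d20 !subr_gt0 lv vr.
    move=> x y ux xy yw; rewrite !lt_min => /andP[/andP[xy1 xy2] /andP[xyl xyr]].
    have [yv|vy] := leP y v; first exact: H1.
    have [vx|xv] := leP v x; first exact: H2.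
    exists v; split; first by rewrite xv ltW.
      move=> a b /andP[xa av] /andP[xb bv].
      by apply: (@close _ _ (left_lim Z v)); apply: Hl; rewrite ?av ?bv andbT; lra.
    move=> a b /andP[xa av] /andP[xb bv].
    by apply: (@close _ _ (Z v)); apply: Hr; rewrite ?xa ?xb /=; lra.
(* The bound 1 keeps a cell that starts before [t] inside [[0, t + 1]], where [d] was obtained. *)
have : \forall n \near \oo, (mesh (pi n) < (Num.min d 1)%:E)%E.
  by apply: (cvge0_lt _ mesh0); rewrite lt_min d0 /=.
apply: filterS => n Mn i it.
have : `|pi n i.+1 - pi n i| < Num.min d 1.
  by rewrite -lte_fin (le_lt_trans _ Mn)//; apply: ereal_sup_ubound; exists i.
have ii := partition_lt (ppi n) (ltnSn i).
rewrite gtr0_norm ?subr_gt0// lt_min => /andP[id i1].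
have [||||c [Hc H1 H2]] := Hd (pi n i) (pi n i.+1) => //.
- exact: partition_ge0.
- by move: i1 it; lra.
by exists c; split=> // u v Hu _ Hv _; [exact: H1|exact: H2].
Unshelve. all: by end_near. Qed.

(** If [s] were not the cut, the values just before [s] and the value at [s] would belong to the
    same piece, and the jump would be at most [e]. Hence a cell contains at most one jump larger
    than [e]. *)
Lemma fine_cut_jump (t e : R) (p : nat -> R) i s c : is_partition p ->
  (forall u v, p i <= u < c -> u <= t -> p i <= v < c -> v <= t -> `|Z u - Z v| <= e) ->
  (forall u v, c <= u <= p i.+1 -> u <= t -> c <= v <= p i.+1 -> v <= t ->
      `|Z u - Z v| <= e) ->
  p i < c -> p i < s <= p i.+1 -> s <= t -> e < `|left_lim Z s - Z s| -> c = s.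
Proof.
move=> pp H1 H2 ic /andP[is_ si] st es.
have s0 : 0 < s by rewrite (le_lt_trans _ is_)// partition_ge0.
have [sc|cs|//] := ltgtP s c; exfalso.
  move: es; rewrite ltNge => /negP; apply; apply: (left_lim_norm_le cZ s0 is_) => x /andP[ix xs].
  by apply: H1; rewrite ?ix ?(ltW is_)//= ?(lt_trans xs)// ltW// (lt_le_trans xs).
move: es; rewrite ltNge => /negP; apply; apply: (left_lim_norm_le cZ s0 cs) => x /andP[cx xs].
by apply: H2; rewrite ?cx ?(ltW cs)//= ltW// (lt_le_trans xs).
Qed.

Lemma fine_jump (t e : R) (p : nat -> R) i s : is_partition p -> fine_at t e p ->
  p i < s <= p i.+1 -> s <= t -> e < `|left_lim Z s - Z s| ->
  `|left_lim Z s - Z (p i)| <= e /\ `|Z (Num.min (p i.+1) t) - Z s| <= e.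
Proof.
move=> pp fp /[dup] Hs /andP[is_ si] st es.
have s0 : 0 < s by rewrite (le_lt_trans _ is_)// partition_ge0.
have it := lt_le_trans is_ st.
have [c [/andP[ic ci] H1 H2]] := fp i it.
have cs := fine_cut_jump pp H1 H2 ic Hs st es; rewrite {}cs in ic ci H1 H2.
split.
  apply: (left_lim_norm_le cZ s0 is_) => x /andP[ix xs].
  by apply: H1; rewrite ?ix ?lexx// ltW// (lt_le_trans xs).
by apply: H2; rewrite ?lexx ?le_min ?ge_min ?si ?st ?lexx ?orbT.
Qed.

End FinePartitions.

(** * Weighted sums of squared increments *)

Lemma increment_ge (R : realType) (V : normedModType R) (X : R -> V)
    (p : nat -> R) i v : is_partition p -> v <= p i -> increment X v p i = 0.
Proof.
move=> pp vi; rewrite /increment !min_r ?subrr//.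
by rewrite (le_trans vi)// partition_le.
Qed.

Section RiemannSums.
Context {R : realType} (alpha : @tensor_norm_family R).
Hypothesis alpha_uniform : uniform_crossnorm alpha.
Context {E : completeNormedModType R} (C : tensor_completion alpha E E).
Context {V W : normedModType R}.
Variables (X : R -> E) (Z : R -> V) (k : R -> 'L(C, W)).
Hypothesis XZ : forall u v, `|X u - X v| <= `|Z u - Z v|.

Definition tsq (x : E) : C := tprod C x x.

Definition tsum (p : nat -> R) (N : nat) (v : R) : C :=
  \sum_(i < N) tsq (increment X v p i).

Definition weighted_tsum (p : nat -> R) (N : nat) (v : R) : W :=
  \sum_(i < N) k (p i) (tsq (increment X v p i)).

Definition sqsum (p : nat -> R) (N : nat) (v : R) : R :=
  \sum_(i < N) `|increment X v p i| ^+ 2.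

Lemma norm_tsq x : `|tsq x| <= `|x| ^+ 2.
Proof. by rewrite expr2 norm_tprod. Qed.

Section Cell.
Variables (p : nat -> R) (t d e e' M B : R) (T : 'L(C, W)) (u v : R).
Hypothesis pp : is_partition p.
Hypothesis fp : fine_at Z t d p.
Hypotheses (u0 : 0 <= u) (uv : u < v) (vt : v <= t) (d0 : 0 <= d).
Hypotheses (e0 : 0 <= e) (e'0 : 0 <= e').
Hypothesis kT : forall x, u <= x < v -> `|k x - T| <= e.
Hypothesis kd : forall x y, 0 <= x <= t -> 0 <= y <= t -> `|Z x - Z y| <= d ->
  `|k x - k y| <= e'.
Hypothesis kM : forall x, 0 <= x <= t -> `|k x - T| <= M.
Hypothesis XB : forall x y, 0 <= x <= t -> 0 <= y <= t -> `|X x - X y| <= B.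

Let err : R := e' * B ^+ 2 + (M + e) * (d ^+ 2 + 2 * d * B).

Let B0 : 0 <= B.
Proof.
have H : 0 <= u <= t by rewrite u0 (le_trans (ltW uv)).
by rewrite (le_trans _ (XB H H)).
Qed.

Let M0 : 0 <= M.
Proof.
have H : 0 <= u <= t by rewrite u0 (le_trans (ltW uv)).
by rewrite (le_trans _ (kM H)).
Qed.

Let err0 : 0 <= err.
Proof.
by rewrite addr_ge0// ?mulr_ge0 ?addr_ge0 ?sqr_ge0// !mulr_ge0.
Qed.

Let D (i : nat) : 'L(C, W) := k (p i) - T.

(* Only the cell straddling [u] can contribute [err]; in the other cells either
   both increments agree or [k (p i)] is close to [T]. *)
Lemma weighted_term_le i :
  `|D i (tsq (increment X v p i) - tsq (increment X u p i))| <=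
  e * (`|increment X v p i| ^+ 2 - `|increment X u p i| ^+ 2) +
  (p i < u <= p i.+1)%R%:R * err.
Proof.
have ind0 : 0 <= (p i < u <= p i.+1)%R%:R * err by rewrite mulr_ge0.
have [vi|iv] := leP v (p i).
  have ui := le_trans (ltW uv) vi.
  by rewrite (increment_ge X pp vi) (increment_ge X pp ui) !subrr linear0 normr0 mulr0 add0r.
have [iu|ui] := leP (p i.+1) u.
  have ii := partition_le pp (leqnSn i).
  have -> : increment X v p i = increment X u p i.
    have ip : p i <= u by exact: le_trans iu.
    by rewrite /increment !min_l// ?(le_trans iu) ?(ltW uv)// ltW.
  by rewrite !subrr linear0 normr0 mulr0 add0r.
have i0 : 0 <= p i by exact: partition_ge0.
have it : 0 <= p i <= t by rewrite i0 (le_trans (ltW iv)).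
have ut : 0 <= u <= t by rewrite u0 (le_trans (ltW uv)).
have [uip|ipu] := leP u (p i).
  rewrite [increment X u p i]increment_ge// [false && _]/= mul0r addr0 normr0.
  rewrite expr0n [_ == _]/= subr0.
  rewrite /tsq tprod0l subr0.
  apply: le_trans (opnorm_apply (D i) _) _.
  rewrite ler_pM ?norm_tsq//.
  by apply: kT; rewrite uip.
have uip1 : u <= p i.+1 by exact: ltW.
rewrite uip1 [true && true]/= mul1r.
set iu := increment X u p i; set iv' := increment X v p i.
set m := Num.min (p i.+1) v.
have um : u <= m by rewrite le_min uip1 ltW.
have mt : 0 <= m <= t by rewrite (le_trans u0 um)/= ge_min vt orbT.
have iuE : iu = X u - X (p i) by rewrite /iu /increment min_r// min_l// ltW.
have ivE : iv' = X m - X (p i) by rewrite /iv' /increment -/m min_l// ltW.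
have iuB : `|iu| <= B by rewrite iuE XB.
have ivB : `|iv'| <= B by rewrite ivE XB.
have ku : `|k u - T| <= e by apply: kT; rewrite lexx.
have ki := kM it.
have [c [/andP[ic ci] H1 H2]] := fp (lt_le_trans ipu (proj2 (andP ut))).
(* If [u] precedes the cut, [k (p i)] is within [e + e'] of [T] and the increment up to [u] is at
   most [d]; this costs [e' * B ^+ 2 + (M + e) * d ^+ 2]. Otherwise [X] moves by at most [d] between
   [u] and [m], the tensor squares and the scalar squares change by at most [2 * d * B], and the
   cost is [(M + e) * (2 * d * B)]. [err] covers both. *)
have [uc|cu] := ltP u c.
  have iud : `|Z u - Z (p i)| <= d.
    by apply: H1; rewrite ?uc ?(ltW ipu) ?lexx//; move: ut it => /andP[_ ?] /andP[_ ?].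
  have kiT : `|k (p i) - T| <= e + e'.
    rewrite -(subrKA (k u)) addrC (le_trans (ler_normD _ _))// lerD// distrC.
    exact: kd.
  have iud' : `|iu| <= d by rewrite iuE (le_trans (XZ _ _)).
  rewrite (bopB (D i)) (le_trans (ler_normB _ _))//.
  have H3 : `|D i (tsq iv')| <= (e + e') * `|iv'| ^+ 2.
    by rewrite (le_trans (opnorm_apply (D i) _))// ler_pM// norm_tsq.
  have H4 : `|D i (tsq iu)| <= M * d ^+ 2.
    rewrite (le_trans (opnorm_apply (D i) _))// ler_pM// (le_trans (norm_tsq _))//.
    by rewrite lerXn2r// nnegrE.
  have H5 : `|iv'| ^+ 2 <= B ^+ 2 by rewrite lerXn2r// nnegrE.
  have H6 : `|iu| ^+ 2 <= d ^+ 2 by rewrite lerXn2r// nnegrE.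
  have H7 : e' * `|iv'| ^+ 2 <= e' * B ^+ 2 by rewrite ler_wpM2l.
  have H8 : e * `|iu| ^+ 2 <= e * d ^+ 2 by rewrite ler_wpM2l.
  have H9 : 0 <= (M + e) * (2 * d * B) by rewrite !mulr_ge0// addr_ge0.
  by move: H3 H4 H7 H8 H9; rewrite /err; lra.
have mu : `|X m - X u| <= d.
  rewrite (le_trans (XZ _ _))//; apply: H2; rewrite ?cu ?uip1 ?(le_trans cu um)//.
  - by rewrite /m ge_min lexx.
  - by case/andP : mt.
  - by case/andP : ut.
have diff : iv' - iu = X m - X u by rewrite ivE iuE opprB addrA subrK.
have H3 : `|tsq iv' - tsq iu| <= d * (2 * B).
  rewrite (le_trans (norm_tprodB alpha_uniform C _ _))// diff ler_pM//.
  by rewrite (mulr_natl B 2) mulr2n lerD.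
have H4 : `|D i (tsq iv' - tsq iu)| <= M * (d * (2 * B)).
  by rewrite (le_trans (opnorm_apply (D i) _))// ler_pM.
have H5 : - (d * (2 * B)) <= `|iv'| ^+ 2 - `|iu| ^+ 2.
  rewrite subr_sqr -mulNr.
  have a1 : - d <= `|iv'| - `|iu|.
    have := ler_dist_dist iv' iu; rewrite diff => /le_trans/(_ mu).
    by rewrite ler_norml => /andP[].
  have a2 : 0 <= `|iv'| + `|iu| by rewrite addr_ge0.
  have a3 : `|iv'| + `|iu| <= 2 * B by rewrite (mulr_natl B 2) mulr2n lerD.
  have a4 : - d * (2 * B) <= - d * (`|iv'| + `|iu|).
    by rewrite !mulNr lerN2 ler_wpM2l.
  by apply: (le_trans a4); rewrite ler_wpM2r.
have H6 : - (e * (d * (2 * B))) <= e * (`|iv'| ^+ 2 - `|iu| ^+ 2).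
  by rewrite -mulrN ler_wpM2l.
have H7 : 0 <= e' * B ^+ 2 by rewrite mulr_ge0// sqr_ge0.
have H8 : 0 <= (M + e) * d ^+ 2 by rewrite mulr_ge0 ?addr_ge0// sqr_ge0.
by move: H4 H6 H7 H8; rewrite /err; lra.
Qed.

(** The indicators telescope. This makes the error of [weighted_tsum_cell] independent of the number
    of cells. *)
Lemma sum_straddle (N : nat) : \sum_(i < N) ((p i < u <= p i.+1)%R%:R : R) <= 1.
Proof.
have indE i : ((p i < u <= p i.+1)%R%:R : R) = (u <= p i.+1)%R%:R - (u <= p i)%R%:R.
  have ii := partition_le pp (leqnSn i).
  rewrite ltNge; case: (leP u (p i)) => /= [ui|_]; last by rewrite subr0.
  by rewrite (le_trans ui ii) subrr.
under eq_bigr do rewrite indE.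
rewrite -(big_mkord xpredT (fun i => (u <= p i.+1)%R%:R - (u <= p i)%R%:R)).
rewrite telescope_sumr//; case: (u <= p N); case: (u <= p 0%N) => /=; lra.
Qed.

Lemma weighted_tsum_cell (N : nat) :
  `|weighted_tsum p N v - weighted_tsum p N u - T (tsum p N v - tsum p N u)| <=
  e * (sqsum p N v - sqsum p N u) + err.
Proof.
have -> : weighted_tsum p N v - weighted_tsum p N u - T (tsum p N v - tsum p N u) =
    \sum_(i < N) D i (tsq (increment X v p i) - tsq (increment X u p i)).
  rewrite /weighted_tsum /tsum -!sumrB linear_sum -sumrB; apply: eq_bigr => i _.
  by rewrite -(bopB (k (p i))).
rewrite (le_trans (ler_norm_sum _ _ _))//.
apply: (@le_trans _ _ (\sum_(i < N) (e * (`|increment X v p i| ^+ 2 -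
    `|increment X u p i| ^+ 2) + (p i < u <= p i.+1)%R%:R * err))).
  by apply: ler_sum => i _; exact: weighted_term_le.
rewrite big_split /= -mulr_sumr sumrB lerD2l -mulr_suml -[leRHS]mul1r.
by rewrite ler_wpM2r// sum_straddle.
Qed.

End Cell.
End RiemannSums.

(** * Limit of the weighted sums *)

Section RiemannSumsLimit.
Context {R : realType} (alpha : @tensor_norm_family R).
Hypothesis alpha_uniform : uniform_crossnorm alpha.
Context {E : completeNormedModType R} (C : tensor_completion alpha E E).
Context {V W : normedModType R}.
Variables (X : R -> E) (Z : R -> V) (k : R -> 'L(C, W)).
Hypothesis XZ : forall u v, `|X u - X v| <= `|Z u - Z v|.
Variables (pi : nat -> nat -> R) (N : nat -> nat) (t Mk B : R).
Hypothesis ppi : forall n, is_partition (pi n).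
Hypothesis fpi : forall d, 0 < d -> \forall n \near \oo, fine_at Z t d (pi n).
Hypothesis ck : cadlag k.
Hypothesis kuc : forall e, 0 < e -> exists2 d, 0 < d & forall x y,
  0 <= x <= t -> 0 <= y <= t -> `|Z x - Z y| <= d -> `|k x - k y| <= e.
Hypothesis kb : forall x, 0 <= x <= t -> `|k x| <= Mk.
Hypothesis XB : forall x y, 0 <= x <= t -> 0 <= y <= t -> `|X x - X y| <= B.

Let wsum n := weighted_tsum X k (pi n) (N n).
Let Qsum n := tsum C X (pi n) (N n).
Let Vsum n := sqsum X (pi n) (N n).

Lemma weighted_tsum_cell_near (u v e e1 : R) (T : 'L(C, W)) :
  0 <= u -> u < v -> v <= t -> 0 <= e -> (forall x, u <= x < v -> `|k x - T| <= e) ->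
  0 < e1 -> \forall n \near \oo,
  `|wsum n v - wsum n u - T (Qsum n v - Qsum n u)| <= e * (Vsum n v - Vsum n u) + e1.
Proof.
move=> u0 uv vt e0 kT e10.
have u0t : 0 <= u <= t by rewrite u0 (le_trans (ltW uv)).
have B0 : 0 <= B by rewrite (le_trans _ (XB u0t u0t)).
pose M := Mk + `|T|.
have kM x : 0 <= x <= t -> `|k x - T| <= M.
  by move=> xt; rewrite (le_trans (ler_normB _ _))// lerD2r kb.
have M0 : 0 <= M by rewrite (le_trans _ (kM u u0t)).
pose e' := e1 / 2 / (B ^+ 2 + 1).
have B1 : 0 < B ^+ 2 + 1 by rewrite ltr_wpDl// sqr_ge0.
have e'0 : 0 < e' by rewrite !divr_gt0.
have [d1 d10 kd1] := kuc e'0.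
(* Since [d] is at most 1, [(M + e) * (d ^+ 2 + 2 * d * B)] is at most [c * d], which [d2] brings
   below [e1 / 2]; [e'] does the same for [e' * B ^+ 2]. *)
pose c := (M + e) * (1 + 2 * B).
have c0 : 0 <= c by rewrite mulr_ge0// addr_ge0// mulr_ge0.
have c1 : 0 < c + 1 by rewrite ltr_wpDl.
pose d2 := e1 / 2 / (c + 1).
have d20 : 0 < d2 by rewrite !divr_gt0.
pose d := Num.min d1 (Num.min 1 d2).
have d0 : 0 < d by rewrite !lt_min d10 d20 ltr01.
have dd1 : d <= d1 by rewrite ge_min lexx.
have dle1 : d <= 1 by rewrite !ge_min lexx orbT.
have dd2 : d <= d2 by rewrite !ge_min lexx !orbT.
have kd x y : 0 <= x <= t -> 0 <= y <= t -> `|Z x - Z y| <= d -> `|k x - k y| <= e'.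
  by move=> xt yt xy; apply: kd1 => //; exact: le_trans dd1.
have := fpi d0; apply: filterS => n fn.
have := weighted_tsum_cell alpha_uniform XZ (ppi n) fn u0 uv vt (ltW d0) e0 (ltW e'0)
  kT kd kM XB (N n).
move/le_trans; apply; rewrite lerD2l (splitr e1) lerD//.
  by rewrite /e' mulrAC ler_pdivrMr// ler_wpM2l ?lerDl// divr_ge0// ltW.
apply: (@le_trans _ _ (c * d)).
  have Me0 : 0 <= M + e by rewrite addr_ge0.
  have -> : c * d = (M + e) * (d + 2 * d * B) by rewrite /c; ring.
  apply: ler_wpM2l => //; rewrite lerD2r expr2 ler_piMl// ltW//.
apply: (@le_trans _ _ (c * d2)); first by rewrite ler_wpM2l.
by rewrite /d2 mulrC mulrAC ler_pdivrMr// ler_wpM2l ?lerDl// divr_ge0// ltW.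
Qed.

Lemma increment0 p i : is_partition p -> increment X 0 p i = 0.
Proof. by move=> pp; rewrite increment_ge// partition_ge0. Qed.

(** The step function [h] is fixed before [n] and [e1]. The main errors telescope in time to
    [e * Vsum n t], although [Vsum n] need not be monotone; the errors [e1] are arbitrary and are
    halved at each gluing. *)
Lemma weighted_tsum_approx (e : R) : 0 <= t -> 0 < e ->
  exists h : op_step C W, [/\ step_on 0 t h,
    forall s, 0 < s <= t -> `|left_lim k s - op_step_fun h s| <= e &
    forall e1, 0 < e1 -> \forall n \near \oo,
      `|wsum n t - op_step_integral (Qsum n) h| <= e * Vsum n t + e1].
Proof.
have w0 n : wsum n 0 = 0.
  rewrite /wsum /weighted_tsum big1// => i _; rewrite increment0// /tsq tprod0l.
  exact: linear0.
have V0 n : Vsum n 0 = 0.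
  by rewrite /Vsum /sqsum big1// => i _; rewrite increment0// normr0 expr0n.
move=> + e0; rewrite le_eqVlt => /orP[/eqP <-|t0].
  exists [::]; split => //.
    by move=> s /andP[s0 /(lt_le_trans s0)]; rewrite ltxx.
  move=> e1 e10; near=> n.
  by rewrite w0 V0 /op_step_integral big_nil subrr normr0 mulr0 add0r ltW.
pose P (u v : R) : Prop := exists h : op_step C W, [/\ step_on u v h,
    forall s, u < s <= v -> `|left_lim k s - op_step_fun h s| <= e &
    forall e1, 0 < e1 -> \forall n \near \oo,
      `|wsum n v - wsum n u - op_step_integral (Qsum n) h| <= e * (Vsum n v - Vsum n u) + e1].
suff [h [h1 h2 h3]] : P 0 t.
  exists h; split => // e1 /h3; apply: filterS => n.
  by rewrite w0 V0 !subr0.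
have single u v T : 0 <= u -> u < v -> v <= t ->
    (forall x, u <= x < v -> `|k x - T| <= e) -> P u v.
  move=> u0 uv vt H; exists [:: ((u, v), T)]; split.
  - exact/step_on_single/ltW.
  - move=> x /andP[ux xv]; rewrite op_step_fun_single ?ux//.
    apply: (left_lim_norm_le ck _ ux); first exact: le_lt_trans ux.
    by move=> y /andP[uy yx]; apply: H; rewrite uy (lt_le_trans yx).
  - move=> e1 e10; rewrite /op_step_integral; under eq_near do rewrite big_seq1.
    exact: weighted_tsum_cell_near (ltW e0) H e10.
apply: cousin => //.
- move=> s /andP[s0 st]; near=> v => vt.
  have sv : s < v by near: v; exact: nbhs_right_gt.
  have H : forall x, s <= x <= v -> `|k x - k s| <= e by near: v; exact: cadlag_near_right.
  by apply: (single _ _ (k s)) => // x /andP[sx xv]; apply: H; rewrite sx ltW.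
- move=> s /andP[s0 st]; near=> u => u0.
  have us : u < s by near: u; exact: nbhs_left_lt.
  apply: (single _ _ (left_lim k s)) => //.
  by near: u; exact: cadlag_near_left.
- move=> u v w u0 uv vw wt [h1 [on1 H1 K1]] [h2 [on2 H2 K2]].
  have [on12 H12] := step_approx_cat (ltW uv) (ltW vw) on1 on2 H1 H2.
  exists (h1 ++ h2); split => // e1 e10.
  have e12 : 0 < e1 / 2 by rewrite divr_gt0.
  apply: filterS2 (K1 _ e12) (K2 _ e12) => n A1 A2; rewrite op_step_integral_cat.
  have -> : wsum n w - wsum n u - (op_step_integral (Qsum n) h1 + op_step_integral (Qsum n) h2)
      = (wsum n v - wsum n u - op_step_integral (Qsum n) h1) +
        (wsum n w - wsum n v - op_step_integral (Qsum n) h2).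
    by rewrite addrACA -opprD (addrC (wsum n v - _)) subrKA.
  rewrite (le_trans (ler_normD _ _))//; move: A1 A2.
  set x1 := `|_|; set x2 := `|_|; rewrite !mulrBr; lra.
Unshelve. all: by end_near. Qed.

End RiemannSumsLimit.

(** * Sums over jumps *)

Lemma cvg_sum_seq (R : numFieldType) (W : normedModType R) (T I : Type) (F : set_system T)
    (r : seq I) (P : pred I) (f : I -> T -> W) (l : I -> W) : Filter F ->
  (forall i, P i -> f i @ F --> l i) ->
  \sum_(i <- r | P i) f i @ F --> \sum_(i <- r | P i) l i.
Proof.
move=> FF H; elim: r => [|i r IH]; first by rewrite !big_nil; exact: cvg_cst.
by rewrite !big_cons; case: ifPn => // Pi; apply: cvgD => //; exact: H.
Qed.

Section JumpSums.
Context {R : realType} {V : normedModType R}.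
Variables (Z : R -> V) (K : set V) (pi : nat -> nat -> R) (N : nat -> nat) (t : R).
Hypothesis cZ : cadlag Z.
Hypothesis ppi : forall n, is_partition (pi n).
Hypothesis piN : forall n, t <= pi n (N n).
Hypothesis fpi : forall d, 0 < d -> \forall n \near \oo, fine_at Z t d (pi n).
Hypothesis KZ : forall s, 0 <= s <= t -> K (Z s).
Hypothesis Kl : forall s, 0 < s <= t -> K (left_lim Z s).

Definition cell_value (T : Type) (f : V -> V -> T) n i : T :=
  f (Z (Num.min (pi n i) t)) (Z (Num.min (pi n i.+1) t)).

Definition jump_value (T : Type) (f : V -> V -> T) s : T := f (left_lim Z s) (Z s).

Definition jump_time (s : R) := (0 < s <= t) && (left_lim Z s != Z s).

Let idx n s := partition_index (pi n) s.

Lemma sum_ord_seq (W : zmodType) (F : nat -> W) (r : seq nat) (M : nat) :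
  uniq r -> {in r, forall i, (i < M)%N} ->
  \sum_(i < M) F i = \sum_(i <- r) F i + \sum_(i < M | (i : nat) \notin r) F i.
Proof.
move=> ur rM; rewrite (bigID (fun i : 'I_M => (i : nat) \in r)) /=; congr (_ + _).
rewrite -(big_mkord (fun i => i \in r) F) -big_filter; apply: perm_big.
apply: uniq_perm => //; first by rewrite filter_uniq// iota_uniq.
move=> i; rewrite mem_filter mem_index_iota /=.
by apply/andP/idP => [[]//|ir]; rewrite ir rM.
Qed.

Lemma indexP n s : 0 < s <= t -> pi n (idx n s) < s <= pi n (idx n s).+1.
Proof. by move=> /andP[s0 _]; exact: partition_indexP. Qed.

Lemma index_lt n s : 0 < s <= t -> (idx n s < N n)%N.
Proof.
move=> st; have /andP[is_ _] := indexP n st; case/andP : st => _ st.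
rewrite ltnNge; apply/negP => /(partition_le (ppi n)) H.
by have := lt_le_trans is_ (le_trans st (le_trans (piN n) H)); rewrite ltxx.
Qed.

Lemma jump_gt0 s : jump_time s -> 0 < `|left_lim Z s - Z s|.
Proof. by move=> /andP[_]; rewrite normr_gt0 subr_eq0. Qed.

(** Finitely many jumps have sizes above a common [e] > 0, and a cell of a partition that is fine at
    [e] contains at most one of them. *)
Lemma index_uniq_near (J : seq R) : uniq J -> all jump_time J ->
  \forall n \near \oo, uniq [seq idx n s | s <- J].
Proof.
move=> uJ /allP jJ.
have [e [e0 He]] : exists e : R, 0 < e /\ forall s, s \in J -> e < `|left_lim Z s - Z s|.
  have : \forall e \near (0 : R)^'+, forall s, s \in J -> jump_time s ->
      e < `|left_lim Z s - Z s|.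
    apply: near_all_seq => s; have [/jump_gt0 js|_] := boolP (jump_time s); last by near=> e.
    by near=> e => _; near: e; exact: nbhs_right_lt.
  move=> H; near (0 : R)^'+ => e; exists e; split; first by near: e; exact: nbhs_right_gt.
  have H' : forall s, s \in J -> jump_time s -> e < `|left_lim Z s - Z s| by near: e.
  by move=> s sJ; apply: H' => //; exact: jJ.
apply: filterS (fpi e0) => n fn; rewrite map_inj_in_uniq// => s s' sJ s'J ss'.
have /andP[st _] := jJ _ sJ; have /andP[st' _] := jJ _ s'J.
have Hs := indexP n st; have Hs' := indexP n st'; rewrite -ss' in Hs'.
have it : pi n (idx n s) < t.
  by move: Hs st => /andP[+ _] /andP[_]; exact: lt_le_trans.
have [c [/andP[ic _] H1 H2]] := fn _ it.
have cE u : pi n (idx n s) < u <= pi n (idx n s).+1 -> 0 < u <= t -> u \in J -> c = u.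
  move=> Hu /andP[_ ut] uJ'.
  exact: (fine_cut_jump cZ (ppi n) H1 H2 ic Hu ut (He _ uJ')).
by rewrite -(cE s)// -(cE s').
Unshelve. all: by end_near. Qed.

Definition uniform_on (W : normedModType R) (f : V -> V -> W) :=
  forall e : R, 0 < e -> exists2 d : R, 0 < d & forall x x' y y', K x -> K x' -> K y -> K y' ->
    `|x - y| <= d -> `|x' - y'| <= d -> `|f x x' - f y y'| <= e.

Lemma cell_value_cvg (W : normedModType R) (f : V -> V -> W) s :
  uniform_on f -> jump_time s ->
  cell_value f n (idx n s) @[n --> \oo] --> jump_value f s.
Proof.
move=> fu js; apply/cvgrPdist_le => e e0.
have [d d0 Hd] := fu e e0; have jp := jump_gt0 js; case/andP : js => st _.
(* Half the jump size makes [fine_jump] applicable: the end values of the cell are then close to the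
   left limit and to the value at [s]. *)
pose d' := Num.min d (`|left_lim Z s - Z s| / 2).
have d'0 : 0 < d' by rewrite lt_min d0 divr_gt0.
apply: filterS (fpi d'0) => n fn.
have Hs := indexP n st; have /andP[is_ si] := Hs; have /andP[s0 sT] := st.
have d'J : d' < `|left_lim Z s - Z s|.
  by rewrite gt_min ltr_pdivrMr// ltr_pMr// ltr1n orbT.
have [H1 H2] := fine_jump cZ (ppi n) fn Hs sT d'J.
have it := ltW (lt_le_trans is_ sT).
rewrite /jump_value /cell_value (min_l it); have i0 := partition_ge0 (idx n s) (ppi n).
apply: Hd.
- exact: Kl.
- by apply: KZ; rewrite (ltW s0).
- by apply: KZ; rewrite i0.
- apply: KZ; rewrite le_min ge_min lexx orbT andbT.
  by rewrite (le_trans (ltW s0))//= (le_trans (ltW s0)).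
- by rewrite (le_trans H1)// ge_min lexx.
- by rewrite distrC (le_trans H2)// ge_min lexx.
Qed.

Section Domination.
Variables (b : V -> V -> R) (Bd : R).
Hypothesis b0 : forall z z', 0 <= b z z'.
Hypothesis bzz : forall z, b z z = 0.
Hypothesis bB : forall n, \sum_(i < N n) cell_value b n i <= Bd.
Hypothesis bu : uniform_on (b : V -> V -> R^o).

(** A Fatou argument: the times of [J] eventually lie in distinct cells, the values of [b] are
    nonnegative, so the sum over these cells is at most [Bd], and the bound survives in the
    limit. *)
Lemma sum_jump_le (J : seq R) : uniq J -> all jump_time J ->
  \sum_(s <- J) jump_value b s <= Bd.
Proof.
move=> uJ /[dup] jJ /allP jJ'.
have H : \sum_(s <- J) cell_value b n (idx n s) @[n --> \oo] --> \sum_(s <- J) jump_value b s.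
  rewrite (_ : (fun n => _) = \sum_(s <- J) (fun n => cell_value b n (idx n s))).
    rewrite big_seq [X in _ --> X]big_seq; apply: cvg_sum_seq => s sJ.
    by apply: (cell_value_cvg bu); exact: jJ'.
  by apply/funext => n; rewrite fct_sumE.
apply: (@ler_cvg_to nat \oo _ R _ (cst Bd) _ _ H); first exact: cvg_cst.
have := index_uniq_near uJ jJ; apply: filterS => n un.
apply: le_trans (bB n); rewrite (sum_ord_seq _ un).
  by rewrite big_map lerDl sumr_ge0// => i _; exact: b0.
by move=> _ /mapP[s /jJ' /andP[st _] ->]; exact: index_lt.
Qed.

Lemma jump_value_id s : 0 < s <= t -> ~~ jump_time s -> jump_value b s = 0.
Proof.
by move=> st; rewrite /jump_time st /= negbK => /eqP e; rewrite /jump_value e bzz.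
Qed.

Lemma norm_upto_jump s :
  `|upto (jump_value b : R -> R^o) t s| = if jump_time s then jump_value b s else 0.
Proof.
rewrite /upto; case: ifPn => [st|]; last first.
  by rewrite /jump_time => /negbTE ->; rewrite normr0.
case: ifPn => [_|/(jump_value_id st) ->]; last by rewrite normr0.
by rewrite ger0_norm// b0.
Qed.

Lemma sum_upto_jump_le (J : {fset R}) :
  \sum_(s <- J) `|upto (jump_value b : R -> R^o) t s| <= Bd.
Proof.
under eq_bigr do rewrite norm_upto_jump.
rewrite -big_mkcond -big_filter /=; apply: sum_jump_le; last exact: filter_all.
by rewrite filter_uniq// fset_uniq.
Qed.

Lemma absolutely_summable_jump : absolutely_summable (upto (jump_value b : R -> R^o) t).
Proof. by exists Bd; exact: sum_upto_jump_le. Qed.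

Lemma absolutely_summable_upto_le (W : normedModType R) (g : R -> W) (c : R) :
  0 <= c -> (forall s, 0 < s <= t -> `|g s| <= c * jump_value b s) ->
  absolutely_summable (upto g t).
Proof.
move=> c0 gb; exists (c * Bd) => J; apply: le_trans (ler_wpM2l c0 (sum_upto_jump_le J)).
rewrite mulr_sumr; apply: ler_sum => s _; rewrite /upto; case: ifPn => [st|_].
  by rewrite (le_trans (gb s st))// ler_wpM2l// ler_norm.
by rewrite !normr0 mulr0.
Qed.

Variables (W : completeNormedModType R) (Phi : V -> V -> W) (c : R).
Hypothesis b_sep : forall e : R, 0 < e -> exists2 d : R, 0 < d &
  forall z z', b z z' <= d -> `|z - z'| <= e.
Hypothesis Phiu : uniform_on Phi.
Hypothesis c0 : 0 <= c.
Hypothesis Phi_le : forall z z', K z -> K z' -> `|Phi z z'| <= c * b z z'.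
Hypothesis Phi_small : forall e : R, 0 < e -> exists2 d : R, 0 < d & forall z z',
  K z -> K z' -> `|z - z'| <= d -> `|Phi z z'| <= e * b z z'.

(** Cells that contain one of finitely many main jumps converge one by one. In the other cells the
    path moves by at most [d], so [Phi] is a small multiple of [b], whose sums are bounded by [Bd].
    The jumps left out carry little of the limit. *)
Lemma sum_cell_value_cvg : 0 <= t ->
  \sum_(i < N n) cell_value Phi n i @[n --> \oo] --> sum_upto (jump_value Phi) t.
Proof.
move=> t0; apply/cvgrPdist_le => e e0.
have Phi_jump s : 0 < s <= t -> `|jump_value Phi s| <= c * jump_value b s.
  by move=> st; apply: Phi_le; [exact: Kl|apply: KZ; case/andP : st => /ltW -> ->].
have gs : absolutely_summable (upto (jump_value Phi) t).
  exact: absolutely_summable_upto_le c0 Phi_jump.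
have Bd0 : 0 <= Bd by apply: le_trans (bB 0%N); apply: sumr_ge0 => i _; exact: b0.
have e3 : 0 < e / 3 by rewrite divr_gt0.
have Bd1 : 0 < Bd + 1 by rewrite ltr_wpDl.
have c1 : 0 < c + 1 by rewrite ltr_wpDl.
have [d d0 Hd] := Phi_small (divr_gt0 e3 Bd1).
have d3 : 0 < d / 3 by rewrite divr_gt0.
have [d' d'0 Hd'] := b_sep d3.
(* The bound [d'] forces each jump outside [J0] below [d / 3]; the other bound makes these jumps
   contribute at most [e / 3] to the sum of [Phi]. *)
pose m := Num.min d' (e / 3 / (c + 1)).
have m0 : 0 < m by rewrite lt_min d'0 divr_gt0.
have [J0 HJ0] := absolutely_summable_tail absolutely_summable_jump m0.
pose J := [seq s <- enum_fset J0 | jump_time s].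
have uJ : uniq J by rewrite filter_uniq// fset_uniq.
have aJ : all jump_time J by exact: filter_all.
have sumJ : `|sum_upto (jump_value Phi) t - \sum_(s <- J) jump_value Phi s| <= e / 3.
  have -> : \sum_(s <- J) jump_value Phi s = \sum_(s <- J0) upto (jump_value Phi) t s.
    rewrite big_filter big_mkcond; apply: eq_bigr => s _; rewrite /upto.
    case: ifPn => [/andP[-> //]|njs]; case: ifPn => // st; apply/esym/eqP.
    by rewrite -normr_le0 (le_trans (Phi_jump s st))// (jump_value_id st njs) mulr0.
  apply: sum_tail => // J1.
  apply: (@le_trans _ _ (c * m)).
    apply: le_trans (ler_wpM2l c0 (HJ0 J1)); rewrite mulr_sumr.
    apply: ler_sum => s _; rewrite /upto; case: ifPn => [st|_].
      by rewrite (le_trans (Phi_jump s st))// ler_wpM2l// ler_norm.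
    by rewrite !normr0 mulr0.
  apply: (@le_trans _ _ (c * (e / 3 / (c + 1)))).
    by rewrite ler_wpM2l// ge_min lexx orbT.
  by rewrite mulrC mulrAC ler_pdivrMr// ler_wpM2l ?lerDl// ltW.
have near1 : \forall n \near \oo,
    `|\sum_(s <- J) jump_value Phi s - \sum_(s <- J) cell_value Phi n (idx n s)| <= e / 3.
  have : \sum_(s <- J) cell_value Phi n (idx n s) @[n --> \oo] -->
      \sum_(s <- J) jump_value Phi s.
    rewrite (_ : (fun n => _) = \sum_(s <- J) (fun n => cell_value Phi n (idx n s))).
      rewrite big_seq [X in _ --> X]big_seq; apply: cvg_sum_seq => s sJ.
      by apply: (cell_value_cvg Phiu); exact: (allP aJ).
    by apply/funext => n; rewrite fct_sumE.
  by move/cvgrPdist_le; exact.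
have near2 : \forall n \near \oo,
    `|\sum_(i < N n | (i : nat) \notin [seq idx n s | s <- J]) cell_value Phi n i| <= e / 3.
  apply: filterS (fpi d3) => n fn.
  apply: (@le_trans _ _ (\sum_(i < N n) e / 3 / (Bd + 1) * cell_value b n i)).
    rewrite (le_trans (ler_norm_sum _ _ _))// big_mkcond /=.
    apply: ler_sum => i _; case: ifPn => [iJ|_]; last first.
      by rewrite mulr_ge0 ?b0// ltW// divr_gt0.
    have i0 := partition_ge0 i (ppi n).
    have ii := partition_le (ppi n) (leqnSn i).
    have i'0 := partition_ge0 i.+1 (ppi n).
    apply: Hd.
    - by apply: KZ; rewrite le_min i0 t0 ge_min lexx orbT.
    - by apply: KZ; rewrite le_min i'0 t0 ge_min lexx orbT.
    have [ti|it] := leP t (pi n i).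
      by rewrite !min_r ?(le_trans ti)// subrr normr0 ltW.
    have [u [/andP[iu ui] H1 H2]] := fn i it.
    (* The three parts are the movement before the cut, the jump at the cut and the movement after
       it. If the cut lies beyond [t], the truncated cell stays in the left piece. *)
    have d33 : d = d / 3 + (d / 3 + d / 3) by lra.
    have [ut|tu] := leP u t; last first.
      rewrite min_r; last by rewrite ltW// (lt_le_trans tu).
      rewrite (@le_trans _ _ (d / 3))//; last by move: d33 (ltW d3); lra.
      by apply: H1; rewrite ?(ltW it) ?lexx.
    have u_gt0 : 0 < u by rewrite (le_lt_trans i0).
    have u0t : 0 < u <= t by rewrite u_gt0.
    have ju : `|left_lim Z u - Z u| <= d / 3.
      have [jtu|] := boolP (jump_time u); last first.
        rewrite /jump_time u0t/= negbK => /eqP ->.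
        by rewrite subrr normr0 ltW.
      apply: Hd'.
      (* A jump time [u] in [J0] would belong to [J], and by uniqueness of the index its cell would
         be [i], which is excluded. *)
      have uJ0 : u \notin J0.
        apply: contra iJ => uJ0; apply/mapP; exists u; first by rewrite mem_filter jtu.
        by apply: (partition_index_uniq (ppi n)) (indexP n u0t); rewrite iu.
      have := HJ0 [fset u]%fset; rewrite big_mkcond big_seq_fset1 uJ0 norm_upto_jump jtu.
      by move/le_trans; apply; rewrite ge_min lexx.
    rewrite d33 -(subrKA (left_lim Z u)) (le_trans (ler_normD _ _))//.
    apply: lerD.
      rewrite distrC; apply: (left_lim_norm_le cZ u_gt0 iu) => x /andP[ix xu].
      by apply: H1; rewrite ?ix ?lexx// ?(ltW it)// (le_trans (ltW xu)).
    rewrite -(subrKA (Z u)) (le_trans (ler_normD _ _))// lerD//.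
    by apply: H2; rewrite ?lexx ?le_min ?ge_min ?ui ?ut ?lexx ?orbT.
  rewrite -mulr_sumr (le_trans (ler_wpM2l _ (bB n)))//; first by rewrite ltW// divr_gt0.
  by rewrite mulrAC ler_pdivrMr// ler_wpM2l ?lerDl// ltW.
near=> n.
have un : uniq [seq idx n s | s <- J] by near: n; exact: index_uniq_near.
have n1 : `|\sum_(s <- J) jump_value Phi s - \sum_(s <- J) cell_value Phi n (idx n s)| <= e / 3.
  by near: n.
have n2 : `|\sum_(i < N n | (i : nat) \notin [seq idx n s | s <- J]) cell_value Phi n i| <= e / 3.
  by near: n.
rewrite (sum_ord_seq _ un); last first.
  by move=> _ /mapP[s /(allP aJ) /andP[st _] ->]; exact: index_lt.
rewrite big_map opprD addrA; set S1 := \sum_(s <- J) _ in n1 *.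
set S2 := \sum_(i < N n | _) _ in n2 *.
rewrite (le_trans (ler_normB _ _))//.
rewrite -(subrKA (\sum_(s <- J) jump_value Phi s)).
have := ler_normD (sum_upto (jump_value Phi) t - \sum_(s <- J) jump_value Phi s)
  (\sum_(s <- J) jump_value Phi s - \sum_(s <- J) cell_value Phi n (idx n s)).
move: sumJ n1 n2; lra.
Unshelve. all: by end_near. Qed.

End Domination.
End JumpSums.

(** * Estimates on compact sets *)

Lemma cvg_fst_comp (T : Type) (U V : topologicalType) (F : set_system T) (f : T -> U * V)
  (l : U * V) : Filter F -> f @ F --> l -> (f x).1 @[x --> F] --> l.1.
Proof. by move=> FF fl; apply: (cvg_comp _ _ fl); exact: cvg_fst. Qed.

Lemma cvg_snd_comp (T : Type) (U V : topologicalType) (F : set_system T) (f : T -> U * V)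
  (l : U * V) : Filter F -> f @ F --> l -> (f x).2 @[x --> F] --> l.2.
Proof. by move=> FF fl; apply: (cvg_comp _ _ fl); exact: cvg_snd. Qed.

Section CompactEstimates.
Context {R : realType} {E F G : completeNormedModType R}.
Variables (f : F * E -> G) (D : F * E -> 'L(E, G)).
Hypothesis f_lip : lipschitz_on_compacts f.
Hypothesis fD : forall a x, gateaux_derivative (fun y => f (a, y)) x (D (a, x)).
Hypothesis cD : continuous_on_compacts D.
Variable K : set (F * E).
Hypothesis cK : compact K.

Lemma norm_fst_le (z : F * E) : `|z.1| <= `|z|.
Proof. by rewrite prod_normE le_max lexx. Qed.

Lemma norm_snd_le (z : F * E) : `|z.2| <= `|z|.
Proof. by rewrite prod_normE le_max lexx orbT. Qed.

Lemma norm_pair_le (z : F * E) : `|z| <= `|z.1| + `|z.2|.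
Proof. by rewrite prod_normE ge_max lerDl lerDr !normr_ge0. Qed.

(* [K] enlarged by the points (a, x + c (x' - x)) met when one moves the two
   coordinates separately and along segments. *)
Definition segment_hull : set (F * E) :=
  (fun q : (F * E) * (F * E) * (F * E) * R =>
    (q.1.1.1.1, q.1.1.2.2 + q.2 *: (q.1.2.2 - q.1.1.2.2))) @`
  (K `*` K `*` K `*` `[0, 1]%classic).

Lemma segment_hull_compact : compact segment_hull.
Proof.
apply: continuous_compact; last first.
  by repeat apply: compact_setX => //; exact: segment_compact.
apply: continuous_subspaceT => q.
have c1 : q.1.1.1.1 @[q --> q] --> q.1.1.1.1 by do 4![apply: cvg_fst_comp]; exact: cvg_id.
have c2 : q.1.1.2.2 @[q --> q] --> q.1.1.2.2.
  by do 2![apply: cvg_snd_comp]; do 2![apply: cvg_fst_comp]; exact: cvg_id.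
have c3 : q.1.2.2 @[q --> q] --> q.1.2.2.
  by do 2![apply: cvg_snd_comp]; apply: cvg_fst_comp; exact: cvg_id.
apply: cvg_pair; first exact: c1.
apply: cvgD; first exact: c2.
apply: cvgZ; first by apply: cvg_snd_comp; exact: cvg_id.
by apply: cvgB; [exact: c3|exact: c2].
Qed.

Lemma segment_hullP a x x' (c : R) : K a -> K x -> K x' -> 0 <= c <= 1 ->
  segment_hull (a.1, x.2 + c *: (x'.2 - x.2)).
Proof.
by move=> Ka Kx Kx' c01; exists (a, x, x', c).
Qed.

Lemma segment_hull_pair a x : K a -> K x -> segment_hull (a.1, x.2).
Proof.
move=> Ka Kx; have := @segment_hullP a x x 0 Ka Kx Kx.
by rewrite scale0r addr0 lexx ler01; exact.
Qed.

Lemma sub_segment_hull z : K z -> segment_hull z.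
Proof. by move=> Kz; have := segment_hull_pair Kz Kz; case: z {Kz}. Qed.

Lemma lipschitz_hull : exists2 L : R, 0 <= L &
  forall z z', segment_hull z -> segment_hull z' -> `|f z - f z'| <= L * `|z - z'|.
Proof.
have /pinfty_ex_gt0[L L0 HL] := f_lip segment_hull_compact.
exists L; first exact: ltW.
by move=> z z' Kz Kz'; apply: (HL (z, z')).
Qed.

Lemma derivative_bounded : exists2 M : R, 0 <= M & forall z, segment_hull z -> `|D z| <= M.
Proof.
have /pinfty_ex_gt0[M M0 HM] := compact_bounded
  (continuous_compact (cD segment_hull_compact) segment_hull_compact).
exists M; first exact: ltW.
by move=> z Kz; apply: HM; exists z.
Qed.

Lemma derivative_uniform (e : R) : 0 < e -> exists2 d : R, 0 < d &
  forall z z', segment_hull z -> segment_hull z' -> `|z - z'| <= d -> `|D z - D z'| <= e.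
Proof. exact: compact_uniform_continuity segment_hull_compact (cD segment_hull_compact). Qed.

(** The mean value inequality runs along the segment from [z] to [(z.1, z'.2)], which may leave [K];
    uniform continuity of [D] on the hull makes [d] independent of [z]. *)
Lemma taylor_hull (e : R) : 0 < e -> exists2 d : R, 0 < d &
  forall z z', K z -> K z' -> `|z'.2 - z.2| <= d ->
    `|f (z.1, z'.2) - f z - D z (z'.2 - z.2)| <= e * `|z'.2 - z.2|.
Proof.
move=> e0; have [d d0 Hd] := derivative_uniform e0; exists d => // -[a x] z' Kz Kz' /= xz'.
have := @gateaux_mean_value R E G (fun y => f (a, y)) (fun y => D (a, y)) x (z'.2 - x)
  (D (a, x) (z'.2 - x)) (e * `|z'.2 - x|) (fD a).
rewrite subrKC; apply => c c01.
rewrite -bop_subE (le_trans (opnorm_apply _ _))// ler_wpM2r//; apply: Hd.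
- exact: (@segment_hullP (a, x) (a, x) z').
- exact: sub_segment_hull.
have -> : ((a, x + c *: (z'.2 - x)) - (a, x) : F * E) = (0, c *: (z'.2 - x)).
  by congr pair; [rewrite /= subrr|rewrite /= addrAC subrr add0r].
rewrite prod_normE /= normr0 max_r// normrZ.
case/andP: c01 => c0 c1; rewrite ger0_norm// (le_trans _ xz')//.
by rewrite ler_piMl.
Qed.

Lemma diameter_bounded : exists2 B : R, 0 <= B & forall z z', K z -> K z' -> `|z - z'| <= B.
Proof.
have /pinfty_ex_gt0[M M0 HM] := compact_bounded cK.
exists (M + M); first by rewrite addr_ge0// ltW.
by move=> z z' Kz Kz'; rewrite (le_trans (ler_normB _ _))// lerD// HM.
Qed.

End CompactEstimates.

(** * Remainder of the squared increments *)

Section SquareRemainder.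
Context {R : realType} (alpha : @tensor_norm_family R).
Hypothesis alpha_uniform : uniform_crossnorm alpha.
Context {E F G : completeNormedModType R} (GG : tensor_completion alpha G G).
Variables (f : F * E -> G) (D : F * E -> 'L(E, G)).
Hypothesis f_lip : lipschitz_on_compacts f.
Hypothesis fD : forall a x, gateaux_derivative (fun y => f (a, y)) x (D (a, x)).
Hypothesis cD : continuous_on_compacts D.
Variable K : set (F * E).
Hypothesis cK : compact K.

Definition sq_gauge (z z' : F * E) : R := `|z'.2 - z.2| ^+ 2 + `|z'.1 - z.1|.

Definition sq_remainder (z z' : F * E) : GG :=
  tsq GG (f z' - f z) - tsq GG (D z (z'.2 - z.2)).

Lemma sq_gauge_ge0 z z' : 0 <= sq_gauge z z'.
Proof. by rewrite addr_ge0// sqr_ge0. Qed.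

Lemma sq_gauge_id z : sq_gauge z z = 0.
Proof. by rewrite /sq_gauge !subrr !normr0 expr0n addr0. Qed.

Lemma sq_gauge_sep (e : R) : 0 < e -> exists2 d : R, 0 < d &
  forall z z', sq_gauge z z' <= d -> `|z - z'| <= e.
Proof.
move=> e0; have e2 : 0 < e / 2 by rewrite divr_gt0.
exists (Num.min (e / 2) ((e / 2) ^+ 2)); first by rewrite lt_min e2 exprn_gt0.
move=> z z'; rewrite le_min /sq_gauge => /andP[H1 H2].
have s0 := sqr_ge0 `|z'.2 - z.2|.
have n0 := normr_ge0 (z'.1 - z.1).
rewrite distrC (le_trans (norm_pair_le _))// (splitr e) lerD//.
  by move: H1 s0; rewrite /=; lra.
rewrite -(@ler_pXn2r _ 2)// ?nnegrE ?normr_ge0 ?(ltW e2)//.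
by move: H2 n0; rewrite /=; lra.
Qed.

Lemma sq_increment_le : exists2 c : R, 0 <= c & forall z z', K z -> K z' ->
  `|f z' - f z| ^+ 2 <= c * sq_gauge z z' /\
  `|D z (z'.2 - z.2)| ^+ 2 <= c * sq_gauge z z'.
Proof.
have [L L0 HL] := lipschitz_hull f_lip cK.
have [M M0 HM] := derivative_bounded cD cK.
have [B B0 HB] := diameter_bounded cK.
(* With a and x the two increments, (a + x)^2 <= 2 (a^2 + x^2) and a^2 <= B a bound the increment of
   [f]; the term [M ^+ 2] bounds the linear part. *)
pose c := 2 * L ^+ 2 * (B + 1) + M ^+ 2.
have L2 : 0 <= L ^+ 2 by exact: sqr_ge0.
have M2 : 0 <= M ^+ 2 by exact: sqr_ge0.
have c0 : 0 <= c by rewrite addr_ge0 ?sqr_ge0// !mulr_ge0 ?addr_ge0.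
exists c => // z z' Kz Kz'.
set x := `|z'.2 - z.2|; set a := `|z'.1 - z.1|.
have x0 : 0 <= x by exact: normr_ge0.
have a0 : 0 <= a by exact: normr_ge0.
have aB : a <= B by rewrite (le_trans _ (HB z' z Kz' Kz))// (norm_fst_le (z' - z)).
have x2 : 0 <= x ^+ 2 by exact: sqr_ge0.
rewrite /sq_gauge -/x -/a; split.
  have H : `|f z' - f z| <= L * (a + x).
    rewrite (le_trans (HL _ _ (sub_segment_hull Kz') (sub_segment_hull Kz)))//.
    by rewrite ler_wpM2l// (norm_pair_le (z' - z)).
  apply: (@le_trans _ _ ((L * (a + x)) ^+ 2)).
    by rewrite lerXn2r ?nnegrE ?mulr_ge0 ?addr_ge0.
  have H1 : (a + x) ^+ 2 <= 2 * (B * a + x ^+ 2).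
    have H2 : a ^+ 2 <= B * a by rewrite expr2 ler_wpM2r.
    have := sqr_ge0 (a - x); rewrite sqrrB sqrrD; lra.
  apply: (@le_trans _ _ (L ^+ 2 * (2 * (B * a + x ^+ 2)))).
    by rewrite exprMn ler_wpM2l.
  have P1 := mulr_ge0 M2 x2; have P2 := mulr_ge0 M2 a0.
  have P3 := mulr_ge0 L2 a0; have P4 := mulr_ge0 (mulr_ge0 L2 B0) x2.
  have -> : c * (x ^+ 2 + a) = L ^+ 2 * (2 * (B * a + x ^+ 2)) +
    (M ^+ 2 * x ^+ 2 + M ^+ 2 * a + 2 * (L ^+ 2 * a) + 2 * (L ^+ 2 * B * x ^+ 2)).
    by rewrite /c; ring.
  by rewrite lerDl; lra.
apply: (@le_trans _ _ (M ^+ 2 * x ^+ 2)).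
  rewrite -exprMn lerXn2r ?nnegrE ?mulr_ge0//.
  rewrite (le_trans (opnorm_apply _ _))// ler_wpM2r// HM//.
  exact: sub_segment_hull.
apply: (@le_trans _ _ (c * x ^+ 2)).
  by rewrite ler_wpM2r// lerDr !mulr_ge0// addr_ge0.
by rewrite ler_wpM2l// lerDl.
Qed.

Lemma sq_remainder_le : exists2 c : R, 0 <= c & forall z z', K z -> K z' ->
  `|sq_remainder z z'| <= c * sq_gauge z z'.
Proof.
have [c c0 Hc] := sq_increment_le; exists (2 * c); first by rewrite mulr_ge0.
move=> z z' Kz Kz'; have [H1 H2] := Hc z z' Kz Kz'.
rewrite (le_trans (ler_normB _ _))//.
have H3 := norm_tsq alpha_uniform GG (f z' - f z).
have H4 := norm_tsq alpha_uniform GG (D z (z'.2 - z.2)).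
rewrite -mulrA (mulr_natl _ 2) mulr2n.
by apply: lerD; [exact: le_trans H1|exact: le_trans H2].
Qed.

(** Passing through [(z.1, z'.2)] gives |u - w| <= L a + e' x, while |u| + |w| <= M' (a + x). The
    product is e x^2 plus a times a factor that tends to 0 with |z' - z|; as the gauge is linear in
    a, this last term is also a small multiple of it. *)
Lemma sq_remainder_small (e : R) : 0 < e -> exists2 d : R, 0 < d &
  forall z z', K z -> K z' -> `|z - z'| <= d ->
  `|sq_remainder z z'| <= e * sq_gauge z z'.
Proof.
move=> e0.
have [L L0 HL] := lipschitz_hull f_lip cK.
have [M M0 HM] := derivative_bounded cD cK.
pose M' := L + M + 1.
have M'0 : 0 < M' by rewrite ltr_wpDl// addr_ge0.
pose e' := e / M'.
have e'0 : 0 < e' by rewrite divr_gt0.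
have [d1 d10 Hd1] := taylor_hull fD cD cK e'0.
(* The factor of [a] in the product is at most q |z' - z|, since both increments are at most |z' -
   z|. *)
pose q := M' * (2 * L + e').
have q0 : 0 < q by rewrite mulr_gt0// ltr_wpDl// mulr_ge0.
exists (Num.min d1 (e / q)); first by rewrite lt_min d10 divr_gt0.
move=> z z' Kz Kz'; rewrite le_min distrC => /andP[zd1 zd2].
set x := `|z'.2 - z.2|; set a := `|z'.1 - z.1|.
have x0 : 0 <= x by exact: normr_ge0.
have a0 : 0 <= a by exact: normr_ge0.
have xz : x <= `|z' - z| by exact: (norm_snd_le (z' - z)).
have az : a <= `|z' - z| by exact: (norm_fst_le (z' - z)).
set u := f z' - f z; set w := D z (z'.2 - z.2).
have uw : `|u - w| <= L * a + e' * x.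
  have -> : u - w = (f z' - f (z.1, z'.2)) + (f (z.1, z'.2) - f z - w).
    by rewrite /u addrA subrKA.
  rewrite (le_trans (ler_normD _ _))// lerD//.
    rewrite (le_trans (HL _ _ (sub_segment_hull Kz') (segment_hull_pair Kz Kz')))//.
    rewrite ler_wpM2l// (le_trans (norm_pair_le _))//= subrr normr0 addr0//.
  by apply: Hd1 => //; rewrite -/x (le_trans xz).
have wle : `|w| <= M * x.
  rewrite (le_trans (opnorm_apply _ _))// ler_wpM2r// HM//.
  exact: sub_segment_hull.
have ule : `|u| <= L * (a + x).
  rewrite (le_trans (HL _ _ (sub_segment_hull Kz') (sub_segment_hull Kz)))//.
  by rewrite ler_wpM2l// (norm_pair_le (z' - z)).
have uwle : `|u| + `|w| <= M' * (a + x).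
  have P1 := mulr_ge0 M0 a0.
  by move: ule wle; rewrite /M'; lra.
rewrite (le_trans (norm_tprodB alpha_uniform GG u w))//.
apply: (@le_trans _ _ ((L * a + e' * x) * (M' * (a + x)))); first by rewrite ler_pM.
rewrite /sq_gauge -/x -/a.
have -> : (L * a + e' * x) * (M' * (a + x)) =
    M' * (L * (a + x) + e' * x) * a + (e' * M') * x ^+ 2 by ring.
have -> : e' * M' = e by rewrite /e' mulfVK// gt_eqF.
rewrite (mulrDr e) addrC lerD2l ler_wpM2r//.
apply: (@le_trans _ _ (q * `|z' - z|)).
  have -> : q * `|z' - z| = M' * (L * (`|z' - z| + `|z' - z|) + e' * `|z' - z|).
    by rewrite /q; ring.
  rewrite ler_wpM2l ?(ltW M'0)// lerD// ler_wpM2l ?(ltW e'0)//.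
  by rewrite lerD.
by rewrite mulrC -ler_pdivlMr.
Qed.

Lemma norm_incrementB (V : normedModType R) (a a' b b' : V) :
  `|(a' - a) - (b' - b)| <= `|a - b| + `|a' - b'|.
Proof.
have -> : (a' - a) - (b' - b) = (a' - b') - (a - b).
  by rewrite !opprB (addrC b) addrACA (addrC (- a)).
by rewrite addrC (le_trans (ler_normD _ _))// normrN.
Qed.

Lemma sq_gauge_uniform : uniform_on K (sq_gauge : F * E -> F * E -> R^o).
Proof.
move=> e e0; have [B B0 HB] := diameter_bounded cK.
have q0 : 0 < 4 * B + 2 by rewrite ltr_wpDl// mulr_ge0.
exists (e / (4 * B + 2)); first by rewrite divr_gt0.
set d := e / _.
move=> x x' y y' Kx Kx' Ky Ky' xy xy'.
have H2 : `|(x'.2 - x.2) - (y'.2 - y.2)| <= 2 * d.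
  rewrite (le_trans (norm_incrementB _ _ _ _))// (mulr_natl d 2) mulr2n lerD//.
    exact: le_trans (norm_snd_le (x - y)) xy.
  exact: le_trans (norm_snd_le (x' - y')) xy'.
have H1 : `|(x'.1 - x.1) - (y'.1 - y.1)| <= 2 * d.
  rewrite (le_trans (norm_incrementB _ _ _ _))// (mulr_natl d 2) mulr2n lerD//.
    exact: le_trans (norm_fst_le (x - y)) xy.
  exact: le_trans (norm_fst_le (x' - y')) xy'.
have Bx : `|x'.2 - x.2| <= B := le_trans (norm_snd_le (x' - x)) (HB _ _ Kx' Kx).
have By : `|y'.2 - y.2| <= B := le_trans (norm_snd_le (y' - y)) (HB _ _ Ky' Ky).
have d0 : 0 <= d by rewrite divr_ge0// ltW.
have -> : (sq_gauge x x' : R^o) - sq_gauge y y' =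
    (`|x'.2 - x.2| - `|y'.2 - y.2|) * (`|x'.2 - x.2| + `|y'.2 - y.2|) +
    (`|x'.1 - x.1| - `|y'.1 - y.1|) by rewrite /sq_gauge -subr_sqr; ring.
have -> : e = 2 * d * (2 * B) + 2 * d.
  have -> : 2 * d * (2 * B) + 2 * d = d * (4 * B + 2) by ring.
  by rewrite /d mulfVK// gt_eqF.
rewrite (le_trans (ler_normD _ _))// lerD//; last exact: le_trans (ler_dist_dist _ _) H1.
rewrite normrM ler_pM//; first exact: le_trans (ler_dist_dist _ _) H2.
by rewrite ger0_norm ?addr_ge0// (mulr_natl B 2) mulr2n lerD.
Qed.

Lemma sq_remainder_uniform : uniform_on K sq_remainder.
Proof.
move=> e e0; have [B B0 HB] := diameter_bounded cK.
have [L L0 HL] := lipschitz_hull f_lip cK.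
have [M M0 HM] := derivative_bounded cD cK.
have e2 : 0 < e / 2 by rewrite divr_gt0.
(* These are the coefficients of [e'] and [d] in the final bound [e' * p + d * q], where [e'] is the
   oscillation of [D]. *)
pose p := 2 * M * B ^+ 2; pose q := (L ^+ 2 + M ^+ 2) * 4 * B.
have p0 : 0 <= p by rewrite !mulr_ge0.
have q0 : 0 <= q by rewrite !mulr_ge0// addr_ge0// sqr_ge0.
have p1 : 0 < p + 1 by rewrite ltr_wpDl.
have q1 : 0 < q + 1 by rewrite ltr_wpDl.
pose e' := e / 2 / (p + 1).
have e'0 : 0 < e' by rewrite divr_gt0.
have [d1 d10 Hd1] := derivative_uniform cD cK e'0.
pose d := Num.min d1 (e / 2 / (q + 1)).
have d0 : 0 < d by rewrite lt_min d10 divr_gt0.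
exists d => // x x' y y' Kx Kx' Ky Ky' xy xy'.
have Hx := sub_segment_hull Kx; have Hx' := sub_segment_hull Kx'.
have Hy := sub_segment_hull Ky; have Hy' := sub_segment_hull Ky'.
have Bx : `|x'.2 - x.2| <= B := le_trans (norm_snd_le (x' - x)) (HB _ _ Kx' Kx).
have By : `|y'.2 - y.2| <= B := le_trans (norm_snd_le (y' - y)) (HB _ _ Ky' Ky).
have H2 : `|(x'.2 - x.2) - (y'.2 - y.2)| <= 2 * d.
  rewrite (le_trans (norm_incrementB _ _ _ _))// (mulr_natl d 2) mulr2n lerD//.
    exact: le_trans (norm_snd_le (x - y)) xy.
  exact: le_trans (norm_snd_le (x' - y')) xy'.
set u1 := f x' - f x; set u2 := f y' - f y.
set w1 := D x (x'.2 - x.2); set w2 := D y (y'.2 - y.2).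
have u1B : `|u1| <= L * B by rewrite (le_trans (HL _ _ Hx' Hx))// ler_wpM2l// HB.
have u2B : `|u2| <= L * B by rewrite (le_trans (HL _ _ Hy' Hy))// ler_wpM2l// HB.
have w1B : `|w1| <= M * B by rewrite (le_trans (opnorm_apply _ _))// ler_pM// HM.
have w2B : `|w2| <= M * B by rewrite (le_trans (opnorm_apply _ _))// ler_pM// HM.
have u12 : `|u1 - u2| <= 2 * L * d.
  rewrite (le_trans (norm_incrementB _ _ _ _))//.
  have -> : 2 * L * d = L * d + L * d by ring.
  by rewrite lerD// (le_trans (HL _ _ _ _))// ler_wpM2l.
have w12 : `|w1 - w2| <= e' * B + M * (2 * d).
  have -> : w1 - w2 = (D x - D y) (x'.2 - x.2) + D y ((x'.2 - x.2) - (y'.2 - y.2)).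
    by rewrite bop_subE [D y (_ - _ - _)]bopB subrKA.
  rewrite (le_trans (ler_normD _ _))// lerD// (le_trans (opnorm_apply _ _))// ler_pM// ?HM//.
  by apply: Hd1 => //; rewrite (le_trans xy)// ge_min lexx.
have -> : sq_remainder x x' - sq_remainder y y' =
    (tsq GG u1 - tsq GG u2) - (tsq GG w1 - tsq GG w2).
  rewrite /sq_remainder -/u1 -/u2 -/w1 -/w2 !opprB (addrC (tsq GG w2)) addrACA.
  by rewrite (addrC (- tsq GG w1)).
rewrite (le_trans (ler_normB _ _))//.
have U : `|tsq GG u1 - tsq GG u2| <= 2 * L * d * (L * B + L * B).
  by rewrite (le_trans (norm_tprodB alpha_uniform GG u1 u2))// ler_pM// lerD.
have Wb : `|tsq GG w1 - tsq GG w2| <= (e' * B + M * (2 * d)) * (M * B + M * B).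
  by rewrite (le_trans (norm_tprodB alpha_uniform GG w1 w2))// ler_pM// lerD.
apply: le_trans (lerD U Wb) _.
have -> : 2 * L * d * (L * B + L * B) + (e' * B + M * (2 * d)) * (M * B + M * B) =
    e' * p + d * q by rewrite /p /q; ring.
rewrite (splitr e) lerD//.
  by rewrite /e' mulrAC ler_pdivrMr// ler_wpM2l ?(ltW e2)// lerDl.
apply: (@le_trans _ _ (e / 2 / (q + 1) * q)).
  by rewrite ler_wpM2r// ge_min lexx orbT.
by rewrite mulrAC ler_pdivrMr// ler_wpM2l ?(ltW e2)// lerDl.
Qed.

End SquareRemainder.

(** * The integral as a path *)

Section IntegralPath.
Context {R : realType} {V : normedModType R} {W : completeNormedModType R}.

Lemma eq_stieltjes_integral (H H' : R -> 'L(V, W)) (Z : R -> V) (t : R) (I : W) :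
  (forall s, 0 < s <= t -> H s = H' s) ->
  is_stieltjes_integral H Z t I -> is_stieltjes_integral H' Z t I.
Proof.
move=> HH' [mu [mu1 [h [h1 h2 h3 h4]]]]; exists mu; split; first exact: mu1.
exists h; split; [exact: h1| | |exact: h4].
  move=> n; apply: eq_measurable_fun (h2 n) => s; rewrite inE /= in_itv/= => st.
  by rewrite HH'.
apply: cvg_trans h3; apply: near_eq_cvg; near=> n; apply: eq_integral => s.
by rewrite inE /= in_itv/= => st; rewrite HH'.
Unshelve. all: by end_near. Qed.

Variables (k : R -> 'L(V, W)) (Z : R -> V).
Hypothesis ck : cadlag k.
Hypothesis fZ : finite_variation Z.
Hypothesis rZ : forall t, 0 <= t -> Z s @[s --> t^'+] --> Z t.

Lemma stieltjes_path_ex : exists I : R -> W, forall t, 0 <= t ->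
  is_stieltjes_integral (left_lim k) Z t (I t) /\
  forall (h : op_step V W) e, step_on 0 t h ->
    (forall s, 0 < s <= t -> `|left_lim k s - op_step_fun h s| <= e) ->
    `|I t - op_step_integral Z h| <= e * tvar Z 0 t.
Proof.
have /choice[I HI] (t : R) : exists I : W, 0 <= t ->
  is_stieltjes_integral (left_lim k) Z t I /\
  forall (h : op_step V W) e, step_on 0 t h ->
    (forall s, 0 < s <= t -> `|left_lim k s - op_step_fun h s| <= e) ->
    `|I - op_step_integral Z h| <= e * tvar Z 0 t.
  have [t0|t0] := leP 0 t; last by exists 0.
  by have [I HI] := stieltjes_ex ck t0 fZ rZ; exists I.
by exists I => t t0; exact: HI.
Qed.

Variable I : R -> W.
Hypothesis HI : forall t, 0 <= t -> forall (h : op_step V W) e, step_on 0 t h ->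
  (forall s, 0 < s <= t -> `|left_lim k s - op_step_fun h s| <= e) ->
  `|I t - op_step_integral Z h| <= e * tvar Z 0 t.

(** [I] is known only through the estimate [HI] at each time, without additivity. Restricting one
    [h] to [0, u] and to [0, v] relates the two values; the two errors explain the factor 2 in
    [c]. *)
Lemma stieltjes_increment (T e : R) : 0 <= T -> 0 < e ->
  exists h : op_step V W, [/\ step_on 0 T h,
    forall s, 0 < s <= T -> `|left_lim k s - op_step_fun h s| <= e &
    forall u v, 0 <= u -> u <= v -> v <= T ->
      `|I v - I u| <= e + `|op_step_integral Z (clamp_step u v h)|].
Proof.
move=> T0 e0.
have tv0 : 0 <= tvar Z 0 T by rewrite tvar_ge0.
pose c := 2 * tvar Z 0 T + 1.
have c1 : 1 <= c by rewrite lerDr mulr_ge0.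
have c0 : 0 < c by exact: lt_le_trans c1.
pose e' := e / c.
have e'0 : 0 < e' by rewrite divr_gt0.
have [h on_h Hh] := step_approx ck (lexx 0) T0 e'0.
exists h; split => //.
  by move=> s sT; rewrite (le_trans (Hh s sT))// ler_pdivrMr// ler_peMr// ltW.
have bound v : 0 <= v -> v <= T ->
    `|I v - op_step_integral Z (clamp_step 0 v h)| <= e' * tvar Z 0 T.
  move=> v0 vT.
  rewrite (@le_trans _ _ (e' * tvar Z 0 v))//.
    apply: HI => //; first exact: step_on_clamp on_h.
    move=> s /andP[s0 sv]; rewrite clamp_step_fun//; apply: Hh.
    by rewrite s0 (le_trans sv).
  by rewrite ler_wpM2l ?(ltW e'0)// (tvarD fZ (lexx 0) v0 vT) lerDl tvar_ge0.
move=> u v u0 uv vT; have v0 := le_trans u0 uv.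
have H1 := bound v v0 vT; have H2 := bound u u0 (le_trans uv vT).
have -> : I v - I u = (I v - op_step_integral Z (clamp_step 0 v h)) -
    (I u - op_step_integral Z (clamp_step 0 u h)) +
    op_step_integral Z (clamp_step u v h).
  rewrite (op_step_integral_clampD Z h u0 uv).
  set x := op_step_integral _ _; set y := op_step_integral _ _.
  by rewrite opprB [RHS]addrAC opprD (addrA (I v)) subrK subrKA.
rewrite (le_trans (ler_normD _ _))// lerD2r (le_trans (ler_normB _ _))//.
apply: (le_trans (lerD H1 H2)); rewrite -mulrDr.
rewrite /e' mulrAC ler_pdivrMr// ler_wpM2l ?(ltW e0)// /c; lra.
Qed.

Lemma left_lim_bounded (T : R) : exists2 M : R, 0 <= M &
  forall s, 0 < s <= T -> `|left_lim k s| <= M.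
Proof.
have /pinfty_ex_gt0[M M0 HM] := compact_bounded (@cadlag_range_compact _ _ _ ck T).
exists M; first exact: ltW.
by move=> s sT; apply: HM; exact: cadlag_range_left_lim.
Qed.

Lemma stieltjes_finite_variation : finite_variation I.
Proof.
apply: finite_variation_dominated => T.
have [T0|T0] := leP 0 T; last first.
  exists (fun=> 0) => u v u0 uv vT.
  by have := lt_le_trans T0 (le_trans u0 (le_trans uv vT)); rewrite ltxx.
have [M M0 HM] := left_lim_bounded T.
exists (fun t => M * tvar_cdf Z t) => u v u0 uv vT.
rewrite -mulrBr tvar_cdfB//; apply/ler_addgt0Pr => e e0.
have t0 : 0 <= tvar Z u v by rewrite tvar_ge0.
have t1 : 0 < tvar Z u v + 1 by rewrite ltr_wpDl.
have e'0 : 0 < e / 2 / (tvar Z u v + 1) by rewrite !divr_gt0.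
have e'1 : e / 2 / (tvar Z u v + 1) <= e / 2.
  by rewrite ler_pdivrMr// ler_peMr ?divr_ge0 ?(ltW e0)// lerDr.
have [h [on_h Hh Ih]] := stieltjes_increment T0 e'0.
apply: (le_trans (Ih u v u0 uv vT)).
have -> : M * tvar Z u v + e = e / 2 + (M * tvar Z u v + e / 2) by lra.
apply: lerD => //.
have : `|op_step_integral Z (clamp_step u v h)| <=
    (M + e / 2 / (tvar Z u v + 1)) * tvar Z u v.
  apply: op_step_integral_le => //; first exact: step_on_clamp on_h.
  move=> s /andP[us sv]; rewrite clamp_step_fun//.
  have sT : 0 < s <= T by rewrite (le_lt_trans u0 us) (le_trans sv).
  rewrite -(subrKC (left_lim k s) (op_step_fun h s)) (le_trans (ler_normD _ _))// lerD ?HM//.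
  by rewrite distrC Hh.
move=> Hop.
apply: (le_trans Hop).
rewrite mulrDl lerD2l mulrAC ler_pdivrMr//.
by rewrite ler_wpM2l ?divr_ge0 ?(ltW e0)// lerDl.
Qed.

Lemma stieltjes_right_continuous t : 0 <= t -> I s @[s --> t^'+] --> I t.
Proof.
move=> t0; apply/cvgrPdist_le => e e0; have e2 : 0 < e / 2 by rewrite divr_gt0.
have T0 : 0 <= t + 1 by rewrite addr_ge0.
have [h [on_h Hh Ih]] := stieltjes_increment T0 e2.
have [M M0 HM] := left_lim_bounded (t + 1).
pose M' := M + e / 2 + 1.
have M'0 : 0 < M' by rewrite ltr_wpDl// addr_ge0// ltW.
near=> v.
have tv : t < v by near: v; exact: nbhs_right_gt.
have vT : v <= t + 1 by near: v; apply: nbhs_right_le; rewrite ltrDl.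
rewrite distrC (le_trans (Ih t v t0 (ltW tv) vT))// [leRHS]splitr lerD2l.
rewrite (near (clamp_step_near_right Z t on_h) v)//.
have hM : `|op_step_fun h v| <= M'.
  have v0 : 0 < v <= t + 1 by rewrite (le_lt_trans t0 tv).
  rewrite -(subrKC (left_lim k v) (op_step_fun h v)) (le_trans (ler_normD _ _))//.
  have := Hh v v0; have := HM v v0; rewrite /M' distrC; lra.
rewrite (le_trans (opnorm_apply _ _))// (le_trans (ler_wpM2r _ hM))//.
rewrite mulrC -ler_pdivlMr//.
near: v; move/cvgr_distC_le : (rZ t0); apply; by rewrite divr_gt0.
Unshelve. all: by end_near. Qed.

Hypothesis lZ : forall t, 0 < t -> Z s @[s --> t^'-] --> Z t.

(** Just before [t] the step is a single operator, so [I] inherits left continuity from the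
    integrator. For the continuous part of the bracket this makes the jump series the only source of
    jumps. *)
Lemma stieltjes_left_continuous t : 0 < t -> I s @[s --> t^'-] --> I t.
Proof.
move=> t0; apply/cvgrPdist_le => e e0; have e2 : 0 < e / 2 by rewrite divr_gt0.
have [h [on_h Hh Ih]] := stieltjes_increment (ltW t0) e2.
pose M' := `|op_step_fun h t| + 1.
have M'0 : 0 < M' by rewrite ltr_wpDl.
near=> u.
have ut : u < t by near: u; exact: nbhs_left_lt.
have u0 : 0 <= u by near: u; exact: nbhs_left_ge.
rewrite (le_trans (Ih u t u0 (ltW ut) (lexx t)))// [leRHS]splitr lerD2l.
rewrite (near (clamp_step_near_left Z t on_h) u)//.
have hM : `|op_step_fun h t| <= M' by rewrite lerDl.
rewrite (le_trans (opnorm_apply _ _))// (le_trans (ler_wpM2r _ hM))//.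
rewrite mulrC -ler_pdivlMr//.
near: u; move/cvgr_dist_le : (lZ t0); apply; by rewrite divr_gt0.
Unshelve. all: by end_near. Qed.

End IntegralPath.

(** * Step integrals of jump sums and images of càdlàg paths *)

Section SumsAndSteps.
Context {R : realType}.

Lemma eq_upto (V : normedModType R) (g g' : R -> V) (t : R) :
  (forall s, 0 < s <= t -> g s = g' s) -> upto g t = upto g' t.
Proof. by move=> gg'; apply/funext => s; rewrite /upto; case: ifP => // /gg'. Qed.

Lemma sum_uptoD (V : completeNormedModType R) (g g' : R -> V) (t : R) :
  absolutely_summable (upto g t) -> absolutely_summable (upto g' t) ->
  sum_upto (fun s => g s + g' s) t = sum_upto g t + sum_upto g' t.
Proof.
move=> gs g's; apply: cvg_lim; first exact: norm_hausdorff.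
rewrite (_ : summability.partial_sum _ = fun J => summability.partial_sum (upto g t) J +
    summability.partial_sum (upto g' t) J).
  by apply: cvgD; exact: partial_sum_cvg.
apply/funext => J; rewrite !partial_sumE -big_split /=; apply: eq_bigr => s _.
by rewrite /upto; case: ifP; rewrite ?addr0.
Qed.

Section Steps.
Context {V W : completeNormedModType R} (g : R -> V).
Hypothesis gs : forall t, 0 <= t -> absolutely_summable (upto g t).

Lemma op_step_integral_sum_upto (h : op_step V W) (t : R) : step_on 0 t h ->
  (fun J : {fset R} => \sum_(s <- J) op_step_fun h s (upto g t s)) @
    summability.totally --> op_step_integral (sum_upto g) h.
Proof.
elim: h => [_|p h IH onh].
  rewrite /op_step_integral big_nil (_ : (fun J : {fset R} => _) = fun=> 0); first exact: cvg_cst.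
  by apply/funext => J; rewrite big1// => s _; rewrite /op_step_fun big_nil bop0E.
have [[p0 pp pt] {}/IH IH] := step_on_cons onh.
rewrite op_step_integral_cons.
rewrite (_ : (fun J : {fset R} => _) = fun J : {fset R} =>
    p.2 (summability.partial_sum (fun s => upto g p.1.2 s - upto g p.1.1 s) J) +
    \sum_(s <- J) op_step_fun h s (upto g t s)).
  apply: cvgD => //; apply: continuous_cvg; first exact: bop_continuous.
  exact: sum_uptoB.
apply/funext => J; rewrite partial_sumE linear_sum -big_split /=; apply: eq_bigr => s _.
rewrite op_step_fun_cons bop_addE bop_scaleE; congr (_ + _).
rewrite upto_itv// indicE mem_setE in_itv/=; case: ifPn => [/andP[ps sp]|_]; last first.
  by rewrite scale0r linear0.
by rewrite scale1r /upto (le_lt_trans p0 ps) (le_trans sp pt).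
Qed.

(** On a finite set of times the terms differ by at most [e] times the norm of [g s]; the bound
    passes to the limit along finite sets. *)
Lemma sum_upto_step_close (H : R -> 'L(V, W)) (h : op_step V W) (t e B : R) :
  0 <= e -> step_on 0 t h -> (forall s, 0 < s <= t -> `|H s - op_step_fun h s| <= e) ->
  (forall J : {fset R}, \sum_(s <- J) `|upto g t s| <= B) ->
  absolutely_summable (upto (fun s => H s (g s)) t) ->
  `|sum_upto (fun s => H s (g s)) t - op_step_integral (sum_upto g) h| <= e * B.
Proof.
move=> e0 onh Hh gB Hs.
have lim : (fun J : {fset R} => summability.partial_sum (upto (fun s => H s (g s)) t) J -
    \sum_(s <- J) op_step_fun h s (upto g t s)) @ summability.totally -->
    sum_upto (fun s => H s (g s)) t - op_step_integral (sum_upto g) h.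
  by apply: cvgB; [exact: partial_sum_cvg|exact: op_step_integral_sum_upto].
rewrite -[X in `|X|]subr0; apply: (cvg_norm_le _ lim).
near=> J; rewrite subr0 /= partial_sumE -sumrB.
rewrite (le_trans (ler_norm_sum _ _ _))// (le_trans _ (ler_wpM2l e0 (gB J)))//.
rewrite mulr_sumr; apply: ler_sum => s _; rewrite /upto; case: ifPn => [st|_].
  by rewrite -bop_subE (le_trans (opnorm_apply _ _))// ler_wpM2r// Hh.
by rewrite linear0 subr0 normr0 mulr_ge0.
Unshelve. all: by end_near. Qed.

End Steps.

(** A step integral involves finitely many times and fixed operators, each of which respects the
    mode. Convergence of the discrete brackets enters the proof only through this. *)
Lemma converges_step_integral (m : convergence_mode) (V W : normedModType R)
    (u : nat -> R -> V) (Q : R -> V) (h : op_step V W) (t : R) : step_on 0 t h ->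
  (forall s, 0 <= s <= t -> converges m (u ^~ s) (Q s)) ->
  converges m (fun n => op_step_integral (u n) h) (op_step_integral Q h).
Proof.
move=> + uQ; elim: h => [_|p h IH onh].
  apply: converges_strong; rewrite /op_step_integral big_nil.
  by under eq_fun do rewrite big_nil; exact: cvg_cst.
have [[p0 pp pt] {}/IH IH] := step_on_cons onh.
rewrite op_step_integral_cons; under eq_fun do rewrite op_step_integral_cons.
apply: convergesD => //; apply: converges_op; apply: convergesB; apply: uQ.
  by rewrite (le_trans p0 pp).
by rewrite p0 (le_trans pp).
Qed.

Lemma fsum_ord (V : zmodType) (F : nat -> V) (N : nat) :
  (forall i, (N <= i)%N -> F i = 0) -> \sum_(i \in [set: nat]) F i = \sum_(i < N) F i.
Proof.
move=> F0; rewrite fsbig_ord; apply/esym/fsbig_widen => // i [_ /= /negP].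
by rewrite -leqNgt => /F0.
Qed.

(** Uniform continuity on the compact set of values and left limits is the form in which the
    assumptions on [f] and its derivative are available. *)
Lemma cadlag_comp (V W : normedModType R) (Z : R -> V) (g : V -> W) : cadlag Z ->
  (forall T e : R, 0 < e -> exists2 d : R, 0 < d & forall z z',
    cadlag_range Z T z -> cadlag_range Z T z' -> `|z - z'| <= d -> `|g z - g z'| <= e) ->
  cadlag (fun s => g (Z s)) /\
  forall t, 0 < t -> left_lim (fun s => g (Z s)) t = g (left_lim Z t).
Proof.
move=> cZ gu.
have gl t : 0 < t -> g (Z s) @[s --> t^'-] --> g (left_lim Z t).
  move=> t0; apply/cvgrPdist_le => e e0; have [d d0 Hd] := gu t e e0.
  near=> s; apply: Hd.
  - by apply: cadlag_range_left_lim; rewrite t0 lexx.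
  - apply: cadlag_range_val; apply/andP; split; near: s.
      exact: nbhs_left_ge.
    exact: nbhs_left_le.
  - by near: s; move/cvgr_dist_le : (cadlag_left_lim cZ t0); exact.
split; last by move=> t t0; exact: left_limE (gl t t0).
split=> t t0; last by apply/cvg_ex; exists (g (left_lim Z t)); exact: gl.
apply/cvgrPdist_le => e e0; have [d d0 Hd] := gu (t + 1) e e0.
near=> s; apply: Hd.
- by apply: cadlag_range_val; rewrite t0 lerDl ler01.
- apply: cadlag_range_val; apply/andP; split.
    by apply: (le_trans t0); near: s; exact: nbhs_right_ge.
  by near: s; apply: nbhs_right_le; rewrite ltrDl.
- by near: s; move/cvgr_dist_le : (cZ.1 t t0); exact.
Unshelve. all: by end_near. Qed.

Lemma cadlag_pair (V W : normedModType R) (A : R -> V) (X : R -> W) :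
  cadlag A -> cadlag X -> cadlag (fun s => (A s, X s)) /\
  forall t, 0 < t -> left_lim (fun s => (A s, X s)) t = (left_lim A t, left_lim X t).
Proof.
move=> cA cX.
have l t : 0 < t -> (A s, X s) @[s --> t^'-] --> (left_lim A t, left_lim X t).
  by move=> t0; apply: cvg_pair; exact: cadlag_left_lim.
split; last by move=> t t0; exact: left_limE (l t t0).
split=> t t0; last by apply/cvg_ex; eexists; exact: l.
by apply: cvg_pair; [exact: cA.1|exact: cX.1].
Qed.

End SumsAndSteps.

(** * Quadratic variation of the image path *)

Section QuadraticVariation.
Context {R : realType} {E F G : completeNormedModType R}.
Variables (alpha : @tensor_norm_family R) (alpha_uniform : uniform_crossnorm alpha).
Variables (EE : tensor_completion alpha E E) (GG : tensor_completion alpha G G).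
Variables (pi : nat -> nat -> R) (ppi : forall n, is_partition (pi n)).
Variables (X : R -> E) (cX : cadlag X) (A : R -> F) (cA : cadlag A).
Hypothesis fA : finite_variation A.
Variables (f : F * E -> G) (D : F * E -> 'L(E, G)).
Hypothesis f_lip : lipschitz_on_compacts f.
Hypothesis fD : forall a x, gateaux_derivative (fun y => f (a, y)) x (D (a, x)).
Hypothesis cD : continuous_on_compacts D.
Let Z s : F * E := (A s, X s).
Hypothesis fpi : forall t d, 0 <= t -> 0 < d -> \forall n \near \oo, fine_at Z t d (pi n).
Variables (m : convergence_mode) (QX : R -> EE).
Hypothesis X_qv : tensor_quadratic_variation m pi X QX.
Hypothesis X_2v : finite_2variation X pi.

Let Y s := f (Z s).
Let op z : 'L(EE, GG) := tensor_op EE GG (D z) (D z).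
Let k s := op (Z s).
Let K T := cadlag_range Z T.
Let dY s := tprod GG (jump Y s) (jump Y s).
Let Qc := continuous_part QX.

Let cZ : cadlag Z.
Proof. exact: (cadlag_pair cA cX).1. Qed.

Let left_limZ t : 0 < t -> left_lim Z t = (left_lim A t, left_lim X t).
Proof. exact: (cadlag_pair cA cX).2. Qed.

Let cK T : compact (K T).
Proof. exact: (@cadlag_range_compact _ _ _ cZ T). Qed.

Let KZ T s : 0 <= s <= T -> K T (Z s).
Proof. exact: cadlag_range_val. Qed.

Let Kl T s : 0 < s <= T -> K T (left_lim Z s).
Proof. exact: cadlag_range_left_lim. Qed.

Let f_uniform T e : 0 < e -> exists2 d : R, 0 < d & forall z z', K T z -> K T z' ->
  `|z - z'| <= d -> `|f z - f z'| <= e.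
Proof.
move=> e0; have [L L0 HL] := lipschitz_hull f_lip (@cK T).
have L1 : 0 < L + 1 by rewrite ltr_wpDl.
exists (e / (L + 1)); first by rewrite divr_gt0.
move=> z z' Kz Kz' zz'.
rewrite (le_trans (HL _ _ (sub_segment_hull Kz) (sub_segment_hull Kz')))//.
rewrite (le_trans (ler_wpM2l L0 zz'))// mulrC mulrAC ler_pdivrMr//.
by rewrite ler_wpM2l ?(ltW e0)// lerDl.
Qed.

Let op_uniform T e : 0 < e -> exists2 d : R, 0 < d & forall z z', K T z -> K T z' ->
  `|z - z'| <= d -> `|op z - op z'| <= e.
Proof.
move=> e0; have [M M0 HM] := derivative_bounded cD (@cK T).
have M1 : 0 < M + M + 1 by rewrite ltr_wpDl// addr_ge0.
have e'0 : 0 < e / (M + M + 1) by rewrite divr_gt0.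
have [d d0 Hd] := derivative_uniform cD (@cK T) e'0; exists d => // z z' Kz Kz' zz'.
have {}Kz := sub_segment_hull Kz; have {}Kz' := sub_segment_hull Kz'.
rewrite (le_trans (norm_tensor_opB alpha_uniform EE GG (D z) (D z')))//.
apply: (@le_trans _ _ (e / (M + M + 1) * (M + M))).
  by rewrite ler_pM ?addr_ge0// ?Hd// lerD ?HM.
by rewrite mulrAC ler_pdivrMr// ler_wpM2l ?(ltW e0)// lerDl.
Qed.

Let cY : cadlag Y.
Proof. exact: (cadlag_comp cZ f_uniform).1. Qed.

Let jumpY s : 0 < s -> jump Y s = f (Z s) - f (left_lim Z s).
Proof. by move=> s0; rewrite /jump s0 (cadlag_comp cZ f_uniform).2. Qed.

Let ck : cadlag k.
Proof. exact: (cadlag_comp cZ op_uniform).1. Qed.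

Let left_limk s : 0 < s -> left_lim k s = op (left_lim Z s).
Proof. exact: (cadlag_comp cZ op_uniform).2. Qed.

Let jumpX s : 0 < s -> jump X s = (Z s).2 - (left_lim Z s).2.
Proof. by move=> s0; rewrite /jump s0 left_limZ. Qed.

Let cQ : cadlag QX.
Proof. by case: X_qv => _ []. Qed.

Let fQ : finite_variation QX.
Proof. by case: X_qv => _ []. Qed.

Let jumpQ s : 0 <= s -> jump QX s = tprod EE (jump X s) (jump X s).
Proof. by case: X_qv => _ _ _; exact. Qed.

(** Any index past [t] will do: later cells have zero increments up to [t]. *)
Let N t n := xget 0%N [set i | t <= pi n i].

Let piN t n : t <= pi n (N t n).
Proof.
have [i ti] := partition_ex t (ppi n).
by apply: (@xgetPex _ 0%N [set i | t <= pi n i]); exists i.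
Qed.

Let increment_out (V : normedModType R) (B : R -> V) t n i : (N t n <= i)%N ->
  increment B t (pi n) i = 0.
Proof.
move=> Ni; apply: increment_ge => //; apply: (le_trans (piN t n)).
exact: partition_le.
Qed.

Let sum_increment_A t n : 0 <= t ->
  \sum_(i < N t n) `|increment A t (pi n) i| <= tvar A 0 t.
Proof.
move=> t0; pose u i := tvar_cdf A (Num.min (pi n i) t).
apply: (@le_trans _ _ (\sum_(i < N t n) (u i.+1 - u i))).
  apply: ler_sum => i _; apply: norm_le_tvar_cdf => //.
    by rewrite le_min t0 andbT partition_ge0.
  by rewrite le_min ge_min ge_min (partition_le (ppi n) (leqnSn i)) lexx orbT.
rewrite -(big_mkord xpredT (fun i => u i.+1 - u i)) telescope_sumr// /u.
rewrite (min_r (piN t n)); have [-> _ _] := ppi n.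
by rewrite min_l// tvar_cdfB.
Qed.

Let V2 t : 0 <= t -> exists B, forall n, sqsum X (pi n) (N t n) t <= B.
Proof.
move=> t0; have [B HB] := X_2v t0; exists B => n; apply: HB; exists n => //.
by apply: fsum_ord => i Ni; rewrite increment_out// normr0 expr0n.
Qed.

Let gauge_bound t : 0 <= t -> exists B, forall n,
  \sum_(i < N t n) cell_value Z pi t (@sq_gauge R E F) n i <= B.
Proof.
move=> t0; have [B HB] := V2 t0; exists (B + tvar A 0 t) => n.
by rewrite /cell_value /sq_gauge /= big_split/= lerD//; [exact: HB|exact: sum_increment_A].
Qed.

Let absolutely_summable_gauge (W : normedModType R) (g : R -> W) c t : 0 <= t -> 0 <= c ->
  (forall s, 0 < s <= t -> `|g s| <= c * sq_gauge (left_lim Z s) (Z s)) ->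
  absolutely_summable (upto g t).
Proof.
move=> t0 c0 gc; have [B HB] := gauge_bound t0.
apply: (absolutely_summable_upto_le cZ ppi (piN t) (fun d => fpi t0) (@KZ t) (@Kl t)
  (@sq_gauge_ge0 R E F) (@sq_gauge_id R E F) HB (sq_gauge_uniform (@cK t)) c0).
exact: gc.
Qed.

Let summable_jumpQ t : 0 <= t -> absolutely_summable (upto (jump QX) t).
Proof.
move=> t0; apply: (absolutely_summable_gauge t0 ler01) => s /andP[s0 _].
rewrite jumpQ ?(ltW s0)// mul1r (le_trans (norm_tsq alpha_uniform EE (jump X s)))//.
by rewrite jumpX// /sq_gauge lerDl.
Qed.

Let summable_dY t : 0 <= t -> absolutely_summable (upto dY t).
Proof.
move=> t0; have [c c0 Hc] := sq_increment_le f_lip cD (@cK t).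
apply: (absolutely_summable_gauge t0 c0) => s s0t; have /andP[s0 st] := s0t.
rewrite (le_trans (norm_tsq alpha_uniform GG (jump Y s)))// jumpY//.
apply: (Hc _ _ _ _).1; first exact: Kl.
by apply: KZ; rewrite (ltW s0).
Qed.

Let fQc : finite_variation Qc.
Proof.
apply: finite_variationD => //; apply: finite_variationN.
exact: finite_variation_sum_upto.
Qed.

Let rQc t : 0 <= t -> Qc s @[s --> t^'+] --> Qc t.
Proof.
by move=> t0; apply: cvgB; [exact: cQ.1|exact: sum_upto_right].
Qed.

(** The left limits of the bracket and of its jump sum miss the same jump, which cancels in the
    difference. *)
Let lQc t : 0 < t -> Qc s @[s --> t^'-] --> Qc t.
Proof.
move=> t0; rewrite [Qc t](_ : _ = left_lim QX t - (sum_upto (jump QX) t - jump QX t)).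
  by apply: cvgB; [exact: cadlag_left_lim|exact: sum_upto_left].
by rewrite {2}/jump t0 /Qc /continuous_part opprB addrA subrKC.
Qed.

Let norm_XZ u v : `|X u - X v| <= `|Z u - Z v|.
Proof. exact: (norm_snd_le (Z u - Z v)). Qed.

Let left_limk_jumpQ s : 0 < s ->
  left_lim k s (jump QX s) = tsq GG (D (left_lim Z s) ((Z s).2 - (left_lim Z s).2)).
Proof.
move=> s0; rewrite left_limk// jumpQ ?(ltW s0)// jumpX//.
exact: tensor_op_tprod.
Qed.

Let summable_left_limk_jumpQ t : 0 <= t ->
  absolutely_summable (upto (fun s => left_lim k s (jump QX s)) t).
Proof.
move=> t0; have [c c0 Hc] := sq_increment_le f_lip cD (@cK t).
apply: (absolutely_summable_gauge t0 c0) => s s0t; have /andP[s0 st] := s0t.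
rewrite left_limk_jumpQ// (le_trans (norm_tsq alpha_uniform GG _))//.
apply: (Hc _ _ _ _).2; first exact: Kl.
by apply: KZ; rewrite (ltW s0).
Qed.

Let summable_remainder t : 0 <= t ->
  absolutely_summable (upto (jump_value Z (sq_remainder GG f D)) t).
Proof.
move=> t0; have [c c0 Hc] := sq_remainder_le alpha_uniform GG f_lip cD (@cK t).
apply: (absolutely_summable_gauge t0 c0) => s s0t; have /andP[s0 st] := s0t.
by apply: Hc; [exact: Kl|apply: KZ; rewrite (ltW s0)].
Qed.

Let tsum_converges t s : 0 <= s <= t ->
  converges m (fun n => tsum EE X (pi n) (N t n) s) (QX s).
Proof.
move=> /andP[s0 st]; have [_ _ /(_ s s0) H _] := X_qv.
rewrite (_ : (fun n => _) = fun n => \sum_(i \in [set: nat])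
  tprod EE (increment X s (pi n) i) (increment X s (pi n) i))//.
apply/funext => n; apply/esym/fsum_ord => i Ni.
rewrite increment_ge ?tprod0l//.
by rewrite (le_trans st)// (le_trans (piN t n))// partition_le.
Qed.

Section Limit.
Variable I : R -> GG.
Hypothesis HI : forall t, 0 <= t -> forall (h : op_step EE GG) e, step_on 0 t h ->
  (forall s, 0 < s <= t -> `|left_lim k s - op_step_fun h s| <= e) ->
  `|I t - op_step_integral Qc h| <= e * tvar Qc 0 t.

(** The approximants are step integrals of the discrete brackets for one [h]. Their errors are those
    of [h] against the continuous part, of [h] against the jump sum, and of freezing; [S] collects
    the factors [tvar Qc 0 t], [BJ] and [BV]. *)
Lemma weighted_tsum_converges t : 0 <= t ->
  converges m (fun n => weighted_tsum X k (pi n) (N t n) t)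
    (I t + sum_upto (fun s => left_lim k s (jump QX s)) t).
Proof.
move=> t0; apply: converges_approx => e e0.
have [BV HV] := V2 t0.
have BV0 : 0 <= BV by apply: le_trans (HV 0%N); apply: sumr_ge0 => i _; exact: sqr_ge0.
have [BJ HJ] := summable_jumpQ t0.
have BJ0 : 0 <= BJ by apply: le_trans (HJ fset0); rewrite big_seq_fset0.
have tv0 : 0 <= tvar Qc 0 t by rewrite tvar_ge0.
pose S := BV + tvar Qc 0 t + BJ + 1.
have S0 : 0 < S by rewrite ltr_wpDl// !addr_ge0.
pose e' := e / S.
have e'0 : 0 < e' by rewrite divr_gt0.
have e'S : e' * S = e by rewrite /e' mulfVK// gt_eqF.
have kuc d : 0 < d -> exists2 d', 0 < d' & forall x y,
    0 <= x <= t -> 0 <= y <= t -> `|Z x - Z y| <= d' -> `|k x - k y| <= d.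
  move=> /(op_uniform t)[d' d'0 Hd]; exists d' => // x y xt yt.
  by apply: Hd; exact: KZ.
have [M M0 HM] := derivative_bounded cD (@cK t).
have kb x : 0 <= x <= t -> `|k x| <= M * M.
  move=> xt; have MD := HM _ (sub_segment_hull (KZ xt)).
  by rewrite (le_trans (norm_tensor_op alpha_uniform EE GG _ _))// ler_pM.
have [B B0 HB] := diameter_bounded (@cK t).
have XB x y : 0 <= x <= t -> 0 <= y <= t -> `|X x - X y| <= B.
  by move=> xt yt; rewrite (le_trans (norm_XZ x y))// HB//; exact: KZ.
have [h [onh Hh lim]] := weighted_tsum_approx alpha_uniform norm_XZ (N t) ppi
  (fun d => fpi t0) ck kuc kb XB t0 e'0.
exists (fun n => op_step_integral (tsum EE X (pi n) (N t n)) h), (op_step_integral QX h).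
split.
- by apply: (converges_step_integral onh) => s; exact: tsum_converges.
- have -> : op_step_integral QX h =
      op_step_integral Qc h + op_step_integral (sum_upto (jump QX)) h.
    rewrite -op_step_integralD; congr op_step_integral; apply/funext => s.
    by rewrite /Qc /continuous_part subrK.
  rewrite opprD addrACA (le_trans (ler_normD _ _))//.
  have H1 := HI t0 onh Hh.
  have H2 := sum_upto_step_close summable_jumpQ (ltW e'0) onh Hh HJ (summable_left_limk_jumpQ t0).
  rewrite (le_trans (lerD H1 H2))// -mulrDr -e'S ler_wpM2l ?(ltW e'0)// /S.
  by move: BV0; lra.
- have := lim e' e'0; apply: filterS => n /le_trans; apply.
  have := HV n => HVn.
  apply: (@le_trans _ _ (e' * BV + e')); first by rewrite lerD2r ler_wpM2l// ltW.
  rewrite -[X in _ + X]mulr1 -mulrDr -[leRHS]e'S ler_wpM2l ?(ltW e'0)// /S.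
  by move: tv0 BJ0; lra.
Qed.

Let QY t := I t + sum_upto dY t.

Lemma tsum_image_converges t : 0 <= t ->
  converges m (fun n => \sum_(i \in [set: nat])
    tprod GG (increment Y t (pi n) i) (increment Y t (pi n) i)) (QY t).
Proof.
move=> t0.
have -> : QY t = (I t + sum_upto (fun s => left_lim k s (jump QX s)) t) +
    sum_upto (jump_value Z (sq_remainder GG f D)) t.
  rewrite -addrA -sum_uptoD//; [|exact: summable_left_limk_jumpQ|exact: summable_remainder].
  congr (_ + _); rewrite /sum_upto; congr summability.sum.
  apply: eq_upto => s /andP[s0 _]; rewrite left_limk_jumpQ// /jump_value /sq_remainder.
  by rewrite addrC subrK /dY jumpY.
rewrite (_ : (fun n => _) = fun n => weighted_tsum X k (pi n) (N t n) t +
    \sum_(i < N t n) cell_value Z pi t (sq_remainder GG f D) n i); last first.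
  apply/funext => n; rewrite (fsum_ord (N := N t n)); last first.
    by move=> i Ni; rewrite increment_out// tprod0l.
  rewrite /weighted_tsum -big_split /=; apply: eq_bigr => i _.
  rewrite /cell_value /sq_remainder.
  have -> : tsq GG (D (Z (Num.min (pi n i) t)) ((Z (Num.min (pi n i.+1) t)).2 -
      (Z (Num.min (pi n i) t)).2)) = k (pi n i) (tsq EE (increment X t (pi n) i)).
    (* In a cell starting at or after [t] the truncated end points coincide, so both sides vanish
       although [k] is taken at [pi n i]. *)
    have [ti|it] := leP t (pi n i).
      rewrite increment_ge// /tsq tprod0l linear0.
      by rewrite min_r ?subrr ?linear0 ?tprod0l// (le_trans ti)// partition_le.
    rewrite -[LHS](tensor_op_tprod alpha_uniform EE GG) /k /op /tsq /increment /=.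
    by rewrite (min_l (ltW it)).
  by rewrite addrC subrK.
apply: convergesD; first exact: weighted_tsum_converges.
apply: converges_strong.
have [B HB] := gauge_bound t0.
have [c c0 Hc] := sq_remainder_le alpha_uniform GG f_lip cD (@cK t).
apply: (sum_cell_value_cvg cZ ppi (piN t) (fun d => fpi t0) (@KZ t) (@Kl t)
  (@sq_gauge_ge0 R E F) (@sq_gauge_id R E F) HB (sq_gauge_uniform (@cK t))
  (@sq_gauge_sep R E F) (sq_remainder_uniform alpha_uniform GG f_lip cD (@cK t)) c0 Hc _ t0).
exact: (sq_remainder_small alpha_uniform GG f_lip fD cD (@cK t)).
Qed.

End Limit.

Lemma tensor_quadratic_variation_image : exists QY : R -> GG,
  tensor_quadratic_variation m pi Y QY /\
  forall t, 0 <= t -> summable_upto dY t /\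
    exists2 I : GG, is_stieltjes_integral
      (fun s => tensor_op EE GG (D (left_lim A s, left_lim X s))
                                (D (left_lim A s, left_lim X s))) Qc t I
      & QY t = I + sum_upto dY t.
Proof.
have [I HI] := stieltjes_path_ex ck fQc rQc.
have HI2 t (t0 : 0 <= t) := (HI t t0).2.
exists (fun t => I t + sum_upto dY t); split; last first.
  move=> t t0; split; first exact: summable_uptoT.
  exists (I t) => //; apply: eq_stieltjes_integral (HI t t0).1 => s /andP[s0 _].
  by rewrite left_limk// left_limZ.
(* The integral path is continuous, so the left limit misses exactly [dY t], the required jump. *)
have leftQY t : 0 < t -> I s + sum_upto dY s @[s --> t^'-] --> I t + (sum_upto dY t - dY t).
  move=> t0; apply: cvgD; last exact: sum_upto_left.
  exact: (stieltjes_left_continuous ck fQc HI2 lQc).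
split.
- exact: cY.
- split.
    split=> t t0; last by apply/cvg_ex; eexists; exact: leftQY.
    by apply: cvgD; [exact: (stieltjes_right_continuous ck fQc rQc HI2)|exact: sum_upto_right].
  apply: finite_variationD; first exact: (stieltjes_finite_variation ck fQc HI2).
  exact: finite_variation_sum_upto.
- by move=> t t0; exact: tsum_image_converges.
- move=> t t0; rewrite /jump; case: ifPn => [t_gt0|t_le0].
    by rewrite (left_limE (leftQY t t_gt0)) opprD opprB addrACA subrr add0r subrKC /dY /jump t_gt0.
  by rewrite tprod0l.
Qed.

End QuadraticVariation.

Theorem corollary5p14 (R : realType) (E F G : completeNormedModType R)
    (alpha : tensor_norm_family) (alpha_uniform : uniform_crossnorm alpha)
    (EE : tensor_completion alpha E E) (GG : tensor_completion alpha G G)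
    (pi : nat -> nat -> R) (pi_partition : forall n, is_partition (pi n))
    (X : R -> E) (X_cadlag : cadlag X)
    (A : R -> F) (A_cadlag : cadlag A) (A_fv : finite_variation A)
    (f : F * E -> G) (f_lipschitz : lipschitz_on_compacts f)
    (Dxf : F * E -> 'L(E, G))
    (f_gateaux : forall a x,
      gateaux_derivative (fun y => f (a, y)) x (Dxf (a, x)))
    (Dxf_continuous : continuous_on_compacts Dxf)
    (pi_fine : mesh (pi n) @[n --> \oo] --> 0%E \/
      forall t, 0 <= t ->
        osc_left (fun s => (A s, X s)) t (pi n) @[n --> \oo] --> 0%E)
    (m : convergence_mode) (QX : R -> EE)
    (X_qv : tensor_quadratic_variation m pi X QX)
    (X_2variation : finite_2variation X pi) :
  let Y := fun t => f (A t, X t) in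
  exists QY : R -> GG,
    tensor_quadratic_variation m pi Y QY /\
    forall t, 0 <= t ->
      summable_upto (fun s => tprod GG (jump Y s) (jump Y s)) t /\
      exists2 I : GG,
        is_stieltjes_integral
          (fun s => tensor_op EE GG (Dxf (left_lim A s, left_lim X s))
                                    (Dxf (left_lim A s, left_lim X s)))
          (continuous_part QX) t I
        & QY t = I + sum_upto (fun s => tprod GG (jump Y s) (jump Y s)) t.
Proof.
move=> Y; apply: (tensor_quadratic_variation_image alpha_uniform GG pi_partition
  X_cadlag A_cadlag A_fv f_lipschitz f_gateaux Dxf_continuous _ X_qv X_2variation).
move=> t d t0 d0; case: pi_fine => [meshpi|oscpi].
  by apply: fine_mesh => //; exact: (cadlag_pair A_cadlag X_cadlag).1.
by apply: fine_osc_left => //; exact: oscpi.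
Qed.
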